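(* Let $K>1$ and $\theta\in(-\pi/2,\pi/2]$. For every $t>t_0$, the set $\{c\in\mathbb{C}:G_{\mathcal{M}}(c)\le t\}$ is a closed topological disk containing $\mathcal{M}_{K,\theta}$, and $\mathcal{M}_{K,\theta}$ carries external parameter rays and equipotentials at all potentials greater than $t_0$.
   Context: Fix $K>1$ and $\theta\in(-\pi/2,\pi/2]$. Let $h(z)=\frac{K+1}{2}z+e^{2i\theta}\frac{K-1}{2}\overline{z}$ (real-linear stretch by factor $K$ in the direction $e^{i\theta}$). For $c\in\mathbb{C}$ let $f_c(z)=h(z)^2+c$, with iterates $f_c^n$. Set $I(f_c)=\{z: f_c^n(z)\to\infty\}$, $BO(f_c)=\mathbb{C}\setminus I(f_c)$, $\mathcal{M}_{K,\theta}=\{c\in\mathbb{C}:0\in BO(f_c)\}$, and $P_n(c)=f_c^n(c)=f_c^{n+1}(0)$ for $n\ge0$. Böttcher coordinate $\psi_c$ (known, Fletcher–Fryer): near infinity put $\psi_0=\mathrm{id}$ and $\psi_{k+1}=f_0^{-1}\circ\psi_k\circ f_c$, the branch of $f_0^{-1}$ being chosen so that $\psi_{k+1}(z)=z+o(1)$ as $|z|\to\infty$. The sequence $(\psi_k)$ converges uniformly on a neighbourhood of infinity $U_c$ (which may be taken with $f_c(U_c)\subset U_c$ and $U_c\cup\{\infty\}$ simply connected) to a quasiconformal map $\psi_c$ with $\psi_c\circ f_c=f_0\circ\psi_c$ on $U_c$. If $c\notin\mathcal{M}_{K,\theta}$ and $n$ is the least integer with $c\in f_c^{-n}(U_c)$,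 then $\psi_c$ extends, by lifting curves under $f_c$ and $f_0$, to an injective continuous map on $f_c^{-n}(U_c)$ still satisfying $\psi_c\circ f_c=f_0\circ\psi_c$; this extension is uniquely determined by $\psi_c|_{U_c}$ and is again denoted $\psi_c$. Then $\Psi(c):=\psi_c(c)$ for $c\in\mathbb{C}\setminus\mathcal{M}_{K,\theta}$. Green's function (known, Broderius–Fletcher): for each $\phi$ the ray $\{te^{i\phi}:t\ge0\}$ meets $\partial I(f_0)$ in exactly one point $b_{K,\theta}(\phi)$. $G_0(z)=\log(|z|/|b_{K,\theta}(\arg z)|)$ for $z\in I(f_0)$ and $G_0=0$ on $BO(f_0)$. For general $c$, $G_c=G_0\circ\psi_c$ in a neighbourhood of infinity, extended to $I(f_c)$ by $G_c(f_c(z))=2G_c(z)$, and $G_c=0$ on $BO(f_c)$. $G_c:\mathbb{C}\to[0,\infty)$ is continuous, positive exactly on $I(f_c)$. Set $G_{\mathcal{M}}(c):=G_c(c)$. For $n\ge1$, $\sigma_n(c):=\sum_{j=1}^n\prod_{i=0}^{j-1}\frac{1}{2|h(P_i(c))|}$ and $\sigma(c):=\lim_{n}\sigma_n(c)\in(0,\infty]$, with $\sigma_n(c)=\sigma(c)=\infty$ if $P_i(c)=0$ for some $i\le n-1$. $\Omega^*:=\{c\in\mathbb{C}\setminus\mathcal{M}_{K,\theta}:\sigma(c)<1\}$ and $t_0:=\inf\{t>0:\{G_{\mathcal{M}}>s\}\subset\Omega^*\text{ for all }s\ge t\}$. ''Carries external parameter rays and equipotentials at all potentials greater than $t_0$''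 means: for every $t'>t_0$, $\Psi$ restricts to a homeomorphism $\{G_{\mathcal{M}}>t'\}\to\{G_0>t'\}$ with $G_0\circ\Psi=G_{\mathcal{M}}$; the external rays and equipotentials of $\mathcal{M}_{K,\theta}$ at potentials in $(t',\infty)$ are the preimages under this homeomorphism of the radial arcs $\{re^{i\phi}:r>e^{t'}|b_{K,\theta}(\phi)|\}$ and of the Jordan curves $\{G_0=t\}=e^t\partial I(f_0)$, $t>t'$, respectively. *)

(* Defs.v *)
(* Classical Stdlib reals with Coquelicot's complex numbers; partially defined
   objects (Böttcher map, Green's function, ...) are selected from their
   defining property with Hilbert's epsilon. *)
From Stdlib Require Import Reals ClassicalEpsilon.
From Coquelicot Require Import Coquelicot.

Open Scope R_scope.

(** * Plane topology *)

Definition boundary (A : C -> Prop) (z : C) : Prop :=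
  ~ locally z A /\ ~ locally z (fun w => ~ A w).

Definition injective_on (A : C -> Prop) (f : C -> C) : Prop :=
  forall z w, A z -> A w -> f z = f w -> z = w.

Definition homeomorphism_on (A B : C -> Prop) (f : C -> C) : Prop :=
  (forall z, A z -> B (f z)) /\ continuous_on A f /\
  exists g : C -> C,
    (forall w, B w -> A (g w)) /\ continuous_on B g /\
    (forall z, A z -> g (f z) = z) /\ (forall w, B w -> f (g w) = w).

Definition closed_topological_disk (A : C -> Prop) : Prop :=
  exists f, homeomorphism_on (fun z => Cmod z <= 1) A f.

Definition jordan_curve (A : C -> Prop) : Prop :=
  exists f, homeomorphism_on (fun z => Cmod z = 1) A f.

Definition cis (phi : R) : C := (cos phi, sin phi).

(** * The family f_c *)

Definition h (K theta : R) (z : C) : C :=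
  (RtoC ((K + 1) / 2) * z
   + cis (2 * theta) * RtoC ((K - 1) / 2) * Cconj z)%C.

Definition f (K theta : R) (c z : C) : C := (h K theta z ^ 2 + c)%C.

Definition f_iter (K theta : R) (c : C) (n : nat) (z : C) : C :=
  Nat.iter n (f K theta c) z.

Definition escaping (K theta : R) (c z : C) : Prop :=
  is_lim_seq (fun n => Cmod (f_iter K theta c n z)) p_infty.

Definition BO (K theta : R) (c z : C) : Prop := ~ escaping K theta c z.

Definition mandelbrot (K theta : R) (c : C) : Prop := BO K theta c 0.

Definition P (K theta : R) (n : nat) (c : C) : C := f_iter K theta c n c.

(** * The Böttcher coordinate *)

Definition near_infinity (r : R) (z : C) : Prop := r < Cmod z.

Definition asymptotic_to_id (g : C -> C) : Prop :=
  forall eps : posreal, exists M : R,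
    forall z, M < Cmod z -> Cmod (g z - z)%C < eps.

(* [psi] is the Böttcher coordinate on U = {|z| > r}.  Choosing the branch of
   f_0^{-1} in psi_{k+1} = f_0^{-1} o psi_k o f_c amounts to choosing a
   continuous solution of f_0 o psi_{k+1} = psi_k o f_c on U. *)
Definition bottcher (K theta : R) (c : C) (r : R) (psi : C -> C) : Prop :=
  0 < r /\
  (forall z, near_infinity r z -> near_infinity r (f K theta c z)) /\
  exists psi_ : nat -> C -> C,
    (forall z, near_infinity r z -> psi_ 0%nat z = z) /\
    (forall k : nat,
       continuous_on (near_infinity r) (psi_ (S k)) /\
       asymptotic_to_id (psi_ (S k)) /\
       forall z, near_infinity r z ->
         f K theta 0 (psi_ (S k) z) = psi_ k (f K theta c z)) /\
    (forall eps : posreal, exists N : nat, forall k z,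
       (N <= k)%nat -> near_infinity r z ->
       Cmod (psi_ k z - psi z)%C < eps).

Definition pullback (K theta : R) (c : C) (r : R) (n : nat) (z : C) : Prop :=
  near_infinity r (f_iter K theta c n z).

(* The extension to f_c^{-n}(U), for n minimal with c in f_c^{-n}(U). *)
Definition bottcher_ext (K theta : R) (c : C) (r : R) (n : nat)
    (psi : C -> C) : Prop :=
  bottcher K theta c r psi /\
  pullback K theta c r n c /\
  (forall m : nat, pullback K theta c r m c -> (n <= m)%nat) /\
  continuous_on (pullback K theta c r n) psi /\
  injective_on (pullback K theta c r n) psi /\
  (forall z, pullback K theta c r n z ->
     psi (f K theta c z) = f K theta 0 (psi z)).

(* The value psi_c(c) is required to be the one given by every sufficiently
   small neighbourhood {|z| > r} of infinity, so that it involves no choice. *)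
Definition Psi_value (K theta : R) (c w : C) : Prop :=
  exists r0 : R, forall r : R, r0 < r ->
    exists (n : nat) (psi : C -> C),
      bottcher_ext K theta c r n psi /\ psi c = w.

Definition Psi (K theta : R) (c : C) : C :=
  epsilon (inhabits (RtoC 0)) (Psi_value K theta c).

(** * Green's functions *)

Definition ray (phi : R) (z : C) : Prop :=
  exists t : R, 0 <= t /\ z = (RtoC t * cis phi)%C.

Definition b (K theta phi : R) : C :=
  epsilon (inhabits (RtoC 0))
    (fun z => ray phi z /\ boundary (escaping K theta 0) z).

Definition arg (z : C) : R :=
  epsilon (inhabits 0)
    (fun phi => - PI < phi <= PI /\ z = (RtoC (Cmod z) * cis phi)%C).

Definition G0 (K theta : R) (z : C) : R :=
  if excluded_middle_informative (escaping K theta 0 z)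
  then ln (Cmod z / Cmod (b K theta (arg z)))
  else 0.

Definition is_green (K theta : R) (c : C) (g : C -> R) : Prop :=
  (exists (r : R) (psi : C -> C), bottcher K theta c r psi /\
     exists M : R, forall z, M < Cmod z -> g z = G0 K theta (psi z)) /\
  (forall z, escaping K theta c z -> g (f K theta c z) = 2 * g z) /\
  (forall z, BO K theta c z -> g z = 0).

Definition G (K theta : R) (c : C) : C -> R :=
  epsilon (inhabits (fun _ : C => 0)) (is_green K theta c).

Definition GM (K theta : R) (c : C) : R := G K theta c c.

(** * The threshold t_0 *)

Definition sigma_n (K theta : R) (c : C) (n : nat) : R :=
  sum_n_m
    (fun j => prod_f_R0 (fun i => 1 / (2 * Cmod (h K theta (P K theta i c))))
                (Nat.pred j))
    1 n.

(* Nondecreasing in n unless some P_i(c) vanishes, so [Lim_seq] is a genuine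
   limit. *)
Definition sigma (K theta : R) (c : C) : Rbar :=
  if excluded_middle_informative (exists i : nat, P K theta i c = RtoC 0)
  then p_infty
  else Lim_seq (sigma_n K theta c).

Definition Omega_star (K theta : R) (c : C) : Prop :=
  ~ mandelbrot K theta c /\ Rbar_lt (sigma K theta c) 1.

Definition t0 (K theta : R) : Rbar :=
  Glb_Rbar (fun t => 0 < t /\
    forall s : R, t <= s -> forall c, s < GM K theta c -> Omega_star K theta c).

(** * Parameter rays and equipotentials *)

Definition radial_arc (K theta t' phi : R) (w : C) : Prop :=
  exists r : R, exp t' * Cmod (b K theta phi) < r /\ w = (RtoC r * cis phi)%C.

Definition parameter_ray (K theta t' phi : R) (c : C) : Prop :=
  t' < GM K theta c /\ radial_arc K theta t' phi (Psi K theta c).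

Definition parameter_equipotential (K theta t' t : R) (c : C) : Prop :=
  t' < GM K theta c /\ G0 K theta (Psi K theta c) = t.

Definition carries_rays_and_equipotentials_above
    (K theta : R) (T : Rbar) : Prop :=
  forall t' : R, Rbar_lt T t' ->
    homeomorphism_on (fun c => t' < GM K theta c)
      (fun w => t' < G0 K theta w) (Psi K theta) /\
    (forall c, t' < GM K theta c ->
       G0 K theta (Psi K theta c) = GM K theta c) /\
    (forall phi : R,
       homeomorphism_on (parameter_ray K theta t' phi)
         (radial_arc K theta t' phi) (Psi K theta)) /\
    (forall t : R, t' < t ->
       homeomorphism_on (parameter_equipotential K theta t' t)
         (fun w => G0 K theta w = t) (Psi K theta) /\
       jordan_curve (fun w => G0 K theta w = t) /\
       (forall w, G0 K theta w = t <->
          exists z, boundary (escaping K theta 0) z /\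
                    w = (RtoC (exp t) * z)%C)).

(* Main.v *)
(** The point [w] is the Böttcher coordinate of [z] when the orbit of [z] under
    [f_c] and that of [w] under [f_0] stay within bounded distance.  Since [f_c]
    expands distances near infinity, such a [w] is unique, and differences of
    orbits can be pulled back: if [z_n], [z'_n] are orbits of [f_c], [f_c'] then
    |z_0 - z'_0| <= |c - c'| sum_j prod_{i<j} 1/|h(z_i + z'_i)| once the orbits
    shadow the same orbit of [f_0].

    Let [eta_c(w)] be the point of coordinate [w] in the plane of [f_c].
    The c with [Psi c = w] are the solutions of [c = eta_c(w)].  By the
    estimate above the right-hand side is, near [c], Lipschitz in [c] with
    constant about sigma(c); so where sigma < 1 it is a contraction and [Psi] is
    a local homeomorphism.  Since G0 o Psi = GM makes [Psi] proper, the number of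
    preimages of s w is locally constant in s >= 1, and it is 1 for large s by
    the same contraction argument; hence [Psi] is a homeomorphism above t0.

    For the disk, replace the parameter c in [eta_c(w)] by a Lipschitz cut-off
    [m(c)] that is 0 for small c and c for large c.  The contraction argument
    still solves [c = eta_{m(c)}(w)], which gives a homeomorphism of the plane
    equal to the identity on a disk and to the inverse of [Psi] near infinity.
    It maps {G0 <= T} onto {GM <= T} for T large, and the radial structure of
    [Psi] coordinates moves the level T down to t. *)

(* The maps are not holomorphic; what replaces complex analysis is the real-linearity of [h], which
   gives h(z)^2 - h(w)^2 = h(z - w) h(z + w), together with |h(z)| >= |z|. Two orbits within 5 of a
   third one of modulus at least 10 have sums of modulus at least 10, so each step expands their
   difference tenfold, up to the difference of the parameters. The recurring 1/9 is 1/10 + 1/100 +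
   ...

   [Psi] is defined through an injective extension of the Böttcher map to a whole preimage of {|z| >
   r}, a domain of unknown shape on which square roots must be chosen. They are chosen by flowing
   each point outward, radially in the image under the iterate, and lifting that flow one preimage
   at a time; this works because the critical value has not yet left {|z| <= r}.

   Topology is kept elementary: continuity of inverses comes from uniqueness of cluster points, and
   connectedness is used for intervals only. In the same spirit the disk is obtained from an
   explicit homeomorphism of the plane instead of a Jordan-Schoenflies argument, since [Psi] says
   nothing about the inside of a level curve. *)
Require Import Defs.
From Stdlib Require Import Reals Arith Lra Lia ClassicalEpsilon.
From Coquelicot Require Import Coquelicot.
Open Scope R_scope.

(** * Convergence of complex sequences *)

Definition Ccv (u : nat -> C) (l : C) : Prop :=
  is_lim_seq (fun n => Cmod (u n - l)) 0.

Lemma Ccv_iff (u : nat -> C) (l : C) :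
  Ccv u l <-> forall eps : R, 0 < eps ->
    exists N, forall n, (N <= n)%nat -> Cmod (u n - l) < eps.
Proof.
  unfold Ccv. split.
  - intros H eps He. apply is_lim_seq_spec in H.
    destruct (H (mkposreal eps He)) as [N HN]. exists N. intros n Hn.
    specialize (HN n Hn). simpl in HN. rewrite Rminus_0_r in HN.
    now rewrite Rabs_pos_eq in HN by apply Cmod_ge_0.
  - intros H. apply is_lim_seq_spec. intros eps.
    destruct (H eps (cond_pos eps)) as [N HN]. exists N. intros n Hn.
    rewrite Rminus_0_r, Rabs_pos_eq by apply Cmod_ge_0. now apply HN.
Qed.

Lemma Ccv_le (u : nat -> C) (l : C) (e : nat -> R) :
  (forall n, Cmod (u n - l) <= e n) -> is_lim_seq e 0 -> Ccv u l.
Proof.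
  intros H He. unfold Ccv.
  apply is_lim_seq_le_le with (fun _ => 0) e; auto using is_lim_seq_const.
  intros n; split; auto using Cmod_ge_0.
Qed.

Lemma Ccv_parts (u : nat -> C) (l : C) :
  Ccv u l <-> is_lim_seq (fun n => fst (u n)) (fst l) /\
              is_lim_seq (fun n => snd (u n)) (snd l).
Proof.
  assert (Hs : forall v x, is_lim_seq v (Finite x) <->
    is_lim_seq (fun n => Rabs (v n - x)) 0).
  { intros v x. split; intro H.
    - replace (Finite 0) with (Rbar_abs (Finite 0)) by (simpl; now rewrite Rabs_R0).
      apply (is_lim_seq_abs (fun n => v n - x) (Finite 0)).
      replace 0 with (x - x) by ring. apply is_lim_seq_minus'; auto using is_lim_seq_const.
    - apply is_lim_seq_abs_0 in H.
      apply is_lim_seq_ext with (fun n => (v n - x) + x); [intros; ring|].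
      replace (Finite x) with (Finite (0 + x)) by (f_equal; ring).
      apply is_lim_seq_plus'; auto using is_lim_seq_const. }
  rewrite (Hs _ (fst l)), (Hs _ (snd l)). unfold Ccv. split.
  - intro H.
    assert (Hm : forall n, Rabs (fst (u n) - fst l) <= Cmod (u n - l) /\
                           Rabs (snd (u n) - snd l) <= Cmod (u n - l)).
    { intro n. assert (Hm := Rmax_Cmod (u n - l)%C).
      split; (eapply Rle_trans; [|exact Hm]); [apply Rmax_l|apply Rmax_r]. }
    split; apply (is_lim_seq_le_le (fun _ => 0) _ (fun n => Cmod (u n - l)));
      auto using is_lim_seq_const; intro n; split; try apply Rabs_pos; apply Hm.
  - intros [H1 H2].
    apply (is_lim_seq_le_le (fun _ => 0) _
      (fun n => Rabs (fst (u n) - fst l) + Rabs (snd (u n) - snd l))).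
    + intro n; split; [apply Cmod_ge_0|].
      replace (u n - l)%C with
        (RtoC (fst (u n) - fst l) + RtoC (snd (u n) - snd l) * Ci)%C
        by (apply injective_projections; simpl; ring).
      eapply Rle_trans; [apply Cmod_triangle|].
      rewrite Cmod_mult, !Cmod_R.
      replace (Cmod Ci) with 1
        by (unfold Cmod, Ci; simpl; rewrite <- sqrt_1 at 1; f_equal; ring).
      lra.
    + apply is_lim_seq_const.
    + replace 0 with (0 + 0) by ring. now apply is_lim_seq_plus'.
Qed.

Lemma Ccv_ext (u v : nat -> C) (l : C) :
  (forall n, u n = v n) -> Ccv u l -> Ccv v l.
Proof.
  intros H. unfold Ccv. apply is_lim_seq_ext. intro n; now rewrite H.
Qed.

Lemma Ccv_ext_loc (u v : nat -> C) (l : C) (N : nat) :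
  (forall n, (N <= n)%nat -> u n = v n) -> Ccv u l -> Ccv v l.
Proof.
  intros H. unfold Ccv. apply is_lim_seq_ext_loc. exists N. intros n Hn; now rewrite H.
Qed.

Lemma Ccv_const (l : C) : Ccv (fun _ => l) l.
Proof. apply Ccv_parts; split; apply is_lim_seq_const. Qed.

Lemma Ccv_plus (u v : nat -> C) (l m : C) :
  Ccv u l -> Ccv v m -> Ccv (fun n => u n + v n)%C (l + m)%C.
Proof.
  rewrite !Ccv_parts. intros [] []; split; simpl; now apply is_lim_seq_plus'.
Qed.

Lemma Ccv_opp (u : nat -> C) (l : C) : Ccv u l -> Ccv (fun n => - u n)%C (- l)%C.
Proof.
  rewrite !Ccv_parts. intros [H1 H2]; split; simpl;
  [apply (is_lim_seq_opp _ _) in H1|apply (is_lim_seq_opp _ _) in H2]; auto.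
Qed.

Lemma Ccv_minus (u v : nat -> C) (l m : C) :
  Ccv u l -> Ccv v m -> Ccv (fun n => u n - v n)%C (l - m)%C.
Proof. intros H1 H2. apply Ccv_plus; auto using Ccv_opp. Qed.

Lemma Ccv_mult (u v : nat -> C) (l m : C) :
  Ccv u l -> Ccv v m -> Ccv (fun n => u n * v n)%C (l * m)%C.
Proof.
  rewrite !Ccv_parts. intros [] []; split; simpl.
  - apply is_lim_seq_minus'; now apply is_lim_seq_mult'.
  - apply is_lim_seq_plus'; now apply is_lim_seq_mult'.
Qed.

Lemma Ccv_conj (u : nat -> C) (l : C) : Ccv u l -> Ccv (fun n => Cconj (u n)) (Cconj l).
Proof.
  rewrite !Ccv_parts. intros [H1 H2]; split; simpl; auto.
  now apply (is_lim_seq_opp _ _) in H2.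
Qed.

Lemma Ccv_RtoC (u : nat -> R) (l : R) : is_lim_seq u l -> Ccv (fun n => RtoC (u n)) (RtoC l).
Proof.
  rewrite !Ccv_parts. intros H; split; simpl; auto using is_lim_seq_const.
Qed.

Lemma Ccv_norm_sqr (u : nat -> C) (l : C) : Ccv u l ->
  is_lim_seq (fun n => fst (u n) ^ 2 + snd (u n) ^ 2) (fst l ^ 2 + snd l ^ 2).
Proof.
  rewrite Ccv_parts. intros [H1 H2].
  apply is_lim_seq_plus'.
  - apply (is_lim_seq_continuous (fun x => x ^ 2)); auto. reg.
  - apply (is_lim_seq_continuous (fun x => x ^ 2)); auto. reg.
Qed.

Lemma Ccv_Cmod (u : nat -> C) (l : C) : Ccv u l -> is_lim_seq (fun n => Cmod (u n)) (Cmod l).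
Proof.
  intro H. unfold Cmod. apply (is_lim_seq_continuous sqrt).
  - apply continuity_pt_sqrt. nra.
  - now apply Ccv_norm_sqr.
Qed.

Lemma Ccv_inv (u : nat -> C) (l : C) : Ccv u l -> l <> 0%C -> Ccv (fun n => / u n)%C (/ l)%C.
Proof.
  intros H Hl. assert (Hd := Ccv_norm_sqr u l H).
  apply Ccv_parts in H. destruct H as [H1 H2]. apply Ccv_parts.
  assert (Hn : fst l ^ 2 + snd l ^ 2 <> 0).
  { intro E. apply Hl. destruct l as [x y]; simpl in *. unfold RtoC. f_equal; nra. }
  split; unfold Cinv; cbv [fst snd]; fold (fst l) (snd l).
  - apply is_lim_seq_div'; auto.
  - apply is_lim_seq_div'; auto.
    now apply (is_lim_seq_opp _ _) in H2.
Qed.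

Lemma Ccv_div (u v : nat -> C) (l m : C) :
  Ccv u l -> Ccv v m -> m <> 0%C -> Ccv (fun n => u n / v n)%C (l / m)%C.
Proof. intros. apply Ccv_mult; auto using Ccv_inv. Qed.

(** A subsequence is encoded as any index map with [n <= p n], monotone or not: such maps compose
    and preserve limits, which is all that the compactness arguments use. *)
Lemma is_lim_seq_subs (u : nat -> R) (l : Rbar) (p : nat -> nat) :
  (forall n, (n <= p n)%nat) -> is_lim_seq u l -> is_lim_seq (fun n => u (p n)) l.
Proof.
  intros Hp Hu. apply (filterlim_comp _ _ _ p u _ eventually); auto.
  intros Q [N HN]. exists N. intros n Hn. apply HN. specialize (Hp n). lia.
Qed.

Lemma Ccv_subs (u : nat -> C) (l : C) (p : nat -> nat) :
  (forall n, (n <= p n)%nat) -> Ccv u l -> Ccv (fun n => u (p n)) l.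
Proof.
  intros Hp H. exact (is_lim_seq_subs (fun n => Cmod (u n - l)) 0 p Hp H).
Qed.

Lemma Ccv_shift (u : nat -> C) (l : C) (N : nat) :
  Ccv (fun n => u (N + n)%nat) l -> Ccv u l.
Proof.
  intro H. apply (is_lim_seq_incr_n (fun n => Cmod (u n - l)) N).
  apply is_lim_seq_ext with (fun n => Cmod (u (N + n)%nat - l)); auto.
  intro n. now rewrite Nat.add_comm.
Qed.

Lemma Ccv_tail (u : nat -> C) (l : C) (N : nat) :
  Ccv u l -> Ccv (fun n => u (N + n)%nat) l.
Proof. apply (Ccv_subs u l (fun n => (N + n)%nat)). intro; lia. Qed.

Lemma Cmod_minus_sym (z w : C) : Cmod (z - w) = Cmod (w - z).
Proof. rewrite <- Cmod_opp. f_equal. ring. Qed.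

Lemma Cmod_minus_triangle (x y z : C) :
  Cmod (x - z) <= Cmod (x - y) + Cmod (y - z).
Proof.
  replace (x - z)%C with ((x - y) + (y - z))%C by ring. apply Cmod_triangle.
Qed.

Lemma Cmod_rev_triangle (x y : C) : Cmod x - Cmod y <= Cmod (x - y).
Proof.
  assert (H := Cmod_triangle (x - y) y). replace (x - y + y)%C with x in H by ring. lra.
Qed.

Lemma Cmod_plus_ge (x y : C) : Cmod x - Cmod y <= Cmod (x + y).
Proof.
  assert (H := Cmod_triangle (x + y) (- y)). replace (x + y + - y)%C with x in H by ring.
  rewrite Cmod_opp in H. lra.
Qed.

Lemma Cminus_eq0 (x y : C) : (x - y)%C = 0%C -> x = y.
Proof. intro H. replace x with ((x - y) + y)%C by ring. rewrite H. ring. Qed.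

Lemma Cmod_minus_le0 (x y : C) : Cmod (x - y) <= 0 -> x = y.
Proof.
  intro H. apply Cminus_eq0, Cmod_eq_0. apply Rle_antisym; auto using Cmod_ge_0.
Qed.

Lemma Cmod_pos_iff (z : C) : 0 < Cmod z -> z <> 0%C.
Proof. intros H ->. rewrite Cmod_0 in H. lra. Qed.

Lemma Cmod_diag (z : C) : Cmod (z - z) = 0.
Proof. replace (z - z)%C with (RtoC 0) by ring. apply Cmod_0. Qed.

Lemma Cdouble (z : C) : (z + z)%C = (RtoC 2 * z)%C.
Proof. apply injective_projections; simpl; ring. Qed.

Lemma RtoC_mult_neq_0 (r : R) (z : C) : 0 < r -> z <> 0%C -> (RtoC r * z)%C <> 0%C.
Proof.
  intros Hr Hz. apply Cmult_neq_0; auto. intro E. apply RtoC_inj in E. lra.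
Qed.

Lemma Csqr_eq (x y : C) : (x * x = y * y)%C -> x = y \/ x = (- y)%C.
Proof.
  intro H.
  assert (H0 : ((x - y) * (x + y))%C = 0%C).
  { transitivity (x * x - y * y)%C; [ring|]. rewrite H. ring. }
  destruct (excluded_middle_informative (x - y = 0)%C) as [E|E].
  - left. now apply Cminus_eq0.
  - right. destruct (excluded_middle_informative (x + y = 0)%C) as [F|F].
    + replace x with ((x + y) - y)%C by ring. rewrite F. ring.
    + now destruct (Cmult_neq_0 _ _ E F).
Qed.

Lemma Ccv_unique (u : nat -> C) (l m : C) : Ccv u l -> Ccv u m -> l = m.
Proof.
  intros H1 H2. apply Cmod_minus_le0.
  apply (is_lim_seq_le (fun _ => Cmod (l - m))
    (fun n => Cmod (u n - l) + Cmod (u n - m)) (Cmod (l - m)) 0).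
  - intro n. rewrite (Cmod_minus_sym (u n) l). apply Cmod_minus_triangle.
  - apply is_lim_seq_const.
  - replace 0 with (0 + 0) by ring. now apply is_lim_seq_plus'.
Qed.

Lemma Ccv_lim_bound (u : nat -> C) (l a : C) (M : R) :
  Ccv u l -> (forall n, Cmod (u n - a) <= M) -> Cmod (l - a) <= M.
Proof.
  intros H HM.
  apply (is_lim_seq_le (fun n => Cmod (u n - a)) (fun _ => M) (Cmod (l - a)) M); auto.
  - apply Ccv_Cmod, Ccv_minus; auto using Ccv_const.
  - apply is_lim_seq_const.
Qed.

Lemma Ccv_Cmod_lt (u : nat -> C) (l : C) (M : R) :
  Ccv u l -> Cmod l < M -> exists N, forall n, (N <= n)%nat -> Cmod (u n) < M.
Proof.
  intros H HM. apply Ccv_iff with (eps := M - Cmod l) in H; [|lra].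
  destruct H as [N HN]. exists N. intros n Hn.
  specialize (HN n Hn). assert (Ht := Cmod_rev_triangle (u n) l). lra.
Qed.

Lemma Ccv_Cmod_gt (u : nat -> C) (l : C) (M : R) :
  Ccv u l -> M < Cmod l -> exists N, forall n, (N <= n)%nat -> M < Cmod (u n).
Proof.
  intros H HM. apply Ccv_iff with (eps := Cmod l - M) in H; [|lra].
  destruct H as [N HN]. exists N. intros n Hn.
  specialize (HN n Hn). rewrite Cmod_minus_sym in HN.
  assert (Ht := Cmod_rev_triangle l (u n)). lra.
Qed.

(** * Compactness *)

Lemma choice_seq (T : Type) (Q : nat -> T -> Prop) :
  (forall n, exists x, Q n x) -> exists u : nat -> T, forall n, Q n (u n).
Proof.
  intro H. exists (fun n => proj1_sig (constructive_indefinite_description _ (H n))).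
  intro n. apply proj2_sig.
Qed.

Lemma is_lim_seq_inv_INR : is_lim_seq (fun n => / INR (S n)) 0.
Proof.
  apply (is_lim_seq_incr_1 (fun n => / INR n)).
  apply (is_lim_seq_inv _ p_infty); [apply is_lim_seq_INR|discriminate].
Qed.

Lemma INR_S_inv_pos (n : nat) : 0 < / INR (S n).
Proof. apply Rinv_0_lt_compat, lt_0_INR. lia. Qed.

Lemma not_eventually (Q : nat -> Prop) :
  ~ (exists N, forall n, (N <= n)%nat -> Q n) ->
  exists p : nat -> nat, forall n, (n <= p n)%nat /\ ~ Q (p n).
Proof.
  intro H. apply (choice_seq nat (fun n m => (n <= m)%nat /\ ~ Q m)).
  intro n. apply NNPP. intro Hm. apply H. exists n.
  intros m Hnm. apply NNPP. intro. apply Hm. now exists m.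
Qed.

(** If no [e] worked, every radius 1/(n+1) would contain a bad point, and these points would form a
    sequence contradicting the hypothesis. This turns sequential statements into uniform
    neighbourhoods. *)
Lemma near_of_seq (T : Type) (d : T -> R) (Q : T -> Prop) :
  (forall u : nat -> T, (forall n, d (u n) <= / INR (S n)) -> exists n, Q (u n)) ->
  exists e, 0 < e /\ forall x, d x <= e -> Q x.
Proof.
  intro H. apply NNPP. intro Hn.
  destruct (choice_seq T (fun n x => d x <= / INR (S n) /\ ~ Q x)) as [u Hu].
  - intro n. apply NNPP. intro Hx. apply Hn. exists (/ INR (S n)).
    split; [apply INR_S_inv_pos|]. intros x Hd. apply NNPP. intro HQ. apply Hx. now exists x.
  - destruct (H u) as [n Hq]; [apply Hu|]. now apply (Hu n).
Qed.

Lemma Ccv_of_radii (u : nat -> C) (l : C) :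
  (forall n, Cmod (u n - l) <= / INR (S n)) -> Ccv u l.
Proof.
  intro H. apply Ccv_le with (fun n => / INR (S n)); auto using is_lim_seq_inv_INR.
Qed.

Lemma real_bolzano (u : nat -> R) (a b : R) :
  (forall n, a <= u n <= b) ->
  exists (p : nat -> nat) (l : R),
    (forall n, (n <= p n)%nat) /\ is_lim_seq (fun n => u (p n)) l.
Proof.
  intros H.
  destruct (Bolzano_Weierstrass u (fun c => a <= c <= b) (compact_P3 a b) H) as [l Hl].
  destruct (choice_seq nat (fun n m => (n <= m)%nat /\ Rabs (u m - l) < / INR (S n)))
    as [p Hp].
  { intro n. destruct (Hl (disc l (mkposreal _ (INR_S_inv_pos n))) n) as [m [Hm Hd]].
    - exists (mkposreal _ (INR_S_inv_pos n)). intros x Hx; exact Hx.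
    - exists m; split; auto. }
  exists p, l. split; [apply Hp|]. apply is_lim_seq_spec. intros eps.
  assert (HI := is_lim_seq_inv_INR). apply is_lim_seq_spec in HI.
  destruct (HI eps) as [N HN]. exists N. intros n Hn.
  specialize (HN n Hn). rewrite Rminus_0_r in HN.
  eapply Rlt_trans; [apply Hp|]. eapply Rle_lt_trans; [apply Rle_abs|exact HN].
Qed.

Lemma complex_bolzano (u : nat -> C) (M : R) :
  (forall n, Cmod (u n) <= M) ->
  exists (p : nat -> nat) (l : C),
    (forall n, (n <= p n)%nat) /\ Ccv (fun n => u (p n)) l.
Proof.
  intros H.
  assert (Hb : forall n, Rmax (Rabs (fst (u n))) (Rabs (snd (u n))) <= M).
  { intro n. eapply Rle_trans; [apply Rmax_Cmod|apply H]. }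
  destruct (real_bolzano (fun n => fst (u n)) (- M) M) as (p & x & Hp & Hx).
  { intro n. apply Rabs_le_between. eapply Rle_trans; [apply Rmax_l|apply Hb]. }
  destruct (real_bolzano (fun n => snd (u (p n))) (- M) M) as (q & y & Hq & Hy).
  { intro n. apply Rabs_le_between. eapply Rle_trans; [apply Rmax_r|apply Hb]. }
  exists (fun n => p (q n)), (x, y). split.
  - intro n. specialize (Hq n). specialize (Hp (q n)). lia.
  - apply Ccv_parts. split; simpl; auto.
    now apply (is_lim_seq_subs (fun n => fst (u (p n))) x q).
Qed.

Lemma Ccv_by_subs (u : nat -> C) (l : C) :
  (forall p, (forall n, (n <= p n)%nat) -> exists q, (forall n, (n <= q n)%nat) /\
     Ccv (fun n => u (p (q n))) l) -> Ccv u l.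
Proof.
  intros H. apply Ccv_iff. intros eps He. apply NNPP. intro Hn.
  destruct (not_eventually _ Hn) as [p Hp].
  destruct (H p) as [q [Hq Hl]]; [apply Hp|].
  apply Ccv_iff with (eps := eps) in Hl; auto. destruct Hl as [N HN].
  specialize (HN N (le_n _)). now destruct (Hp (q N)).
Qed.

(** Every subsequence has a convergent subsequence, whose limit can only be [l]. Identifying cluster
    points is how continuity is proved for maps defined by a choice, such as [Sh] and the inverse of
    [Psi]. *)
Lemma Ccv_of_compact (u : nat -> C) (l : C) (M : R) :
  (forall n, Cmod (u n) <= M) ->
  (forall p l', (forall n, (n <= p n)%nat) -> Ccv (fun n => u (p n)) l' -> l' = l) ->
  Ccv u l.
Proof.
  intros HM H. apply Ccv_by_subs. intros p Hp.
  destruct (complex_bolzano (fun n => u (p n)) M) as (q & l' & Hq & Hl'); auto.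
  exists q. split; auto.
  rewrite (H (fun n => p (q n)) l') in Hl'; auto.
  intro n. specialize (Hq n). specialize (Hp (q n)). lia.
Qed.

(** * Sequential continuity *)

Definition seq_cont_on (A : C -> Prop) (g : C -> C) : Prop :=
  forall u l, A l -> (forall n, A (u n)) -> Ccv u l -> Ccv (fun n => g (u n)) (g l).

Lemma ball_C_Cmod (x y : C) (eps : R) :
  Cmod (y - x) < eps -> @ball C_UniformSpace x eps y.
Proof.
  intro H. assert (Hm := Rmax_Cmod (y - x)%C). split; unfold ball; simpl;
  unfold AbsRing_ball, abs, minus, plus, opp; simpl;
  (eapply Rle_lt_trans; [|exact H]); (eapply Rle_trans; [|exact Hm]);
  [apply Rmax_l|apply Rmax_r].
Qed.

(** Balls of C in the uniform structure are squares, which costs a factor sqrt 2, rounded up to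
    2. *)
Lemma Cmod_ball_C (x y : C) (eps : R) :
  @ball C_UniformSpace x eps y -> Cmod (y - x) < 2 * eps.
Proof.
  intros [H1 H2]. unfold ball in *; simpl in *.
  unfold AbsRing_ball, abs, minus, plus, opp in *; simpl in *.
  eapply Rle_lt_trans; [apply Cmod_2Rmax|].
  assert (Hs : sqrt 2 < 2).
  { rewrite <- (sqrt_square 2) at 2 by lra. apply sqrt_lt_1; lra. }
  assert (Hm : Rmax (Rabs (fst (y - x)%C)) (Rabs (snd (y - x)%C)) < eps)
    by (apply Rmax_lub_lt; assumption).
  assert (0 <= Rmax (Rabs (fst (y - x)%C)) (Rabs (snd (y - x)%C)))
    by (eapply Rle_trans; [apply Rabs_pos|apply Rmax_l]).
  nra.
Qed.

Lemma locally_C_iff (x : C) (A : C -> Prop) :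
  @locally C_UniformSpace x A <->
  exists eps, 0 < eps /\ forall y, Cmod (y - x) < eps -> A y.
Proof.
  split.
  - intros [e He]. exists e. split; [apply cond_pos|].
    intros y Hy. now apply He, ball_C_Cmod.
  - intros (e & He & H). assert (H2 : 0 < e / 2) by lra.
    exists (mkposreal _ H2). intros y Hy. apply H.
    apply Cmod_ball_C in Hy. simpl in Hy. lra.
Qed.

Lemma continuous_on_of_seq (A : C -> Prop) (g : C -> C) :
  seq_cont_on A g -> @continuous_on C_UniformSpace C_UniformSpace A g.
Proof.
  intros H x Hx Q HQ. apply locally_C_iff in HQ. destruct HQ as (e & He & HQ).
  unfold filtermap, within. apply locally_C_iff.
  destruct (near_of_seq C (fun y => Cmod (y - x)) (fun y => A y -> Q (g y))) as (d & Hd & Hy).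
  - intros u Hu. apply NNPP. intro Hn.
    assert (HA : forall n, A (u n) /\ ~ Q (g (u n))).
    { intro n. split; apply NNPP; intro; apply Hn; exists n; tauto. }
    assert (Hc : Ccv (fun n => g (u n)) (g x)).
    { apply H; auto using Ccv_of_radii. intro; apply HA. }
    apply Ccv_iff with (eps := e) in Hc; auto. destruct Hc as [N HN].
    apply (HA N). apply HQ, HN. lia.
  - exists d. split; auto. intros y Hyx. apply Hy. lra.
Qed.

Lemma seq_of_continuous_on (A : C -> Prop) (g : C -> C) :
  @continuous_on C_UniformSpace C_UniformSpace A g -> seq_cont_on A g.
Proof.
  intros H u l Hl HA Hu. apply Ccv_iff. intros e He.
  assert (HL : @locally C_UniformSpace (g l) (fun y => Cmod (y - g l) < e))
    by (apply locally_C_iff; exists e; auto).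
  specialize (H l Hl _ HL). unfold filtermap, within in H.
  apply locally_C_iff in H. destruct H as (d & Hd & H).
  apply Ccv_iff with (eps := d) in Hu; auto. destruct Hu as [N HN].
  exists N. intros n Hn. apply H; auto.
Qed.

Lemma homeomorphism_of_seq (A B : C -> Prop) (f g : C -> C) :
  (forall z, A z -> B (f z)) -> (forall w, B w -> A (g w)) ->
  (forall z, A z -> g (f z) = z) -> (forall w, B w -> f (g w) = w) ->
  seq_cont_on A f -> seq_cont_on B g -> homeomorphism_on A B f.
Proof.
  intros. split; [|split]; auto using continuous_on_of_seq.
  exists g. repeat split; auto using continuous_on_of_seq.
Qed.

(** A cluster point of [g (u n)] lies in the closed set [A], and [f] maps it to the limit of [u], so
    it is determined. *)
Lemma compact_homeomorphism (A B : C -> Prop) (f g : C -> C) (M : R) :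
  (forall z, A z -> Cmod z <= M) ->
  (forall u l, (forall n, A (u n)) -> Ccv u l -> A l) ->
  (forall z, A z -> B (f z)) -> (forall w, B w -> A (g w)) ->
  (forall z, A z -> g (f z) = z) -> (forall w, B w -> f (g w) = w) ->
  seq_cont_on A f -> homeomorphism_on A B f.
Proof.
  intros HM Hcl Hf Hg Hgf Hfg Hc.
  apply homeomorphism_of_seq with g; auto.
  intros u l Hl Hu Hul. apply Ccv_of_compact with M; auto.
  intros p l' Hp Hl'.
  assert (Al' : A l') by (apply (Hcl (fun n => g (u (p n)))); auto).
  assert (H1 : Ccv (fun n => f (g (u (p n)))) (f l')) by (apply Hc; auto).
  assert (H2 : Ccv (fun n => f (g (u (p n)))) l).
  { apply Ccv_ext with (fun n => u (p n)); [intro; now rewrite Hfg|].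
    now apply Ccv_subs. }
  rewrite <- (Ccv_unique _ _ _ H1 H2). auto using eq_sym.
Qed.

(** * Connectedness of intervals *)

Definition seq_closed (a b : R) (Q : R -> Prop) : Prop :=
  forall s l, (forall n, a <= s n <= b) -> a <= l <= b -> is_lim_seq s (Finite l) ->
    (forall n, Q (s n)) -> Q l.

(** Bisection: the lower ends keep [~ Q], the upper ends keep [Q], and their common limit would
    satisfy both. *)
Lemma interval_clopen (a b : R) (Q : R -> Prop) :
  seq_closed a b Q -> seq_closed a b (fun t => ~ Q t) ->
  forall x y, a <= x <= b -> a <= y <= b -> Q x -> Q y.
Proof.
  assert (Main : forall Q : R -> Prop,
    seq_closed a b Q -> seq_closed a b (fun t => ~ Q t) ->
    forall x y, a <= x -> x <= y -> y <= b -> Q y -> Q x).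
  { clear Q. intros Q H1 H2 x y Hax Hxy Hyb Hy. apply NNPP. intro Hx.
    set (q := fun t => if excluded_middle_informative (Q t) then true else false).
    assert (Hq : forall t, q t = true <-> Q t).
    { intro t. unfold q. destruct excluded_middle_informative; split; auto; discriminate. }
    assert (Hq' : forall t, q t = false <-> ~ Q t).
    { intro t. rewrite <- Hq. now rewrite Bool.not_true_iff_false. }
    destruct (dicho_lb_cv x y q Hxy) as [l Hl].
    destruct (dicho_up_cv x y q Hxy) as [l' Hl'].
    assert (E := cv_dicho x y l l' q Hxy Hl Hl'). subst l'.
    apply is_lim_seq_Reals in Hl. apply is_lim_seq_Reals in Hl'.
    assert (Blb : forall n, a <= dicho_lb x y q n <= b).
    { intro n. assert (A1 := dicho_lb_growing x y q Hxy).
      assert (A2 : x <= dicho_lb x y q n)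
        by (apply Rge_le, (growing_prop (dicho_lb x y q) n 0%nat A1); lia).
      assert (A3 := dicho_lb_maj_y x y q Hxy n). lra. }
    assert (Bub : forall n, a <= dicho_up x y q n <= b).
    { intro n. assert (A1 := dicho_up_decreasing x y q Hxy).
      assert (A2 : dicho_up x y q n <= y)
        by (apply (decreasing_prop (dicho_up x y q) 0%nat n A1); lia).
      assert (A3 := dicho_up_min_x x y q Hxy n). lra. }
    assert (Bl : a <= l <= b).
    { split.
      - apply (is_lim_seq_le (fun _ => a) (dicho_lb x y q) a l);
          auto using is_lim_seq_const. intro n; apply Blb.
      - apply (is_lim_seq_le (dicho_lb x y q) (fun _ => b) l b);
          auto using is_lim_seq_const. intro n; apply Blb. }
    apply (H2 (dicho_lb x y q) l); auto.
    - intro n. apply Hq', dicho_lb_car. now apply Hq'.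
    - apply (H1 (dicho_up x y q) l); auto.
      intro n. apply Hq, dicho_up_car. now apply Hq. }
  intros H1 H2 x y Hx Hy HQ. destruct (Rle_lt_dec x y).
  - apply NNPP. intro HnQ. apply (Main (fun t => ~ Q t)) with x y; auto; try lra.
    intros s l Hs Hl Hsl Hn HnQl.
    apply HnQl. apply H1 with s; auto. intro n. apply NNPP. apply Hn.
  - apply Main with x; auto; lra.
Qed.

Definition path_cont (u : R -> C) : Prop :=
  forall s t, (forall n, 0 <= s n <= 1) -> 0 <= t <= 1 ->
    is_lim_seq s (Finite t) -> Ccv (fun n => u (s n)) (u t).

(** Agreement is a closed condition, and so is disagreement, which amounts to [u = - v] with [v]
    nonzero. Every choice of branch below is compared through this lemma. *)
Lemma path_same_sign (u v : R -> C) (t0 : R) :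
  path_cont u -> path_cont v ->
  (forall t, 0 <= t <= 1 -> u t = v t \/ u t = (- v t)%C) ->
  (forall t, 0 <= t <= 1 -> v t <> 0%C) ->
  0 <= t0 <= 1 -> u t0 = v t0 ->
  forall t, 0 <= t <= 1 -> u t = v t.
Proof.
  intros Hu Hv Hs Hn Ht0 E t Ht.
  apply (interval_clopen 0 1 (fun t => u t = v t)) with t0; auto.
  - intros s l Hsn Hl Hsl Hq. apply (Ccv_unique (fun n => u (s n))); auto.
    apply Ccv_ext with (fun n => v (s n)); auto.
  - intros s l Hsn Hl Hsl Hq Hc.
    assert (E2 : u l = (- v l)%C).
    { apply (Ccv_unique (fun n => u (s n))); auto.
      apply Ccv_ext with (fun n => (- v (s n))%C).
      - intro n. destruct (Hs (s n) (Hsn n)) as [H|H]; [now destruct (Hq n)|auto].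
      - apply Ccv_opp; auto. }
    apply (RtoC_mult_neq_0 2 (v l)); auto; [lra|].
    rewrite <- Cdouble. rewrite E2 in Hc. rewrite <- Hc at 1. ring.
Qed.

(** * The principal square root on the right half-plane *)

Definition csqrt (u : C) : C :=
  (sqrt ((Cmod u + fst u) / 2), snd u / (2 * sqrt ((Cmod u + fst u) / 2))).

Lemma csqrt_pos (u : C) : 0 < fst u -> 0 < fst (csqrt u).
Proof.
  intro H. simpl. apply sqrt_lt_R0. assert (H0 := Cmod_ge_0 u). lra.
Qed.

Lemma csqrt_sqr (u : C) : 0 < fst u -> (csqrt u * csqrt u)%C = u.
Proof.
  intro H. assert (Hp := csqrt_pos u H). simpl in Hp.
  unfold csqrt. set (m := sqrt ((Cmod u + fst u) / 2)) in *.
  assert (Hm : m * m = (Cmod u + fst u) / 2).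
  { apply sqrt_sqrt. assert (H0 := Cmod_ge_0 u). lra. }
  assert (Hc : Cmod u * Cmod u = fst u ^ 2 + snd u ^ 2).
  { unfold Cmod. apply sqrt_sqrt. nra. }
  destruct u as [x y]; unfold Cmult; simpl in *. f_equal; [|field; lra].
  replace (y / (2 * m) * (y / (2 * m))) with (y * y / (4 * (m * m))) by (field; lra).
  rewrite Hm. set (c := Cmod (x, y)) in *.
  assert (Hyy : y * y = (c - x) * (c + x)) by nra.
  assert (0 <= c) by apply Cmod_ge_0.
  rewrite Hyy. field. lra.
Qed.

Lemma csqrt_cv (u : nat -> C) (l : C) :
  0 < fst l -> Ccv u l -> Ccv (fun n => csqrt (u n)) (csqrt l).
Proof.
  intros Hl H. assert (Hp := csqrt_pos l Hl). simpl in Hp.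
  assert (HC := Ccv_Cmod u l H). apply Ccv_parts in H. destruct H as [H1 H2].
  assert (Hm : is_lim_seq (fun n => sqrt ((Cmod (u n) + fst (u n)) / 2))
                 (sqrt ((Cmod l + fst l) / 2))).
  { apply (is_lim_seq_continuous sqrt).
    - apply continuity_pt_sqrt. assert (H0 := Cmod_ge_0 l). lra.
    - apply is_lim_seq_div'; auto using is_lim_seq_const, is_lim_seq_plus'. }
  apply Ccv_parts. unfold csqrt. cbv [fst snd]. fold (fst l) (snd l). split; auto.
  apply is_lim_seq_div'; auto.
  - apply is_lim_seq_mult'; auto using is_lim_seq_const.
  - fold (fst l) in Hp. lra.
Qed.

Lemma csqrt_1 : csqrt 1%C = 1%C.
Proof.
  unfold csqrt. simpl. rewrite Cmod_1.
  replace ((1 + 1) / 2) with 1 by field. rewrite sqrt_1.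
  unfold RtoC. f_equal. field.
Qed.

Lemma fst_pos_near_1 (u : C) (d : R) : Cmod (u - 1) <= d -> d < 1 -> 0 < fst u.
Proof.
  intros H Hd. assert (Hm := Rmax_Cmod (u - 1)%C).
  assert (Hl := Rmax_l (Rabs (fst (u - 1)%C)) (Rabs (snd (u - 1)%C))).
  assert (Ha := Rle_abs (- fst (u - 1)%C)). rewrite Rabs_Ropp in Ha.
  simpl in *. lra.
Qed.

Lemma fst_le_Cmod (u : C) : fst u <= Cmod u.
Proof.
  eapply Rle_trans; [apply Rle_abs|]. eapply Rle_trans; [apply Rmax_l|apply Rmax_Cmod].
Qed.

(** In u - 1 = (csqrt u - 1)(csqrt u + 1) the second factor has real part at least 1. *)
Lemma csqrt_near_1 (u : C) : 0 < fst u -> Cmod (csqrt u - 1) <= Cmod (u - 1).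
Proof.
  intro H. assert (Hp := csqrt_pos u H).
  assert (E : (u - 1)%C = ((csqrt u - 1) * (csqrt u + 1))%C).
  { rewrite <- (csqrt_sqr u H) at 1. ring. }
  rewrite E, Cmod_mult.
  assert (H1 : 1 <= Cmod (csqrt u + 1)).
  { eapply Rle_trans; [|apply fst_le_Cmod]. simpl in *. lra. }
  assert (H0 := Cmod_ge_0 (csqrt u - 1)%C). nra.
Qed.

(** * Contractions *)

(** The iterates of [a] are bounded, hence have a cluster point, and consecutive distances decay
    geometrically, which makes that cluster point fixed. *)
Lemma banach (T : C -> C) (a : C) (rad q : R) :
  0 <= rad -> 0 <= q < 1 ->
  (forall z, Cmod (z - a) <= rad -> Cmod (T z - a) <= rad) ->
  (forall z w, Cmod (z - a) <= rad -> Cmod (w - a) <= rad ->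
     Cmod (T z - T w) <= q * Cmod (z - w)) ->
  exists z, Cmod (z - a) <= rad /\ T z = z.
Proof.
  intros Hr Hq HT HL.
  set (z := fun n => Nat.iter n T a).
  assert (Hz : forall n, Cmod (z n - a) <= rad).
  { induction n as [|n IH].
    - change (Cmod (a - a) <= rad).
      now rewrite Cmod_diag.
    - now apply HT. }
  assert (Hd : forall n, Cmod (z (S n) - z n) <= rad * q ^ n).
  { induction n as [|n IH].
    - simpl. rewrite Rmult_1_r. apply (Hz 1%nat).
    - change (Cmod (T (z (S n)) - T (z n)) <= rad * q ^ S n).
      eapply Rle_trans; [apply HL; apply Hz|].
      simpl. replace (rad * (q * q ^ n)) with (q * (rad * q ^ n)) by ring.
      apply Rmult_le_compat_l; [lra|exact IH]. }
  destruct (complex_bolzano z (Cmod a + rad)) as (p & l & Hp & Hl).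
  { intro n. assert (H := Cmod_rev_triangle (z n) a). specialize (Hz n). lra. }
  assert (Hla : Cmod (l - a) <= rad)
    by (apply (Ccv_lim_bound (fun n => z (p n))); auto).
  exists l. split; auto.
  apply (Ccv_unique (fun n => T (z (p n)))).
  - apply Ccv_le with (fun n => q * Cmod (z (p n) - l)).
    + intro n. apply HL; auto.
    + replace 0 with (q * 0) by ring. apply is_lim_seq_mult'; auto using is_lim_seq_const.
  - apply Ccv_ext with (fun n => (z (p n) + (z (S (p n)) - z (p n)))%C).
    + intro n. change (z (S (p n))) with (T (z (p n))). ring.
    + replace l with (l + 0)%C by ring. apply Ccv_plus; auto.
      apply (Ccv_subs (fun n => (z (S n) - z n)%C)); auto.
      apply Ccv_le with (fun n => rad * q ^ n).
      * intro n. replace (z (S n) - z n - 0)%C with (z (S n) - z n)%C by ring. apply Hd.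
      * replace 0 with (rad * 0) by ring. apply is_lim_seq_mult'; auto using is_lim_seq_const.
        apply is_lim_seq_geom. rewrite Rabs_pos_eq; lra.
Qed.

Lemma eventually_finite (N : nat) (Q : nat -> nat -> Prop) :
  (forall i, (i < N)%nat -> exists M, forall k, (M <= k)%nat -> Q i k) ->
  exists M, forall k, (M <= k)%nat -> forall i, (i < N)%nat -> Q i k.
Proof.
  induction N as [|N IH]; intro H.
  - exists 0%nat. intros; lia.
  - destruct IH as [M HM]; [intros i Hi; apply H; lia|].
    destruct (H N) as [M' HM']; [lia|]. exists (Nat.max M M'). intros k Hk i Hi.
    destruct (Nat.eq_dec i N) as [->|Hne]; [apply HM'|apply HM]; lia.
Qed.

Lemma upper_bound4 (a b c d : R) : exists M, a <= M /\ b <= M /\ c <= M /\ d <= M.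
Proof.
  exists (Rmax (Rmax a b) (Rmax c d)).
  assert (H1 := Rmax_l (Rmax a b) (Rmax c d)). assert (H2 := Rmax_r (Rmax a b) (Rmax c d)).
  assert (H3 := Rmax_l a b). assert (H4 := Rmax_r a b).
  assert (H5 := Rmax_l c d). assert (H6 := Rmax_r c d). lra.
Qed.

Lemma inv_pow_cv (a q : R) : 1 < q -> is_lim_seq (fun n => a / q ^ n) 0.
Proof.
  intro Hq. apply is_lim_seq_ext with (fun n => a * (/ q) ^ n).
  - intro n. unfold Rdiv. now rewrite pow_inv.
  - replace (Finite 0) with (Finite (a * 0)) by (f_equal; ring).
    apply is_lim_seq_mult'; [apply is_lim_seq_const|]. apply is_lim_seq_geom.
    assert (H : 0 < / q) by (apply Rinv_0_lt_compat; lra).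
    rewrite Rabs_pos_eq by lra. rewrite <- Rinv_1. apply Rinv_lt_contravar; lra.
Qed.

(** * The inverse stretch, the escape rate of [f_0] and the shadowing map *)

Definition hinv (K theta : R) (w : C) : C :=
  (RtoC ((K + 1) / (2 * K)) * w
   - cis (2 * theta) * RtoC ((K - 1) / (2 * K)) * Cconj w)%C.

(** Approximants of the escape rate of [f_0]. No positive part is taken, so the limit also measures
    how fast bounded orbits tend to 0. *)
Definition Lg_n (K theta : R) (z : C) (n : nat) : R :=
  ln (Cmod (f_iter K theta 0 n z)) / 2 ^ n.

(* [log |z|] corrected by a function of [arg z], so that [Lg] is homogeneous
   and [G0] is its positive part. *)
Definition Lg (K theta : R) (z : C) : R := real (Lim_seq (Lg_n K theta z)).

Lemma Cmod_cis (phi : R) : Cmod (cis phi) = 1.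
Proof.
  unfold Cmod, cis. simpl. rewrite !Rmult_1_r. fold (Rsqr (cos phi)) (Rsqr (sin phi)).
  rewrite Rplus_comm, sin2_cos2. apply sqrt_1.
Qed.

Lemma Cmod_conj (z : C) : Cmod (Cconj z) = Cmod z.
Proof. unfold Cmod. simpl. f_equal. ring. Qed.

Lemma Cconj_mult (z w : C) : Cconj (z * w)%C = (Cconj z * Cconj w)%C.
Proof. apply injective_projections; simpl; ring. Qed.

Lemma Cconj_minus (z w : C) : Cconj (z - w)%C = (Cconj z - Cconj w)%C.
Proof. apply injective_projections; simpl; ring. Qed.

Lemma Cconj_plus (z w : C) : Cconj (z + w)%C = (Cconj z + Cconj w)%C.
Proof. apply injective_projections; simpl; ring. Qed.

Lemma Cmod_RtoC_pos (r : R) : 0 <= r -> Cmod (RtoC r) = r.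
Proof. intro H. rewrite Cmod_R. now apply Rabs_pos_eq. Qed.

Lemma cis_polar (z : C) : z <> 0%C ->
  exists phi, - PI < phi <= PI /\ z = (RtoC (Cmod z) * cis phi)%C.
Proof.
  intro Hz. assert (Hm := Cmod_gt_0 z). apply Hm in Hz. clear Hm.
  set (m := Cmod z) in *.
  assert (Hc : m * m = fst z ^ 2 + snd z ^ 2).
  { unfold m, Cmod. apply sqrt_sqrt. nra. }
  assert (Hx : -1 <= fst z / m <= 1).
  { assert (- m <= fst z <= m) by (split; nra).
    split; apply Rmult_le_reg_r with m; auto; unfold Rdiv;
    rewrite Rmult_assoc, Rinv_l by lra; lra. }
  assert (Hs : sqrt (1 - (fst z / m)²) = Rabs (snd z) / m).
  { replace (1 - (fst z / m)²) with ((Rabs (snd z) / m)²).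
    - apply sqrt_Rsqr. apply Rmult_le_pos; [apply Rabs_pos|].
      left; now apply Rinv_0_lt_compat.
    - unfold Rsqr. replace (Rabs (snd z) / m * (Rabs (snd z) / m))
        with (Rabs (snd z) * Rabs (snd z) / (m * m)) by (field; lra).
      replace (fst z / m * (fst z / m)) with (fst z ^ 2 / (m * m)) by (field; lra).
      rewrite <- Rabs_mult, Rabs_pos_eq by nra. rewrite Hc. field.
      assert (0 < m * m) by nra. lra. }
  assert (Hb := acos_bound (fst z / m)).
  destruct (Rle_lt_dec 0 (snd z)) as [Hy|Hy].
  - exists (acos (fst z / m)). split; [assert (H := PI_RGT_0); lra|].
    unfold cis. rewrite cos_acos, sin_acos, Hs by auto.
    rewrite Rabs_pos_eq by auto.
    apply injective_projections; simpl; field; lra.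
  - exists (- acos (fst z / m)). split.
    + split; [|assert (H := PI_RGT_0); lra].
      assert (Hne : acos (fst z / m) <> PI); [|lra].
      intro E. assert (Hco := cos_acos _ Hx). rewrite E, cos_PI in Hco.
      assert (Hxm : fst z = - m).
      { replace (fst z) with (fst z / m * m) by (field; lra). rewrite <- Hco. ring. }
      rewrite Hxm in Hc. nra.
    + unfold cis. rewrite cos_neg, sin_neg, cos_acos, sin_acos, Hs by auto.
      rewrite Rabs_left by auto.
      apply injective_projections; simpl; field; lra.
Qed.

(** The pull-back of [psi_k] by [f_b] and [f_a], for two arbitrary parameters. Factoring [h z] out
    of the square root leaves a quotient near 1, and its principal root selects the branch
    asymptotic to the identity. *)
Fixpoint psi_seq (K theta : R) (a b : C) (k : nat) (z : C) : C :=
  match k with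
  | O => z
  | S k => hinv K theta (h K theta z *
      csqrt ((psi_seq K theta a b k (Defs.f K theta a z) - b) /
             (h K theta z * h K theta z)))%C
  end.

(** The bound 5 leaves room for the deviation of [psi_seq] from the identity, which is at most (|a|
    + |b| + 5)/|z| <= 4.5 on [far] points. It is also small enough to give uniqueness: two points
    shadowing an orbit of modulus at least 10 have orbits whose sums have modulus at least 2 * 10 -
    5 - 5 = 10. *)
Definition shadows (K theta : R) (a b z z' : C) : Prop :=
  forall n, Cmod (f_iter K theta b n z' - f_iter K theta a n z) <= 5.

(* [Sh a b] conjugates [f_a] to [f_b] near infinity: its value at [z] is the
   only point whose [f_b]-orbit shadows the [f_a]-orbit of [z].  In particular
   [Sh c 0] is the Böttcher coordinate and [Sh 0 c] its inverse. *)
Definition Sh (K theta : R) (a b z : C) : C :=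
  epsilon (inhabits (RtoC 0)) (shadows K theta a b z).

(** Under these bounds |f_a(z)| >= |z|^2 - 2|z| >= 8|z|, so the condition propagates along the
    orbit. *)
Definition far (a z : C) : Prop := 10 <= Cmod z /\ Cmod a <= 2 * Cmod z.

Lemma far_0 (z : C) : 10 <= Cmod z -> far 0 z.
Proof. intro H. split; auto. rewrite Cmod_0. lra. Qed.

Lemma far_of_radius (r : R) (a z : C) :
  10 <= r -> Cmod a <= 2 * r -> r < Cmod z -> far a z.
Proof. intros. split; lra. Qed.

(** * Lifting homotopies through squaring *)

Definition Ccv2 (u : nat -> C * C) (x : C * C) : Prop :=
  Ccv (fun n => fst (u n)) (fst x) /\ Ccv (fun n => snd (u n)) (snd x).

Definition cont2 (D : C * C -> Prop) (g : C * C -> C) : Prop :=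
  forall u x, D x -> (forall n, D (u n)) -> Ccv2 u x -> Ccv (fun n => g (u n)) (g x).

Definition homotopy (D : C * C -> Prop) (F : C * C -> R -> C) : Prop :=
  forall u x s t, D x -> (forall n, D (u n)) -> Ccv2 u x ->
    (forall n, 0 <= s n <= 1) -> 0 <= t <= 1 -> is_lim_seq s (Finite t) ->
    Ccv (fun n => F (u n) (s n)) (F x t).

Lemma Ccv2_const (x : C * C) : Ccv2 (fun _ => x) x.
Proof. split; apply Ccv_const. Qed.

Lemma Ccv2_subs (u : nat -> C * C) (x : C * C) (p : nat -> nat) :
  (forall n, (n <= p n)%nat) -> Ccv2 u x -> Ccv2 (fun n => u (p n)) x.
Proof.
  intros Hp []; split;
    [apply (Ccv_subs (fun n => fst (u n)))|apply (Ccv_subs (fun n => snd (u n)))]; auto.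
Qed.

Lemma homotopy_path (D : C * C -> Prop) (F : C * C -> R -> C) (x : C * C) :
  homotopy D F -> D x -> path_cont (F x).
Proof. intros H Hx s t Hs Ht Hst. apply (H (fun _ => x)); auto using Ccv2_const. Qed.

Lemma cont2_path (D : C * C -> Prop) (g : C * C -> C) (c : C) (y : R -> C) :
  cont2 D g -> path_cont y -> (forall t, 0 <= t <= 1 -> D (c, y t)) ->
  path_cont (fun t => g (c, y t)).
Proof.
  intros Hg Hy HD s t Hs Ht Hst. apply (Hg (fun n => (c, y (s n)))); auto.
  split; simpl; auto using Ccv_const.
Qed.

Definition fine_mesh (F : C * C -> R -> C) (x : C * C) (N : nat) : Prop :=
  (0 < N)%nat /\ forall s t, 0 <= s <= 1 -> 0 <= t <= 1 -> Rabs (s - t) <= / INR N ->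
    Cmod (F x s / F x t - 1) <= / 2.

(** For [k = N] this is a square root of [F x t / F x 0]: a telescoping product of principal roots
    over a subdivision of [0, t]. The mesh points scale with [t], which makes the product continuous
    in [t]. *)
Fixpoint ratio_prod (F : C * C -> R -> C) (x : C * C) (t : R) (N k : nat) : C :=
  match k with
  | O => 1%C
  | S k => (ratio_prod F x t N k *
            csqrt (F x (t * INR (S k) / INR N)%R / F x (t * INR k / INR N)%R))%C
  end.

Lemma mesh_point (t : R) (N k : nat) :
  0 <= t <= 1 -> (0 < N)%nat -> (k <= N)%nat -> 0 <= t * INR k / INR N <= 1.
Proof.
  intros Ht HN Hk. apply lt_0_INR in HN. apply le_INR in Hk. assert (H0 := pos_INR k).
  split.
  - apply Rmult_le_pos; [nra|]. left; now apply Rinv_0_lt_compat.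
  - apply Rmult_le_reg_r with (INR N); auto.
    unfold Rdiv. rewrite Rmult_assoc, Rinv_l by lra. nra.
Qed.

Lemma mesh_step (F : C * C -> R -> C) (x : C * C) (t : R) (N k : nat) :
  fine_mesh F x N -> 0 <= t <= 1 -> (S k <= N)%nat ->
  0 < fst (F x (t * INR (S k) / INR N)%R / F x (t * INR k / INR N)%R)%C.
Proof.
  intros [HN H] Ht Hk. apply fst_pos_near_1 with (/ 2); [|lra].
  apply H; try (apply mesh_point; auto; lia).
  rewrite S_INR. apply lt_0_INR in HN.
  replace (t * (INR k + 1) / INR N - t * INR k / INR N) with (t * / INR N) by (field; lra).
  assert (0 < / INR N) by now apply Rinv_0_lt_compat.
  rewrite Rabs_pos_eq; nra.
Qed.

Lemma ratio_prod_sqr (F : C * C -> R -> C) (x : C * C) (t : R) (N k : nat) :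
  (forall t, 0 <= t <= 1 -> F x t <> 0%C) ->
  fine_mesh F x N -> 0 <= t <= 1 -> (k <= N)%nat ->
  (F x 0 * (ratio_prod F x t N k * ratio_prod F x t N k))%C = F x (t * INR k / INR N).
Proof.
  intros H0 HN Ht Hk. assert (HN0 := proj1 HN). induction k as [|k IH].
  - simpl. replace (t * 0 / INR N) with 0 by (field; apply lt_0_INR in HN0; lra). ring.
  - cbn [ratio_prod]. set (p := ratio_prod F x t N k) in *. set (q := csqrt _).
    replace (F x 0 * (p * q * (p * q)))%C with (F x 0 * (p * p) * (q * q))%C by ring.
    unfold q. rewrite csqrt_sqr by (apply mesh_step; auto).
    rewrite IH by lia. field. apply H0, mesh_point; auto; lia.
Qed.

(** Continuity of [csqrt] at a point only asks for a positive real part there, so a mesh that is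
    fine for the limit [x] suffices. *)
Lemma ratio_prod_cv (D : C * C -> Prop) (F : C * C -> R -> C) (N k : nat)
    (u : nat -> C * C) (x : C * C) (s : nat -> R) (t : R) :
  homotopy D F -> (forall x t, D x -> 0 <= t <= 1 -> F x t <> 0%C) ->
  D x -> (forall n, D (u n)) -> Ccv2 u x ->
  (forall n, 0 <= s n <= 1) -> 0 <= t <= 1 -> is_lim_seq s (Finite t) ->
  fine_mesh F x N -> (k <= N)%nat ->
  Ccv (fun n => ratio_prod F (u n) (s n) N k) (ratio_prod F x t N k).
Proof.
  intros HF H0 Dx Du Hux Hs Ht Hst HN Hk. assert (HN0 := proj1 HN).
  assert (HFc : forall i, (i <= N)%nat ->
    Ccv (fun n => F (u n) (s n * INR i / INR N)) (F x (t * INR i / INR N))).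
  { intros i Hi. apply HF; auto.
    - intro n. now apply mesh_point.
    - now apply mesh_point.
    - apply is_lim_seq_div'; auto using is_lim_seq_const.
      + apply is_lim_seq_mult'; auto using is_lim_seq_const.
      + apply lt_0_INR in HN0. lra. }
  induction k as [|k IH]; [exact (Ccv_const 1)|].
  cbn [ratio_prod]. apply Ccv_mult; [apply IH; lia|].
  apply csqrt_cv; [now apply mesh_step|].
  apply Ccv_div; [apply HFc; lia|apply HFc; lia|].
  apply H0; auto. apply mesh_point; auto; lia.
Qed.

Lemma fine_mesh_le (F : C * C -> R -> C) (x : C * C) (N M : nat) :
  fine_mesh F x N -> (N <= M)%nat -> fine_mesh F x M.
Proof.
  intros [HN H] HM. split; [lia|]. intros s t Hs Ht Hst. apply H; auto.
  eapply Rle_trans; [exact Hst|]. apply Rinv_le_contravar.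
  - now apply lt_0_INR.
  - now apply le_INR.
Qed.

(** A single mesh serves a whole tail of a convergent sequence; this is what makes the lifts
    continuous in the base point as well as in time. *)
Lemma fine_mesh_uniform (D : C * C -> Prop) (F : C * C -> R -> C)
    (u : nat -> C * C) (x : C * C) :
  homotopy D F -> (forall x t, D x -> 0 <= t <= 1 -> F x t <> 0%C) ->
  D x -> (forall n, D (u n)) -> Ccv2 u x ->
  exists N, forall n, (N <= n)%nat -> fine_mesh F (u n) N.
Proof.
  intros HF H0 Dx Du Hux. apply NNPP. intro Hn.
  (* Otherwise each [N] yields an index and two times at distance at most 1/(N+1) with a quotient
     far from 1. Along a subsequence both times tend to the same [l], where the quotient tends to
     1. *)
  destruct (choice_seq (nat * (R * R)) (fun N w => (N <= fst w)%nat /\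
    0 <= fst (snd w) <= 1 /\ 0 <= snd (snd w) <= 1 /\
    Rabs (fst (snd w) - snd (snd w)) <= / INR (S N) /\
    / 2 < Cmod (F (u (fst w)) (fst (snd w)) / F (u (fst w)) (snd (snd w)) - 1)))
    as [w Hw'].
  { intro N. apply NNPP. intro Hw. apply Hn. exists (S N). intros n HNn. split; [lia|].
    intros s t Hs Ht Hst. apply Rnot_lt_le. intro Hlt. apply Hw.
    exists (n, (s, t)). simpl. repeat split; try tauto; try lia. }
  destruct (real_bolzano (fun N => fst (snd (w N))) 0 1) as (p & l & Hp & Hl);
    [intro; apply Hw'|].
  assert (Hl01 : 0 <= l <= 1).
  { split.
    - apply (is_lim_seq_le (fun _ => 0) (fun n => fst (snd (w (p n)))) 0 l);
        auto using is_lim_seq_const. intro; apply Hw'.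
    - apply (is_lim_seq_le (fun n => fst (snd (w (p n)))) (fun _ => 1) l 1);
        auto using is_lim_seq_const. intro; apply Hw'. }
  assert (Hl2 : is_lim_seq (fun n => snd (snd (w (p n)))) l).
  { apply is_lim_seq_ext with
      (fun n => fst (snd (w (p n))) - (fst (snd (w (p n))) - snd (snd (w (p n)))));
      [intro; ring|].
    replace l with (l - 0) by ring. apply is_lim_seq_minus'; auto.
    apply (is_lim_seq_le_le (fun n => - / INR (S (p n))) _ (fun n => / INR (S (p n)))).
    - intro n. apply Rabs_le_between. apply Hw'.
    - replace (Finite 0) with (Rbar_opp 0) by (simpl; f_equal; ring).
      apply -> is_lim_seq_opp. apply (is_lim_seq_subs _ _ p Hp is_lim_seq_inv_INR).
    - apply (is_lim_seq_subs _ _ p Hp is_lim_seq_inv_INR). }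
  assert (Hup : Ccv2 (fun n => u (fst (w (p n)))) x).
  { apply (Ccv2_subs u x (fun n => fst (w (p n)))); auto.
    intro n. specialize (Hp n). assert (H := proj1 (Hw' (p n))). lia. }
  assert (Hlim : Ccv (fun n => F (u (fst (w (p n)))) (fst (snd (w (p n)))) /
      F (u (fst (w (p n)))) (snd (snd (w (p n)))))%C (F x l / F x l)%C).
  { apply Ccv_div; [| |now apply H0]; (apply HF; auto; intro; apply Hw'). }
  replace (F x l / F x l)%C with (RtoC 1) in Hlim by (field; auto).
  apply Ccv_iff with (eps := / 2) in Hlim; [|lra].
  destruct Hlim as [N HN]. specialize (HN N (le_n _)).
  assert (H := Hw' (p N)). lra.
Qed.

(** For a fixed mesh the root is explicit. Two fine meshes give continuous roots that agree at time
    0, hence everywhere, so the mesh may be chosen arbitrarily at each point and exchanged for a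
    common one along a convergent sequence. *)
Lemma sqrt_lift (D : C * C -> Prop) (F : C * C -> R -> C) (q : C * C -> C) :
  homotopy D F -> (forall x t, D x -> 0 <= t <= 1 -> F x t <> 0%C) ->
  cont2 D q -> (forall x, D x -> (q x * q x)%C = F x 0) ->
  exists Q : C * C -> R -> C, homotopy D Q /\
    (forall x t, D x -> 0 <= t <= 1 -> (Q x t * Q x t)%C = F x t) /\
    (forall x, D x -> Q x 0 = q x).
Proof.
  intros HF H0 Hq Hq0.
  set (QN := fun N x t => (q x * ratio_prod F x t N N)%C).
  assert (Hex : forall x, D x -> exists N, fine_mesh F x N).
  { intros x Dx. destruct (fine_mesh_uniform D F (fun _ => x) x) as [N HN];
      auto using Ccv2_const. exists N. now apply (HN N). }
  assert (Hsq : forall N x t, D x -> fine_mesh F x N -> 0 <= t <= 1 ->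
    (QN N x t * QN N x t)%C = F x t).
  { intros N x t Dx HN Ht. unfold QN. set (p := ratio_prod F x t N N).
    replace (q x * p * (q x * p))%C with (q x * q x * (p * p))%C by ring.
    rewrite Hq0 by auto. unfold p. rewrite ratio_prod_sqr; auto.
    f_equal. assert (H := lt_0_INR N (proj1 HN)). field. lra. }
  assert (HQ0 : forall N x, D x -> fine_mesh F x N -> QN N x 0 = q x).
  { intros N x Dx HN. unfold QN. assert (HN0 := lt_0_INR N (proj1 HN)).
    assert (E : forall k, ratio_prod F x 0 N k = 1%C).
    { induction k as [|k IH]; auto. cbn [ratio_prod]. rewrite IH.
      replace (0 * INR (S k) / INR N) with 0 by (field; lra).
      replace (0 * INR k / INR N) with 0 by (field; lra).
      replace (F x 0 / F x 0)%C with (RtoC 1) by (field; apply H0; auto; lra).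
      rewrite csqrt_1. ring. }
    rewrite E. ring. }
  assert (Hcv : forall N u x s t, D x -> (forall n, D (u n)) -> Ccv2 u x ->
    (forall n, 0 <= s n <= 1) -> 0 <= t <= 1 -> is_lim_seq s (Finite t) ->
    fine_mesh F x N -> Ccv (fun n => QN N (u n) (s n)) (QN N x t)).
  { intros. unfold QN. apply Ccv_mult; auto. apply (ratio_prod_cv D); auto. }
  assert (Hind : forall N M x t, D x -> fine_mesh F x N -> fine_mesh F x M -> 0 <= t <= 1 ->
    QN N x t = QN M x t).
  { intros N M x t Dx HN HM Ht.
    assert (Hp : forall N, fine_mesh F x N -> path_cont (QN N x)).
    { intros N' HN' s t' Hs Ht' Hst. apply (Hcv N' (fun _ => x)); auto using Ccv2_const. }
    apply (path_same_sign (QN N x) (QN M x) 0); auto; try lra.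
    - intros t' Ht'. apply Csqr_eq. now rewrite !Hsq.
    - intros t' Ht' E. apply (H0 x t'); auto. rewrite <- (Hsq M) by auto. rewrite E. ring.
    - now rewrite !HQ0. }
  set (Q := fun x t => QN (epsilon (inhabits 0%nat) (fine_mesh F x)) x t).
  assert (HQ : forall N x t, D x -> fine_mesh F x N -> 0 <= t <= 1 -> Q x t = QN N x t).
  { intros N x t Dx HN Ht. apply Hind; auto. apply epsilon_spec. now exists N. }
  exists Q. repeat split.
  - intros u x s t Dx Du Hux Hs Ht Hst.
    destruct (fine_mesh_uniform D F u x) as [N HN]; auto.
    destruct (Hex x Dx) as [M HM]. set (L := Nat.max N M).
    assert (HL : fine_mesh F x L) by (apply fine_mesh_le with M; auto; lia).
    rewrite (HQ L) by auto.
    apply Ccv_ext_loc with (fun n => QN L (u n) (s n)) N.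
    + intros n Hn. symmetry. apply HQ; auto. apply fine_mesh_le with N; auto. lia.
    + now apply Hcv.
  - intros x t Dx Ht. destruct (Hex x Dx) as [N HN]. rewrite (HQ N) by auto. now apply Hsq.
  - intros x Dx. destruct (Hex x Dx) as [N HN]. rewrite (HQ N) by (auto; lra). now apply HQ0.
Qed.

(** The flow [Y] brings every point of [D] into [N], where the root [q] is known. Run backwards, it
    transports [q] to the starting point by lifting. On a trajectory staying inside [N] the
    transported root and [q] are two lifts with the same initial value. *)
Lemma sqrt_extend (D N : C * C -> Prop) (Y : C * C -> R -> C) (g q : C * C -> C) :
  homotopy D Y ->
  (forall x t, D x -> 0 <= t <= 1 -> D (fst x, Y x t)) ->
  (forall x, D x -> Y x 0 = snd x) ->
  (forall x, D x -> N (fst x, Y x 1)) ->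
  cont2 D g -> (forall x, D x -> g x <> 0%C) ->
  (forall x, N x -> D x) -> cont2 N q -> (forall x, N x -> (q x * q x)%C = g x) ->
  exists Q : C * C -> C, cont2 D Q /\
    (forall x, D x -> (Q x * Q x)%C = g x) /\
    (forall x, D x -> (forall t, 0 <= t <= 1 -> N (fst x, Y x t)) -> Q x = q x).
Proof.
  intros HY HYD HY0 HY1 Hg Hg0 HND Hq Hqg.
  assert (Hrev : forall s t, is_lim_seq s (Finite t) ->
    is_lim_seq (fun n => 1 - s n) (Finite (1 - t))).
  { intros s t H. apply is_lim_seq_minus'; auto using is_lim_seq_const. }
  destruct (sqrt_lift D (fun x t => g (fst x, Y x (1 - t))) (fun x => q (fst x, Y x 1)))
    as (Q & HQ & HQ2 & HQ0).
  - intros u x s t Dx Du Hux Hs Ht Hst.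
    apply (Hg (fun n => (fst (u n), Y (u n) (1 - s n)))).
    + apply HYD; auto; lra.
    + intro n. apply HYD; auto. specialize (Hs n). lra.
    + split; simpl; [apply Hux|]. apply HY; auto; try lra.
      intro n. specialize (Hs n). lra.
  - intros x t Dx Ht. apply Hg0, HYD; auto; lra.
  - intros u x Dx Du Hux. apply (Hq (fun n => (fst (u n), Y (u n) 1))); auto.
    split; simpl; [apply Hux|]. apply HY; auto; try lra; [intros; lra|apply is_lim_seq_const].
  - intros x Dx. cbv beta. rewrite Rminus_0_r. auto.
  - exists (fun x => Q x 1). repeat split.
    + intros u x Dx Du Hux. apply HQ; auto; try lra; [intros; lra|apply is_lim_seq_const].
    + intros x Dx. rewrite HQ2 by (auto; lra). rewrite Rminus_diag, HY0 by auto.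
      now destruct x.
    + intros x Dx HN.
      assert (E : Q x 1 = q (fst x, Y x (1 - 1))).
      { apply (path_same_sign (Q x) (fun t => q (fst x, Y x (1 - t))) 0); try lra.
        - now apply (homotopy_path D).
        - intros s t Hs Ht Hst. apply (Hq (fun n => (fst x, Y x (1 - s n)))).
          + apply HN. lra.
          + intro n. apply HN. specialize (Hs n). lra.
          + split; simpl; [apply Ccv_const|].
            apply (homotopy_path D Y x HY Dx (fun n => 1 - s n)); auto; try lra.
            intro n. specialize (Hs n). lra.
        - intros t Ht. apply Csqr_eq. rewrite HQ2 by auto. symmetry. apply Hqg, HN. lra.
        - intros t Ht E. assert (H : g (fst x, Y x (1 - t)) = 0%C).
          { rewrite <- Hqg by (apply HN; lra). rewrite E. ring. }
          revert H. apply Hg0, HYD; auto; lra.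
        - rewrite HQ0 by auto. now rewrite Rminus_0_r. }
      rewrite E, Rminus_diag, HY0 by auto. now destruct x.
Qed.

(** * Potentials, contraction sums and the maps used for the disk *)

Definition green_value (K theta : R) (c z : C) (y : R) : Prop :=
  exists N, far c (f_iter K theta c N z) /\
    y = Lg K theta (Sh K theta c 0 (f_iter K theta c N z)) / 2 ^ N.

(** The first two logarithms bound the growth of ln|f_c^n(z)| divided by 2^n when |c| and |z| are at
    most [rho]. The term [ln 2] pays for replacing a point by its image under [Sh], and [2 * ln K]
    for replacing ln|z| by [Lg]. *)
Definition green_bound (K rho : R) : R :=
  ln (K * K + rho) + ln (Rmax 1 rho) + (ln 2 + 2 * ln K).

(* [kap e N T] is e_0 (1 + e_1 (1 + ... e_(N-1) (1 + T))). *)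
Fixpoint kap (e : nat -> R) (N : nat) (T : R) : R :=
  match N with
  | O => T
  | S N => kap e N (e N * (1 + T))
  end.

(** Applied to orbits, [d i] is the distance at time [i], [delta] the distance of the parameters and
    [e i] the backward contraction factor; the recursion is unwound from the last time to the
    first. *)
Lemma kap_bound (e d : nat -> R) (N : nat) (T delta : R) :
  (forall i, (i < N)%nat -> 0 <= e i) ->
  (forall i, (i < N)%nat -> d i <= e i * (d (S i) + delta)) ->
  d N <= T * delta -> d 0%nat <= kap e N T * delta.
Proof.
  revert T. induction N as [|N IH]; intros T He Hd HN; simpl; auto.
  apply IH; auto.
  eapply Rle_trans; [apply Hd; lia|].
  assert (H := He N ltac:(lia)).
  replace (e N * (1 + T) * delta) with (e N * (T * delta + delta)) by ring.
  apply Rmult_le_compat_l; lra.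
Qed.

Lemma kap_cv (e : nat -> nat -> R) (e0 : nat -> R) (N : nat) (T : nat -> R) (T0 : R) :
  (forall i, (i < N)%nat -> is_lim_seq (fun k => e k i) (e0 i)) ->
  is_lim_seq T T0 -> is_lim_seq (fun k => kap (e k) N (T k)) (kap e0 N T0).
Proof.
  revert T T0. induction N as [|N IH]; intros T T0 He HT; simpl; auto.
  apply IH; auto. apply is_lim_seq_mult'; [apply He; lia|].
  apply is_lim_seq_plus'; auto using is_lim_seq_const.
Qed.

Definition partial_prod (e : nat -> R) (N : nat) : R :=
  match N with O => 1 | S m => prod_f_R0 e m end.

Lemma partial_prod_S (e : nat -> R) (N : nat) :
  partial_prod e (S N) = partial_prod e N * e N.
Proof. destruct N as [|N]; simpl; ring. Qed.

(** Links the nested form to the truncations of sigma: knowing the distance after [N] steps only up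
    to the factor [T] costs the last product times [T]. *)
Lemma kap_sum (e : nat -> R) (N : nat) (T : R) :
  kap e N T = sum_n_m (fun j => prod_f_R0 e (Nat.pred j)) 1 N + partial_prod e N * T.
Proof.
  revert T. induction N as [|N IH]; intro T.
  - rewrite sum_n_m_zero by lia. unfold zero; simpl. ring.
  - simpl kap. rewrite IH, sum_n_Sm by lia. unfold plus; simpl.
    change (prod_f_R0 e N) with (partial_prod e (S N)). rewrite partial_prod_S. ring.
Qed.

(** Pulls [z] back [N] times under [f_c], each time with the branch close to the reference orbit
    [p], chosen by the same factorisation as in [psi_seq]. *)
Fixpoint chain (K theta : R) (p : nat -> C) (c z : C) (N : nat) : C :=
  match N with
  | O => z
  | S N => chain K theta p c (hinv K theta (h K theta (p N) *
      csqrt ((z - c) / (h K theta (p N) * h K theta (p N)))))%C N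
  end.

(* Along the critical orbit of [c], N iterations take one into {|z| > r} and
   the sum defining sigma(c), truncated there, leaves room for the tail. *)
Definition expanding (K theta : R) (c : C) (N : nat) (r : R) : Prop :=
  10 <= r /\ Cmod c < 2 * r /\ r + 10 < Cmod (f_iter K theta c N c) /\
  (forall i, f_iter K theta c i c <> 0%C) /\
  kap (fun i => / Cmod (h K theta (f_iter K theta c i c + f_iter K theta c i c)))
    N (/ 9) < 1.

(** The constant 3 is matched to the Lipschitz constant 1/9 of [Sh] in its parameter: composed, they
    contract by 1/3. The first condition keeps [m c] small enough for [far]. *)
Definition slow (m : C -> C) : Prop :=
  (forall c, Cmod (m c) <= Cmod c) /\
  forall c d, Cmod (m c - m d) <= 3 * Cmod (c - d).

Definition cutoff (c : C) : C := (RtoC (Rmin 1 (Rmax 0 ((Cmod c - 30) / 30))) * c)%C.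

Lemma cutoff_small (c : C) : Cmod c <= 30 -> cutoff c = 0%C.
Proof.
  intro H. unfold cutoff. rewrite Rmax_left by lra. rewrite Rmin_right by lra. ring.
Qed.

Lemma cutoff_large (c : C) : 60 <= Cmod c -> cutoff c = c.
Proof.
  intro H. unfold cutoff. rewrite Rmax_right by lra. rewrite Rmin_left by lra. ring.
Qed.

Lemma cutoff_slow : slow cutoff.
Proof.
  set (l := fun c => Rmin 1 (Rmax 0 ((Cmod c - 30) / 30))).
  assert (Hl : forall c, 0 <= l c <= 1).
  { intro c. unfold l. split; [|apply Rmin_l].
    apply Rmin_glb; [lra|apply Rmax_l]. }
  (* If |d| >= 60 both factors equal 1; otherwise |d| < 60 and the factor is 1/30-Lipschitz in the
     modulus. With the term [l c * (c - d)] this accounts for 3 = 1 + 2. *)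
  assert (Hlip : forall c d, Cmod d <= Cmod c -> Cmod d * Rabs (l c - l d) <= 2 * Cmod (c - d)).
  { intros c d Hcd. assert (Ht := Cmod_rev_triangle c d). assert (H0 := Cmod_ge_0 d).
    assert (H1 := Cmod_ge_0 (c - d)%C).
    destruct (Rle_lt_dec 60 (Cmod d)) as [Hd|Hd].
    - unfold l. rewrite (Rmax_right 0 ((Cmod c - 30) / 30)) by lra.
      rewrite (Rmax_right 0 ((Cmod d - 30) / 30)) by lra.
      rewrite !Rmin_left by lra. rewrite Rminus_diag, Rabs_R0. lra.
    - assert (H2 : Rabs (l c - l d) <= (Cmod c - Cmod d) / 30); [|nra].
      unfold l, Rmin, Rmax. apply Rabs_le.
      destruct (Rle_dec 0 ((Cmod c - 30) / 30)), (Rle_dec 0 ((Cmod d - 30) / 30));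
      repeat match goal with |- context [Rle_dec ?a ?b] => destruct (Rle_dec a b) end; lra. }
  assert (Main : forall c d, Cmod d <= Cmod c ->
    Cmod (cutoff c - cutoff d) <= 3 * Cmod (c - d)).
  { intros c d Hcd. unfold cutoff. fold (l c) (l d).
    replace (RtoC (l c) * c - RtoC (l d) * d)%C
      with (RtoC (l c) * (c - d) + RtoC (l c - l d) * d)%C
      by (apply injective_projections; simpl; ring).
    eapply Rle_trans; [apply Cmod_triangle|]. rewrite !Cmod_mult, !Cmod_R.
    specialize (Hlip c d Hcd). specialize (Hl c).
    rewrite (Rabs_pos_eq (l c)) by lra. assert (H1 := Cmod_ge_0 (c - d)%C). nra. }
  split.
  - intro c. unfold cutoff. rewrite Cmod_mult. fold (l c). specialize (Hl c).
    rewrite Cmod_RtoC_pos by lra. assert (H := Cmod_ge_0 c). nra.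
  - intros c d. destruct (Rle_lt_dec (Cmod d) (Cmod c)); [now apply Main|].
    rewrite (Cmod_minus_sym (cutoff c)), (Cmod_minus_sym c). apply Main. lra.
Qed.

(* Interpolates between the identity on {|w| <= 25} and the inverse of [Psi]
   near infinity, by letting the shadowed dynamics move from [f_0] to [f_c]. *)
Definition blend (K theta : R) (w : C) : C :=
  if Rle_dec (Cmod w) 25 then w
  else epsilon (inhabits w)
         (fun c => Cmod (c - w) <= 5 /\ Sh K theta 0 (cutoff c) w = c).

Definition blend_inv (K theta : R) (c : C) : C :=
  if Rle_dec (Cmod c) 30 then c else Sh K theta (cutoff c) 0 c.

(** Homogeneous of degree 0: its value at z is -ln|b(arg z)|. *)
Definition angular (K theta : R) (z : C) : R := Lg K theta z - ln (Cmod z).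

(* Maps the unit disk radially onto {G0 <= T}; [Lg] is junk at 0. *)
Definition radial (K theta T : R) (z : C) : C :=
  if excluded_middle_informative (z = 0%C) then 0%C
  else (RtoC (exp (T - angular K theta z)) * z)%C.

Definition radial_inv (K theta T : R) (w : C) : C :=
  if excluded_middle_informative (w = 0%C) then 0%C
  else (RtoC (exp (angular K theta w - T)) * w)%C.

(** A reparametrisation of potentials, fixed up to [a], that will carry a high level down to the
    wanted one; replacing [k] by [/ k] inverts it. *)
Definition stretch (a k x : R) : R := x + (k - 1) * Rmax 0 (x - a).

Lemma stretch_low (a k x : R) : x <= a -> stretch a k x = x.
Proof. intro H. unfold stretch. rewrite Rmax_left by lra. ring. Qed.

Lemma stretch_high (a k x : R) : a <= x -> stretch a k x = a + k * (x - a).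
Proof. intro H. unfold stretch. rewrite Rmax_right by lra. ring. Qed.

Lemma stretch_inv (a k x : R) : 0 < k -> stretch a (/ k) (stretch a k x) = x.
Proof.
  intro Hk. destruct (Rle_lt_dec x a) as [H|H].
  - rewrite (stretch_low a k) by auto. now apply stretch_low.
  - rewrite (stretch_high a k) by lra. rewrite stretch_high by nra. field. lra.
Qed.

Lemma stretch_cv (a k : R) (u : nat -> R) (l : R) : is_lim_seq u l ->
  is_lim_seq (fun n => stretch a k (u n)) (stretch a k l).
Proof.
  intro H. unfold stretch. apply is_lim_seq_plus'; auto.
  apply is_lim_seq_mult'; [apply is_lim_seq_const|].
  assert (E : forall x, Rmax 0 x = (x + Rabs x) / 2).
  { intro x. unfold Rmax, Rabs. destruct (Rle_dec 0 x), (Rcase_abs x); lra. }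
  rewrite E. apply is_lim_seq_ext with (fun n => ((u n - a) + Rabs (u n - a)) / 2);
    [intro; now rewrite E|].
  assert (Hm : is_lim_seq (fun n => u n - a) (l - a))
    by (apply is_lim_seq_minus'; auto using is_lim_seq_const).
  apply is_lim_seq_div'; [|apply is_lim_seq_const|lra].
  apply is_lim_seq_plus'; auto. now apply (is_lim_seq_abs _ (Finite (l - a))).
Qed.

Lemma exp_cv (u : nat -> R) (l : R) : is_lim_seq u l ->
  is_lim_seq (fun n => exp (u n)) (exp l).
Proof.
  intro H. apply is_lim_seq_continuous; auto. apply derivable_continuous_pt, derivable_pt_exp.
Qed.

Section Stretch.

Context (K theta : R) (hK : 1 < K).

Local Notation hh := (h K theta).
Local Notation ff := (Defs.f K theta).
Local Notation fi := (f_iter K theta).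
Local Notation esc := (escaping K theta).
Local Notation h' := (hinv K theta).
Local Notation Lgg := (Lg K theta).
Local Notation Sh' := (Sh K theta).
Local Notation GM' := (GM K theta).
Local Notation Psi' := (Psi K theta).
Local Notation G0' := (G0 K theta).
Local Notation psi_seq' := (psi_seq K theta).
Local Notation blend' := (blend K theta).
Local Notation blend_inv' := (blend_inv K theta).
Local Notation radial' := (radial K theta).
Local Notation radial_inv' := (radial_inv K theta).
Local Notation angular' := (angular K theta).
Local Notation bottcher_ext' := (bottcher_ext K theta).
Local Notation pullback' := (pullback K theta).
Local Notation Omega_star' := (Omega_star K theta).

(** * The stretch and the iterates *)

Lemma h_plus (z w : C) : hh (z + w) = (hh z + hh w)%C.
Proof. unfold h. rewrite Cconj_plus. ring. Qed.

Lemma h_minus (z w : C) : hh (z - w) = (hh z - hh w)%C.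
Proof. unfold h. rewrite Cconj_minus. ring. Qed.

Lemma h_scal (r : R) (z : C) : hh (RtoC r * z) = (RtoC r * hh z)%C.
Proof.
  unfold h. rewrite Cconj_mult.
  replace (Cconj (RtoC r)) with (RtoC r)
    by (apply injective_projections; simpl; ring). ring.
Qed.

Lemma h_opp (z : C) : hh (- z) = (- hh z)%C.
Proof.
  replace (- z)%C with (RtoC (-1) * z)%C by (apply injective_projections; simpl; ring).
  rewrite h_scal. apply injective_projections; simpl; ring.
Qed.

Lemma h_0 : hh 0%C = 0%C.
Proof. replace (RtoC 0) with (0 * 0)%C at 1 by ring. rewrite h_scal. ring. Qed.

Lemma h_upper (z : C) : Cmod (hh z) <= K * Cmod z.
Proof.
  unfold h. eapply Rle_trans; [apply Cmod_triangle|].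
  rewrite !Cmod_mult, Cmod_cis, Cmod_conj, !Cmod_RtoC_pos by lra.
  apply Req_le. field.
Qed.

(** The extreme stretching factors of [h] are K and 1, the sum and the difference of the moduli of
    its coefficients. This lower bound is the source of all expansion. *)
Lemma h_lower (z : C) : Cmod z <= Cmod (hh z).
Proof.
  unfold h. eapply Rle_trans; [|apply Cmod_plus_ge].
  rewrite !Cmod_mult, Cmod_cis, Cmod_conj, !Cmod_RtoC_pos by lra.
  apply Req_le. field.
Qed.

Lemma h_neq_0 (z : C) : z <> 0%C -> hh z <> 0%C.
Proof.
  intros Hz. apply Cmod_gt_0. eapply Rlt_le_trans; [|apply h_lower].
  now apply Cmod_gt_0.
Qed.

Lemma h_inj (z w : C) : hh z = hh w -> z = w.
Proof.
  intro E. apply Cmod_minus_le0. eapply Rle_trans; [apply h_lower|].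
  rewrite h_minus, E, Cmod_diag. lra.
Qed.

Lemma h_cv (u : nat -> C) (l : C) : Ccv u l -> Ccv (fun n => hh (u n)) (hh l).
Proof.
  intro H. unfold h. apply Ccv_plus; apply Ccv_mult; auto using Ccv_const, Ccv_conj.
Qed.

Lemma hinv_r (w : C) : hh (h' w) = w.
Proof.
  unfold hinv, h. rewrite Cconj_minus, !Cconj_mult.
  assert (Hc := sin2_cos2 (2 * theta)). unfold Rsqr in Hc.
  unfold cis. set (s := sin (2 * theta)) in *. set (c := cos (2 * theta)) in *.
  assert (Hs : s * s = 1 - c * c) by lra.
  destruct w as [x y].
  apply injective_projections; simpl; apply Rminus_diag_uniq; field_simplify; try lra;
  apply Rmult_eq_0_compat_r.
  - ring_simplify. replace (s ^ 2) with (1 - c * c) by (rewrite <- Hs; ring). ring.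
  - ring_simplify. replace (s ^ 2) with (1 - c * c) by (rewrite <- Hs; ring). ring.
Qed.

Lemma hinv_lip (z w : C) : Cmod (h' z - h' w) <= Cmod (z - w).
Proof.
  eapply Rle_trans; [apply h_lower|]. rewrite h_minus, !hinv_r. lra.
Qed.

Lemma hinv_cv (u : nat -> C) (l : C) : Ccv u l -> Ccv (fun n => h' (u n)) (h' l).
Proof.
  intro H. unfold hinv. apply Ccv_minus; repeat apply Ccv_mult; auto using Ccv_const, Ccv_conj.
Qed.

Lemma hinv_l (z : C) : h' (hh z) = z.
Proof. apply h_inj. apply hinv_r. Qed.

Lemma f_eq (c z : C) : ff c z = (hh z * hh z + c)%C.
Proof. unfold Defs.f. simpl. ring. Qed.

Lemma f_opp (c z : C) : ff c (- z)%C = ff c z.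
Proof. rewrite !f_eq, h_opp. ring. Qed.

Lemma f_eq_cases (c z w : C) : ff c z = ff c w -> z = w \/ z = (- w)%C.
Proof.
  rewrite !f_eq. intro H.
  assert (H0 : (hh z * hh z)%C = (hh w * hh w)%C).
  { replace (hh z * hh z)%C with (hh z * hh z + c - c)%C by ring. rewrite H. ring. }
  apply Csqr_eq in H0. destruct H0 as [E|E].
  - left. now apply h_inj.
  - right. apply h_inj. now rewrite h_opp.
Qed.

(** Additivity of [h] gives the difference of squares although [f] is not holomorphic. The expansion
    of distances is thus governed by the sum of the two points. *)
Lemma f_diff (c d z w : C) :
  (ff c z - ff d w)%C = (hh (z - w) * hh (z + w) + (c - d))%C.
Proof. rewrite !f_eq, h_minus, h_plus. ring. Qed.

Lemma f_cv (c z : nat -> C) (c0 z0 : C) :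
  Ccv c c0 -> Ccv z z0 -> Ccv (fun n => ff (c n) (z n)) (ff c0 z0).
Proof.
  intros Hc Hz. rewrite f_eq.
  apply Ccv_ext with (fun n => hh (z n) * hh (z n) + c n)%C.
  - intro; now rewrite f_eq.
  - apply Ccv_plus; auto. apply Ccv_mult; now apply h_cv.
Qed.

Lemma fi_S (c z : C) (n : nat) : fi c (S n) z = ff c (fi c n z).
Proof. reflexivity. Qed.

Lemma fi_add (c z : C) (n m : nat) : fi c (n + m) z = fi c n (fi c m z).
Proof. induction n as [|n IH]; auto. rewrite Nat.add_succ_l, !fi_S. now rewrite IH. Qed.

Lemma fi_shift (c z : C) (n : nat) : fi c n (ff c z) = fi c (S n) z.
Proof. replace (S n) with (n + 1)%nat by lia. now rewrite fi_add. Qed.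

Lemma fi_cv (n : nat) (c z : nat -> C) (c0 z0 : C) :
  Ccv c c0 -> Ccv z z0 -> Ccv (fun k => fi (c k) n (z k)) (fi c0 n z0).
Proof.
  intros Hc Hz. induction n as [|n IH]; auto.
  apply (f_cv c (fun k => fi (c k) n (z k))); auto.
Qed.

Lemma f_upper (c z : C) : Cmod (ff c z) <= K * K * (Cmod z * Cmod z) + Cmod c.
Proof.
  rewrite f_eq. eapply Rle_trans; [apply Cmod_triangle|]. rewrite Cmod_mult.
  assert (H1 := h_upper z). assert (H0 := Cmod_ge_0 (hh z)).
  nra.
Qed.

Lemma f_lower (c z : C) : Cmod z * Cmod z - Cmod c <= Cmod (ff c z).
Proof.
  rewrite f_eq. eapply Rle_trans; [|apply Cmod_plus_ge]. rewrite Cmod_mult.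
  assert (H1 := h_lower z). assert (H2 := Cmod_ge_0 z). nra.
Qed.

Lemma f0_Cmod (z : C) : Cmod (ff 0 z) = Cmod (hh z) * Cmod (hh z).
Proof. rewrite f_eq, Cplus_0_r. apply Cmod_mult. Qed.

Lemma f0_neq_0 (z : C) : z <> 0%C -> ff 0 z <> 0%C.
Proof.
  intro Hz. rewrite f_eq, Cplus_0_r. apply Cmult_neq_0; now apply h_neq_0.
Qed.

Lemma fi0_neq_0 (z : C) (n : nat) : z <> 0%C -> fi 0 n z <> 0%C.
Proof. intro Hz. induction n as [|n IH]; auto. now apply f0_neq_0. Qed.

Lemma fi_bounded (j : nat) (r rho : R) :
  exists A, 0 <= A /\
    forall c z, Cmod c <= rho -> Cmod z <= r -> Cmod (fi c j z) <= A.
Proof.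
  induction j as [|j (A & HA & IH)].
  - exists (Rmax r 0). split; [apply Rmax_r|].
    intros c z _ Hz. eapply Rle_trans; [exact Hz|apply Rmax_l].
  - exists (K * K * (A * A) + Rmax rho 0). split.
    + assert (H := Rmax_r rho 0). nra.
    + intros c z Hc Hz. rewrite fi_S. eapply Rle_trans; [apply f_upper|].
      assert (H := IH c z Hc Hz). assert (H0 := Cmod_ge_0 (fi c j z)).
      assert (H1 := Rmax_l rho 0). assert (0 <= K * K) by nra.
      assert (Cmod (fi c j z) * Cmod (fi c j z) <= A * A) by nra. nra.
Qed.

(** * The homogeneous Green's function of [f_0] *)

Lemma lnK_pos : 0 < ln K.
Proof. rewrite <- ln_1. apply ln_increasing; lra. Qed.

Lemma pow2_pos (n : nat) : 0 < 2 ^ n.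
Proof. apply pow_lt. lra. Qed.

(** From |z| <= |h(z)| <= K|z| the increment lies between 0 and ln K / 2^n, written here as a
    difference so that the sum telescopes to the error bound of [Lg_n_close]. *)
Lemma Lg_n_step (z : C) (n : nat) : z <> 0%C ->
  Lg_n K theta z n <= Lg_n K theta z (S n) <=
  Lg_n K theta z n + (2 * ln K / 2 ^ n - 2 * ln K / 2 ^ S n).
Proof.
  intro Hz. unfold Lg_n. rewrite fi_S, f0_Cmod.
  assert (Hn : 0 < Cmod (fi 0 n z)) by (apply Cmod_gt_0, fi0_neq_0; auto).
  set (w := fi 0 n z) in *. assert (Hp := pow2_pos n).
  assert (H1 := h_lower w). assert (H2 := h_upper w).
  assert (L1 : ln (Cmod w) <= ln (Cmod (hh w))) by (apply ln_le; lra).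
  assert (L2 : ln (Cmod (hh w)) <= ln K + ln (Cmod w)).
  { rewrite <- ln_mult by lra. apply ln_le; lra. }
  rewrite ln_mult by lra. simpl (2 ^ S n).
  replace ((ln (Cmod (hh w)) + ln (Cmod (hh w))) / (2 * 2 ^ n))
    with (ln (Cmod (hh w)) / 2 ^ n) by (field; lra).
  replace (ln (Cmod w) / 2 ^ n + (2 * ln K / 2 ^ n - 2 * ln K / (2 * 2 ^ n)))
    with ((ln K + ln (Cmod w)) / 2 ^ n) by (field; lra).
  assert (0 < / 2 ^ n) by now apply Rinv_0_lt_compat.
  split; apply Rmult_le_compat_r; lra.
Qed.

Lemma Lg_n_add (z : C) (n m : nat) : z <> 0%C ->
  Lg_n K theta z n <= Lg_n K theta z (n + m) <=
  Lg_n K theta z n + (2 * ln K / 2 ^ n - 2 * ln K / 2 ^ (n + m)).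
Proof.
  intro Hz. induction m as [|m IH].
  - rewrite Nat.add_0_r. lra.
  - rewrite Nat.add_succ_r. assert (H := Lg_n_step z (n + m) Hz). lra.
Qed.

Lemma Lg_n_lim (z : C) : z <> 0%C -> is_lim_seq (Lg_n K theta z) (Lgg z).
Proof.
  intro Hz. assert (E : ex_finite_lim_seq (Lg_n K theta z)).
  { apply ex_finite_lim_seq_incr with (Lg_n K theta z 0 + 2 * ln K).
    - intro n. now apply Lg_n_step.
    - intro n. assert (H := Lg_n_add z 0 n Hz). simpl (0 + n)%nat in H.
      assert (0 < 2 * ln K / 2 ^ n)
        by (apply Rdiv_lt_0_compat; [assert (H0 := lnK_pos); lra|apply pow2_pos]).
      simpl (2 ^ 0) in H. lra. }
  now apply Lim_seq_correct'.
Qed.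

Lemma Lg_n_close (z : C) (n : nat) : z <> 0%C ->
  Lg_n K theta z n <= Lgg z <= Lg_n K theta z n + 2 * ln K / 2 ^ n.
Proof.
  intro Hz. assert (HL := Lg_n_lim z Hz).
  assert (HL' : is_lim_seq (fun m => Lg_n K theta z (n + m)) (Lgg z)).
  { apply (is_lim_seq_subs (Lg_n K theta z) (Lgg z) (fun m => (n + m)%nat)); auto.
    intro; lia. }
  split.
  - apply (is_lim_seq_le (fun _ => Lg_n K theta z n) (fun m => Lg_n K theta z (n + m))
      (Lg_n K theta z n) (Lgg z)); auto using is_lim_seq_const.
    intro m. now apply Lg_n_add.
  - apply (is_lim_seq_le (fun m => Lg_n K theta z (n + m))
      (fun _ => Lg_n K theta z n + 2 * ln K / 2 ^ n) (Lgg z)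
      (Lg_n K theta z n + 2 * ln K / 2 ^ n)); auto using is_lim_seq_const.
    intro m. assert (H := Lg_n_add z n m Hz).
    assert (0 < 2 * ln K / 2 ^ (n + m))
        by (apply Rdiv_lt_0_compat; [assert (H0 := lnK_pos); lra|apply pow2_pos]).
    lra.
Qed.

Lemma Lg_bounds (z : C) : z <> 0%C -> ln (Cmod z) <= Lgg z <= ln (Cmod z) + 2 * ln K.
Proof.
  intro Hz. assert (H := Lg_n_close z 0 Hz). unfold Lg_n in H. simpl in H.
  now rewrite !Rdiv_1_r in H.
Qed.

Lemma Lg_f0 (z : C) : z <> 0%C -> Lgg (ff 0 z) = 2 * Lgg z.
Proof.
  intro Hz. assert (H1 := Lg_n_lim (ff 0 z) (f0_neq_0 z Hz)).
  assert (H2 : is_lim_seq (fun n => 2 * Lg_n K theta z (S n)) (2 * Lgg z)).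
  { apply is_lim_seq_mult'; [apply is_lim_seq_const|].
    apply (is_lim_seq_subs (Lg_n K theta z) (Lgg z) S); auto using Lg_n_lim. }
  assert (H3 : is_lim_seq (Lg_n K theta (ff 0 z)) (2 * Lgg z)).
  { eapply is_lim_seq_ext; [|exact H2]. intro n. unfold Lg_n. simpl (2 ^ S n).
    rewrite fi_shift. field. assert (H := pow2_pos n). lra. }
  apply is_lim_seq_unique in H1. apply is_lim_seq_unique in H3.
  rewrite H1 in H3. now injection H3.
Qed.

Lemma Lg_fi0 (z : C) (n : nat) : z <> 0%C -> Lgg (fi 0 n z) = 2 ^ n * Lgg z.
Proof.
  intro Hz. induction n as [|n IH]; [simpl; ring|].
  rewrite fi_S, Lg_f0, IH by (now apply fi0_neq_0). simpl. ring.
Qed.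

Lemma fi0_scal (r : R) (z : C) (n : nat) :
  fi 0 n (RtoC r * z)%C = (RtoC (r ^ (2 ^ n)) * fi 0 n z)%C.
Proof.
  induction n as [|n IH].
  - simpl. now rewrite Rmult_1_r.
  - rewrite !fi_S, IH, !f_eq, h_scal.
    replace (2 ^ S n)%nat with (2 ^ n + 2 ^ n)%nat by (simpl; lia).
    rewrite pow_add, RtoC_mult. ring.
Qed.

Lemma Lg_scal (r : R) (z : C) : 0 < r -> z <> 0%C -> Lgg (RtoC r * z) = ln r + Lgg z.
Proof.
  intros Hr Hz.
  assert (Hrz := RtoC_mult_neq_0 r z Hr Hz).
  assert (H1 := Lg_n_lim _ Hrz).
  assert (H3 : is_lim_seq (Lg_n K theta (RtoC r * z)%C) (ln r + Lgg z)).
  { apply is_lim_seq_ext with (fun n => ln r + Lg_n K theta z n).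
    - intro n. unfold Lg_n. rewrite fi0_scal, Cmod_mult.
      assert (Hrn : 0 < r ^ 2 ^ n) by now apply pow_lt.
      rewrite Cmod_RtoC_pos by lra.
      rewrite ln_mult; auto; [|now apply Cmod_gt_0, fi0_neq_0].
      rewrite ln_pow by auto. rewrite pow_INR. change (INR 2) with 2.
      field. assert (H := pow2_pos n). lra.
    - apply is_lim_seq_plus'; auto using is_lim_seq_const, Lg_n_lim. }
  apply is_lim_seq_unique in H1. apply is_lim_seq_unique in H3.
  rewrite H1 in H3. now injection H3.
Qed.

Lemma ln_cv (u : nat -> R) (l : R) : 0 < l -> is_lim_seq u l ->
  is_lim_seq (fun n => ln (u n)) (ln l).
Proof.
  intros Hl H. apply is_lim_seq_continuous; auto.
  apply derivable_continuous_pt. exists (/ l). now apply derivable_pt_lim_ln.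
Qed.

(** [Lg] is a uniform limit of the continuous [Lg_n], with error 2 ln K / 2^n independent of the
    point. *)
Lemma Lg_cv (u : nat -> C) (l : C) : l <> 0%C -> (forall n, u n <> 0%C) -> Ccv u l ->
  is_lim_seq (fun n => Lgg (u n)) (Lgg l).
Proof.
  intros Hl Hu H. apply is_lim_seq_spec. intros eps.
  assert (He := cond_pos eps).
  assert (HK := inv_pow_cv (2 * ln K) 2 ltac:(lra)). apply is_lim_seq_spec in HK.
  assert (He2 : 0 < eps / 2) by lra.
  destruct (HK (mkposreal _ He2)) as [N HN]. specialize (HN N (le_n _)). simpl in HN.
  rewrite Rminus_0_r in HN. apply Rabs_lt_between in HN.
  assert (Hc : is_lim_seq (fun n => Lg_n K theta (u n) N) (Lg_n K theta l N)).
  { unfold Lg_n. apply is_lim_seq_div'; auto using is_lim_seq_const.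
    - apply ln_cv; [now apply Cmod_gt_0, fi0_neq_0|].
      apply Ccv_Cmod. apply (fi_cv N (fun _ => RtoC 0)); auto using Ccv_const.
    - assert (Hp := pow2_pos N). lra. }
  apply is_lim_seq_spec in Hc. destruct (Hc (mkposreal _ He2)) as [N' HN'].
  exists N'. intros n Hn. specialize (HN' n Hn). simpl in HN'.
  apply Rabs_lt_between in HN'. apply Rabs_lt_between.
  assert (A1 := Lg_n_close l N Hl). assert (A2 := Lg_n_close (u n) N (Hu n)). lra.
Qed.

(** ln|f_0^n(z)| stays within 2 ln K of 2^n [Lg z], so its divergence is decided by the sign of
    [Lg z]. *)
Lemma escaping0_iff (z : C) : esc 0 z <-> z <> 0%C /\ 0 < Lgg z.
Proof.
  split.
  - intro H.
    assert (Hb : forall M, ~ forall n, Cmod (fi 0 n z) <= M).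
    { intros M HM. unfold escaping in H.
      assert (E : Rbar_le p_infty M); [|exact E].
      apply (is_lim_seq_le (fun n => Cmod (fi 0 n z)) (fun _ => M)); auto using is_lim_seq_const. }
    assert (Hz : z <> 0%C).
    { intros ->. apply (Hb 0). intro n. replace (fi 0 n 0) with (RtoC 0).
      - rewrite Cmod_0. lra.
      - induction n as [|n IH]; auto. rewrite fi_S, <- IH, f_eq, h_0. ring. }
    split; auto. apply Rnot_le_lt. intro HL. apply (Hb 1). intro n.
    assert (Hn := Lg_n_close z n Hz). unfold Lg_n in Hn.
    assert (Hp := pow2_pos n).
    assert (Hln : ln (Cmod (fi 0 n z)) <= 0).
    { replace (ln (Cmod (fi 0 n z))) with (ln (Cmod (fi 0 n z)) / 2 ^ n * 2 ^ n)
        by (field; lra). nra. }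
    assert (Hm : 0 < Cmod (fi 0 n z)) by now apply Cmod_gt_0, fi0_neq_0.
    apply Rnot_lt_le. intro Hlt. assert (H1 := ln_increasing 1 _ Rlt_0_1 Hlt).
    rewrite ln_1 in H1. lra.
  - intros [Hz HL]. unfold escaping.
    apply is_lim_seq_le_p_loc with (fun n => 2 ^ n * Lgg z - 2 * ln K).
    + exists 0%nat. intros n _. assert (Hn := Lg_n_close z n Hz). unfold Lg_n in Hn.
      assert (Hp := pow2_pos n).
      assert (Hm : 0 < Cmod (fi 0 n z)) by now apply Cmod_gt_0, fi0_neq_0.
      assert (H1 : 2 ^ n * Lgg z - 2 * ln K <= ln (Cmod (fi 0 n z))).
      { destruct Hn as [_ Hn]. apply (Rmult_le_compat_l (2 ^ n)) in Hn; [|lra].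
        replace (2 ^ n * (ln (Cmod (fi 0 n z)) / 2 ^ n + 2 * ln K / 2 ^ n))
          with (ln (Cmod (fi 0 n z)) + 2 * ln K) in Hn by (field; lra). lra. }
      assert (H2 := exp_ineq1_le (ln (Cmod (fi 0 n z)))). rewrite exp_ln in H2 by auto. lra.
    + apply (is_lim_seq_minus _ _ p_infty (2 * ln K)); [|apply is_lim_seq_const|reflexivity].
      apply (is_lim_seq_mult _ _ p_infty (Lgg z)).
      * apply is_lim_seq_geom_p. lra.
      * apply is_lim_seq_const.
      * now apply is_Rbar_mult_p_infty_pos.
Qed.

Lemma cis_neq_0 (phi : R) : cis phi <> 0%C.
Proof. apply Cmod_pos_iff. rewrite Cmod_cis. lra. Qed.

(** Scaling by 1 - d and 1 + d changes [Lg] strictly in both directions, so a zero of [Lg] is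
    approached from both sides; by continuity a nonzero sign persists nearby. *)
Lemma boundary0_iff (z : C) : boundary (esc 0) z <-> z <> 0%C /\ Lgg z = 0.
Proof.
  assert (Hsc : forall (z : C) (e : R), z <> 0%C -> 0 < e ->
    exists w v : C, Cmod (w - z) < e /\ w <> 0%C /\ Lgg w < Lgg z /\
                Cmod (v - z) < e /\ v <> 0%C /\ Lgg z < Lgg v).
  { clear z. intros z e Hz He. assert (Hm : 0 < Cmod z) by (apply Cmod_gt_0; exact Hz).
    set (d := Rmin (/ 2) (e / 2 / Cmod z)).
    assert (Hd : 0 < d).
    { apply Rmin_glb_lt; [lra|]. repeat apply Rdiv_lt_0_compat; lra. }
    assert (Hd1 : d <= / 2) by apply Rmin_l.
    assert (Hd2 : d * Cmod z <= e / 2).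
    { assert (d <= e / 2 / Cmod z) by apply Rmin_r.
      replace (e / 2) with (e / 2 / Cmod z * Cmod z) by (field; lra).
      apply Rmult_le_compat_r; lra. }
    exists (RtoC (1 - d) * z)%C, (RtoC (1 + d) * z)%C. repeat split.
    - replace (RtoC (1 - d) * z - z)%C with (RtoC (- d) * z)%C
        by (apply injective_projections; simpl; ring).
      rewrite Cmod_mult, Cmod_R, Rabs_Ropp, Rabs_pos_eq by lra. lra.
    - apply RtoC_mult_neq_0; auto; lra.
    - rewrite Lg_scal by (auto; lra). assert (ln (1 - d) < ln 1) by (apply ln_increasing; lra).
      rewrite ln_1 in *. lra.
    - replace (RtoC (1 + d) * z - z)%C with (RtoC d * z)%C
        by (apply injective_projections; simpl; ring).
      rewrite Cmod_mult, Cmod_R, Rabs_pos_eq by lra. lra.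
    - apply RtoC_mult_neq_0; auto; lra.
    - rewrite Lg_scal by (auto; lra). assert (ln 1 < ln (1 + d)) by (apply ln_increasing; lra).
      rewrite ln_1 in *. lra. }
  assert (Hopen : forall z : C, z <> 0%C -> Lgg z <> 0 ->
    exists e, 0 < e /\ forall w : C, Cmod (w - z) < e -> w <> 0%C /\ 0 < Lgg w * Lgg z).
  { clear z. intros z Hz HL.
    destruct (near_of_seq C (fun w => Cmod (w - z)) (fun w => w <> 0%C /\ 0 < Lgg w * Lgg z))
      as (e & He & H).
    - intros u Hu. apply Ccv_of_radii in Hu. apply NNPP. intro Hn.
      assert (Hm : 0 < Cmod z) by (now apply Cmod_gt_0).
      destruct (Ccv_Cmod_gt u z 0 Hu Hm) as [N HN].
      assert (Hne : forall n, u (N + n)%nat <> 0%C)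
        by (intro n; apply Cmod_pos_iff, HN; lia).
      assert (HLc := Lg_cv (fun n => u (N + n)%nat) z Hz Hne (Ccv_tail u z N Hu)).
      assert (Hsq : Lgg z * Lgg z <= 0); [|nra].
      apply (is_lim_seq_le (fun n => Lgg (u (N + n)%nat) * Lgg z) (fun _ => 0)
        (Lgg z * Lgg z) 0); auto using is_lim_seq_const.
      + intro n. apply Rnot_lt_le. intro. apply Hn. exists (N + n)%nat. auto.
      + apply is_lim_seq_mult'; auto using is_lim_seq_const.
    - exists e. split; auto. intros w Hw. apply H. lra. }
  unfold boundary. rewrite !locally_C_iff. split.
  - intros [H1 H2].
    assert (Hz : z <> 0%C).
    (* 0 is interior to the nonescaping set: [Lg] is at most ln|w| + 2 ln K, which is below -1 on
       this disk. *)
    { intros ->. apply H2. exists (exp (- (2 * ln K) - 1)). split; [apply exp_pos|].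
      intros w Hw He. apply escaping0_iff in He. destruct He as [Hw0 He].
      replace (w - 0)%C with w in Hw by ring.
      assert (Hm : 0 < Cmod w) by (now apply Cmod_gt_0).
      assert (Hb := Lg_bounds w Hw0).
      apply ln_increasing in Hw; auto. rewrite ln_exp in Hw. lra. }
    split; auto. apply NNPP. intro HL. destruct (Hopen z Hz HL) as (e & He & Hw).
    destruct (Rlt_le_dec 0 (Lgg z)) as [Hp|Hp].
    + apply H1. exists e. split; auto. intros w Hwz. apply escaping0_iff.
      destruct (Hw w Hwz) as [A B]. split; auto. nra.
    + apply H2. exists e. split; auto. intros w Hwz. rewrite escaping0_iff.
      destruct (Hw w Hwz) as [A B]. intros [_ C]. nra.
  - intros [Hz HL]. split; intros (e & He & H);
    destruct (Hsc z e Hz He) as (w & v & A1 & A2 & A3 & A4 & A5 & A6).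
    + specialize (H w A1). apply escaping0_iff in H. lra.
    + apply (H v A4). apply escaping0_iff. split; auto; lra.
Qed.

(** Along the ray [Lg] equals ln t + [Lg (cis phi)], which vanishes for exactly one t > 0. *)
Lemma b_eq (phi : R) :
  b K theta phi = (RtoC (exp (- Lgg (cis phi))) * cis phi)%C.
Proof.
  assert (H : (fun z => ray phi z /\ boundary (esc 0) z) (b K theta phi)).
  { unfold b. apply epsilon_spec.
    exists (RtoC (exp (- Lgg (cis phi))) * cis phi)%C. split.
    - exists (exp (- Lgg (cis phi))). split; auto. left; apply exp_pos.
    - apply boundary0_iff. assert (He := exp_pos (- Lgg (cis phi))). split.
      + apply RtoC_mult_neq_0; auto using cis_neq_0.
      + rewrite Lg_scal by (auto using cis_neq_0). rewrite ln_exp. ring. }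
  destruct H as [(t & Ht & E) Hb]. apply boundary0_iff in Hb. destruct Hb as [Hz HL].
  rewrite E in *. f_equal. f_equal.
  assert (Ht0 : 0 < t).
  { destruct Ht as [|Ht]; auto. exfalso. apply Hz. rewrite <- Ht. ring. }
  rewrite Lg_scal in HL by (auto using cis_neq_0).
  rewrite <- (exp_ln t) by auto. f_equal. lra.
Qed.

Lemma b_Cmod (phi : R) : Cmod (b K theta phi) = exp (- Lgg (cis phi)).
Proof.
  rewrite b_eq, Cmod_mult, Cmod_cis, Cmod_RtoC_pos; [ring|left; apply exp_pos].
Qed.

Lemma G0_escaping (z : C) : esc 0 z -> G0' z = Lgg z.
Proof.
  intro He. unfold G0. destruct excluded_middle_informative as [_|N]; [|easy].
  apply escaping0_iff in He. destruct He as [Hz HL].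
  assert (Ha : (fun phi => - PI < phi <= PI /\ z = (RtoC (Cmod z) * cis phi)%C) (arg z)).
  { unfold arg. apply epsilon_spec. now apply cis_polar. }
  destruct Ha as [_ Ha]. assert (Hm : 0 < Cmod z) by (now apply Cmod_gt_0).
  rewrite b_Cmod, ln_div by (auto; apply exp_pos). rewrite ln_exp.
  assert (E : Lgg z = ln (Cmod z) + Lgg (cis (arg z))).
  { rewrite <- Lg_scal by (auto using cis_neq_0). f_equal. exact Ha. }
  rewrite E. ring.
Qed.

Lemma G0_not_escaping (z : C) : ~ esc 0 z -> G0' z = 0.
Proof. intro He. unfold G0. now destruct excluded_middle_informative. Qed.

Lemma G0_gt_iff (z : C) (t : R) : 0 <= t -> (t < G0' z <-> z <> 0%C /\ t < Lgg z).
Proof.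
  intro Ht. destruct (classic (esc 0 z)) as [He|He].
  - rewrite G0_escaping by auto. apply escaping0_iff in He. tauto.
  - rewrite G0_not_escaping by auto. rewrite escaping0_iff in He. split; [lra|].
    intros [H1 H2]. exfalso. apply He. split; auto; lra.
Qed.

(** * Shadowing orbits near infinity *)

Lemma far_f (a z : C) : far a z -> 8 * Cmod z <= Cmod (ff a z).
Proof. intros [H1 H2]. eapply Rle_trans; [|apply f_lower]. nra. Qed.

Lemma far_step (a b z : C) : far a z -> far b z -> far b (ff a z).
Proof.
  intros Ha [H1 H2]. assert (H := far_f a z Ha). split; lra.
Qed.

Lemma far_fi (a b z : C) (n : nat) : far a z -> far b z -> far b (fi a n z).
Proof.
  intros Ha Hb.
  assert (H : far a (fi a n z) /\ far b (fi a n z)); [|apply H].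
  induction n as [|n [IH1 IH2]]; [split; auto|].
  rewrite fi_S. split; apply far_step; auto.
Qed.

Lemma far_fi_ge (a z : C) (n : nat) : far a z -> INR n + Cmod z <= Cmod (fi a n z).
Proof.
  intro Ha. induction n as [|n IH].
  - simpl. lra.
  - rewrite fi_S, S_INR. assert (H := far_f a _ (far_fi a a z n Ha Ha)).
    assert (H1 := pos_INR n). destruct Ha. lra.
Qed.

(** Going back one step divides the distance by at least 10 and adds at most a tenth of |b - c|; the
    geometric series gives 1/9. *)
Lemma orbit_expansion (b c x y : C) (n : nat) :
  (forall i, (i < n)%nat -> 10 <= Cmod (fi b i x + fi c i y)) ->
  Cmod (x - y) <= Cmod (fi b n x - fi c n y) / 10 ^ n + Cmod (b - c) / 9.
Proof.
  revert x y. induction n as [|n IH]; intros x y H.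
  - simpl. assert (H0 := Cmod_ge_0 (b - c)%C). lra.
  - specialize (IH (ff b x) (ff c y)). rewrite !fi_shift in IH.
    assert (H1 : Cmod (ff b x - ff c y) <=
      Cmod (fi b (S n) x - fi c (S n) y) / 10 ^ n + Cmod (b - c) / 9).
    { apply IH. intros i Hi. rewrite !fi_shift. apply H. lia. }
    assert (H2 : 10 * Cmod (x - y) <= Cmod (ff b x - ff c y) + Cmod (b - c)).
    { rewrite f_diff. assert (H3 := Cmod_plus_ge (hh (x - y) * hh (x + y)) (b - c)).
      rewrite Cmod_mult in H3.
      assert (H4 := h_lower (x - y)). assert (H5 := h_lower (x + y)).
      assert (H6 : 10 <= Cmod (x + y)) by (apply (H 0%nat); lia).
      assert (H7 := Cmod_ge_0 (x - y)%C). nra. }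
    set (D := Cmod (fi b (S n) x - fi c (S n) y)) in *.
    assert (Hp : 0 < 10 ^ n) by (apply pow_lt; lra).
    replace (D / 10 ^ S n) with (D / 10 ^ n / 10) by (simpl; field; lra). lra.
Qed.

Lemma le_of_pow10 (a x y : R) : (forall n, x <= a / 10 ^ n + y) -> x <= y.
Proof.
  intro H. apply (is_lim_seq_le (fun _ => x) (fun n => a / 10 ^ n + y) x y); auto.
  - apply is_lim_seq_const.
  - replace (Finite y) with (Finite (0 + y)) by (f_equal; ring).
    apply is_lim_seq_plus'; [apply inv_pow_cv; lra|apply is_lim_seq_const].
Qed.

Lemma shadow_sum (u v w : C) : 10 <= Cmod w -> Cmod (u - w) <= 5 -> Cmod (v - w) <= 5 ->
  10 <= Cmod (u + v).
Proof.
  intros Hw Hu Hv. assert (Ht := Cmod_plus_ge (w + w) ((u - w) + (v - w))).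
  assert (Ht2 := Cmod_triangle (u - w) (v - w)).
  replace (w + w + (u - w + (v - w)))%C with (u + v)%C in Ht by ring.
  rewrite Cdouble, Cmod_mult, Cmod_RtoC_pos in Ht by lra. lra.
Qed.

Lemma close_sum (u v : C) : 10 <= Cmod u -> Cmod (u - v) <= 10 -> 10 <= Cmod (u + v).
Proof.
  intros Hu Hv. assert (H := Cmod_rev_triangle (RtoC 2 * u) (u - v)%C).
  rewrite Cmod_mult, Cmod_RtoC_pos in H by lra.
  replace (RtoC 2 * u - (u - v))%C with (u + v)%C in H
    by (apply injective_projections; simpl; ring). lra.
Qed.

Lemma close_orbits_eq (b x y : C) :
  (forall n, 10 <= Cmod (fi b n x)) ->
  (forall n, Cmod (fi b n x - fi b n y) <= 10) -> x = y.
Proof.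
  intros Hx Hd. apply Cmod_minus_le0, (le_of_pow10 10). intro n.
  eapply Rle_trans; [apply (orbit_expansion b b x y n)|].
  - intros i _. apply close_sum; auto.
  - rewrite Cmod_diag. replace (0 / 9) with 0 by field. apply Rplus_le_compat_r, Rmult_le_compat_r; auto.
    left. apply Rinv_0_lt_compat, pow_lt. lra.
Qed.

(** The first bound reproduces itself. At f_a(z) it gives a deviation at most 5, so the quotient u
    under the root satisfies |h(z)|^2 |u - 1| <= |a| + |b| + 5, and the principal root moves z by at
    most |h(z)| |u - 1|. Positivity of the real part shows that the branch is legitimate. *)
Lemma psi_seq_spec (a b : C) (k : nat) (z : C) : far a z -> far b z ->
  Cmod (psi_seq' a b k z - z) <= (Cmod a + Cmod b + 5) / Cmod z /\
  ff b (psi_seq' a b (S k) z) = psi_seq' a b k (ff a z) /\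
  0 < fst ((psi_seq' a b k (ff a z) - b) / (hh z * hh z))%C.
Proof.
  set (B := Cmod a + Cmod b + 5).
  assert (HB : 0 < B).
  { unfold B. assert (H1 := Cmod_ge_0 a). assert (H2 := Cmod_ge_0 b). lra. }
  assert (Step : forall k z, far a z -> far b z ->
    Cmod (psi_seq' a b k (ff a z) - ff a z) <= B / Cmod (ff a z) ->
    Cmod (psi_seq' a b (S k) z - z) <= B / Cmod z /\
    ff b (psi_seq' a b (S k) z) = psi_seq' a b k (ff a z) /\
    0 < fst ((psi_seq' a b k (ff a z) - b) / (hh z * hh z))%C).
  { clear k z. intros k z Ha Hb H. 
    destruct (far_step a a z Ha Ha) as [Hf1 Hf2]. destruct (far_step a b z Ha Hb) as [_ Hf3].
    destruct Ha as [Hz Ha]. destruct Hb as [_ Hb].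
    assert (Hz0 : z <> 0%C) by (apply Cmod_pos_iff; lra).
    assert (Hh0 := h_neq_0 z Hz0). assert (Hh := h_lower z).
    set (p := psi_seq' a b k (ff a z)) in *.
    set (u := ((p - b) / (hh z * hh z))%C).
    assert (Hp5 : Cmod (p - ff a z) <= 5).
    { eapply Rle_trans; [exact H|]. apply Rmult_le_reg_r with (Cmod (ff a z)); [lra|].
      unfold Rdiv. rewrite Rmult_assoc, Rinv_l by lra. unfold B. lra. }
    assert (Hu : Cmod (hh z) * (Cmod (hh z) * Cmod (u - 1)) <= B).
    { rewrite <- !Cmod_mult.
      replace (hh z * (hh z * (u - 1)))%C with ((p - ff a z) + (a + - b))%C
        by (unfold u; rewrite f_eq; field; auto).
      eapply Rle_trans; [apply Cmod_triangle|].
      assert (Ht := Cmod_triangle a (- b)). rewrite Cmod_opp in Ht. unfold B. lra. }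
    assert (Hm := Cmod_ge_0 (u - 1)%C).
    (* [far] gives B <= 4|z| + 5, and |z| >= 10 turns this into 0.4|z|^2 + 0.05|z|^2. *)
    assert (HB2 : B <= (45 / 100) * (Cmod z * Cmod z)) by (unfold B; nra).
    assert (Hu1 : Cmod (u - 1) <= 45 / 100).
    { assert (Hzz : 0 < Cmod z * Cmod z) by nra.
      assert (Hle : Cmod z * Cmod z * Cmod (u - 1) <= 45 / 100 * (Cmod z * Cmod z)).
      { eapply Rle_trans; [|exact HB2]. eapply Rle_trans; [|exact Hu].
        rewrite <- Rmult_assoc. apply Rmult_le_compat_r; nra. }
      nra. }
    assert (Hfst : 0 < fst u) by (apply fst_pos_near_1 with (45 / 100); lra).
    repeat split; auto.
    - simpl. fold p. fold u. replace z with (h' (hh z)) at 2 by apply hinv_l.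
      eapply Rle_trans; [apply hinv_lip|].
      replace (hh z * csqrt u - hh z)%C with (hh z * (csqrt u - 1))%C by ring.
      rewrite Cmod_mult. assert (Hc := csqrt_near_1 u Hfst).
      apply Rmult_le_reg_r with (Cmod z); [lra|].
      unfold Rdiv. rewrite (Rmult_assoc B), Rinv_l, Rmult_1_r by lra.
      assert (H0 : 0 <= Cmod (hh z)) by lra.
      assert (H1 : Cmod (hh z) * Cmod (csqrt u - 1) <= Cmod (hh z) * Cmod (u - 1)) by nra.
      assert (H2 : 0 <= Cmod (hh z) * Cmod (u - 1)) by nra.
      nra.
    - simpl. fold p. fold u. rewrite f_eq, hinv_r.
      replace (hh z * csqrt u * (hh z * csqrt u))%C with (hh z * hh z * (csqrt u * csqrt u))%C
        by ring.
      rewrite csqrt_sqr by auto. unfold u. field. auto. }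
  assert (Bd : forall k z, far a z -> far b z ->
    Cmod (psi_seq' a b k z - z) <= B / Cmod z).
  { clear k z. induction k as [|k IH]; intros z Ha Hb.
    - simpl. rewrite Cmod_diag.
      destruct Ha. apply Rlt_le, Rdiv_lt_0_compat; lra.
    - apply Step; auto. apply IH; apply far_step; auto. }
  intros Ha Hb. split; [auto|].
  apply Step; auto. apply Bd; apply far_step; auto.
Qed.

Lemma psi_seq_close (a b : C) (k : nat) (z : C) : far a z -> far b z ->
  Cmod (psi_seq' a b k z - z) <= 5.
Proof.
  intros Ha Hb. destruct (psi_seq_spec a b k z Ha Hb) as [H _].
  eapply Rle_trans; [exact H|]. destruct Ha, Hb.
  apply Rmult_le_reg_r with (Cmod z); [lra|].
  unfold Rdiv. rewrite Rmult_assoc, Rinv_l by lra. lra.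
Qed.

Lemma psi_seq_orbit (a b : C) (n k : nat) (z : C) : far a z -> far b z ->
  fi b n (psi_seq' a b (n + k) z) = psi_seq' a b k (fi a n z).
Proof.
  revert z. induction n as [|n IH]; intros z Ha Hb; [reflexivity|].
  rewrite <- !fi_shift. rewrite <- IH by (apply far_step; auto).
  f_equal. now apply psi_seq_spec.
Qed.

(** Existence by compactness: the n-th iterate of psi_(n+k)(z) is psi_k at the n-th point of the
    orbit, hence within 5 of it, and this passes to a cluster point. *)
Lemma Sh_spec (a b z : C) : far a z -> far b z -> shadows K theta a b z (Sh' a b z).
Proof.
  intros Ha Hb. unfold Sh. apply epsilon_spec.
  destruct (complex_bolzano (fun k => psi_seq' a b k z) (Cmod z + 5))
    as (p & l & Hp & Hl).
  { intro n. assert (H := psi_seq_close a b n z Ha Hb).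
    assert (H2 := Cmod_rev_triangle (psi_seq' a b n z) z). lra. }
  exists l. intro n.
  apply (Ccv_lim_bound (fun k => fi b n (psi_seq' a b (p (n + k)%nat) z))).
  - apply (fi_cv n (fun _ => b)); [apply Ccv_const|].
    apply (Ccv_subs (fun k => psi_seq' a b (p k) z)); auto. intro; lia.
  - intro k. specialize (Hp (n + k)%nat).
    replace (p (n + k)%nat) with (n + (p (n + k)%nat - n))%nat by lia.
    rewrite psi_seq_orbit by auto. apply psi_seq_close; apply far_fi; auto.
Qed.

Lemma Sh_close (a b z : C) : far a z -> far b z -> Cmod (Sh' a b z - z) <= 5.
Proof. intros Ha Hb. apply (Sh_spec a b z Ha Hb 0%nat). Qed.

Lemma Sh_Cmod_ge (a b z : C) : far a z -> far b z -> Cmod z - 5 <= Cmod (Sh' a b z).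
Proof.
  intros Ha Hb. assert (H := Sh_close a b z Ha Hb). rewrite Cmod_minus_sym in H.
  assert (H2 := Cmod_rev_triangle z (Sh' a b z)). lra.
Qed.

Lemma Sh_Cmod_le (a b z : C) : far a z -> far b z -> Cmod (Sh' a b z) <= Cmod z + 5.
Proof.
  intros Ha Hb. assert (H := Sh_close a b z Ha Hb).
  assert (H2 := Cmod_rev_triangle (Sh' a b z) z). lra.
Qed.

(** Both points shadow one orbit of [f_a], so their distance never exceeds 10 and [orbit_expansion]
    may be applied with n tending to infinity. Equal parameters give uniqueness. *)
Lemma Sh_lip (a b c z x : C) : far a z -> far b z ->
  shadows K theta a c z x ->
  Cmod (Sh' a b z - x) <= Cmod (b - c) / 9.
Proof.
  intros Ha Hb Hx. assert (Hs := Sh_spec a b z Ha Hb).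
  assert (HL : forall n : nat, 10 <= Cmod (fi b n (Sh' a b z) + fi c n x))
    by (intro n; apply (shadow_sum _ _ (fi a n z)); auto; now apply (far_fi a a z n)).
  set (s := Sh' a b z) in *.
  apply (le_of_pow10 10). intro n.
  eapply Rle_trans; [apply (orbit_expansion b c s x n)|]; auto.
  apply Rplus_le_compat_r, Rmult_le_compat_r.
  - left. apply Rinv_0_lt_compat, pow_lt. lra.
  - eapply Rle_trans; [apply (Cmod_minus_triangle _ (fi a n z))|].
    rewrite (Cmod_minus_sym (fi a n z)). specialize (Hs n). specialize (Hx n). lra.
Qed.

Lemma Sh_unique (a b z x : C) : far a z -> far b z ->
  shadows K theta a b z x -> x = Sh' a b z.
Proof.
  intros Ha Hb Hx. symmetry. apply Cmod_minus_le0.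
  eapply Rle_trans; [apply (Sh_lip a b b); auto|].
  rewrite Cmod_diag. lra.
Qed.

Lemma Sh_f (a b z : C) : far a z -> far b z ->
  Sh' a b (ff a z) = ff b (Sh' a b z).
Proof.
  intros Ha Hb. symmetry. apply Sh_unique; try (apply far_step; auto).
  intro n. rewrite !fi_shift. now apply Sh_spec.
Qed.

Lemma Sh_fi (a b z : C) (n : nat) : far a z -> far b z ->
  Sh' a b (fi a n z) = fi b n (Sh' a b z).
Proof.
  intros Ha Hb. induction n as [|n IH]; auto.
  rewrite !fi_S, <- IH. apply Sh_f; apply far_fi; auto.
Qed.

(** [z] itself witnesses the choice defining [Sh b a], so the image point need not be [far]. Two
    candidates have orbits within 5 + 5 of each other while that of [z] stays beyond 10, so they
    coincide. *)
Lemma Sh_inv (a b z : C) : far a z -> far b z ->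
  Sh' b a (Sh' a b z) = z.
Proof.
  intros Ha Hb. assert (Hs := Sh_spec a b z Ha Hb). set (w := Sh' a b z) in *.
  assert (Hw : shadows K theta b a w (Sh' b a w)).
  { unfold Sh at 1. apply epsilon_spec. exists z. intro n. rewrite Cmod_minus_sym. apply Hs. }
  symmetry. apply (close_orbits_eq a).
  - intro n. now apply (far_fi a a z n).
  - intro n. eapply Rle_trans; [apply (Cmod_minus_triangle _ (fi b n w))|].
    rewrite (Cmod_minus_sym (fi a n z)),
      (Cmod_minus_sym (fi b n w) (fi a n (Sh' b a w))).
    specialize (Hs n). specialize (Hw n). lra.
Qed.

Lemma Sh_inj (a b z w : C) : far a z -> far b z -> far a w -> far b w ->
  Sh' a b z = Sh' a b w -> z = w.
Proof.
  intros Haz Hbz Haw Hbw E.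
  rewrite <- (Sh_inv a b z), <- (Sh_inv a b w) by auto. now rewrite E.
Qed.

Lemma Sh_same (a z : C) : far a z -> Sh' a a z = z.
Proof.
  intro Ha. symmetry. apply Sh_unique; auto. intro n.
  rewrite Cmod_diag. lra.
Qed.

Lemma Sh_neq_0 (a b z : C) : far a z -> far b z -> Sh' a b z <> 0%C.
Proof.
  intros Ha Hb. apply Cmod_pos_iff. assert (H := Sh_Cmod_ge a b z Ha Hb).
  destruct Ha. lra.
Qed.

(** Shadowing is a closed condition in parameters and point jointly, and shadowing points are
    unique; hence only one cluster point is possible. *)
Lemma Sh_cv (a b z : nat -> C) (a0 b0 z0 : C) :
  Ccv a a0 -> Ccv b b0 -> Ccv z z0 ->
  (forall n, far (a n) (z n)) -> (forall n, far (b n) (z n)) ->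
  far a0 z0 -> far b0 z0 ->
  Ccv (fun n => Sh' (a n) (b n) (z n)) (Sh' a0 b0 z0).
Proof.
  intros Ca Cb Cz Ha Hb Ha0 Hb0.
  assert (Hbd : exists M, forall n, Cmod (z n) <= M).
  { assert (Hm := Ccv_Cmod z z0 Cz).
    destruct (filterlim_bounded (fun n => Cmod (z n))) as [M HM].
    - exists (Cmod z0). exact Hm.
    - exists M. intro n. eapply Rle_trans; [apply Rle_abs|]. apply HM. }
  destruct Hbd as [M HM].
  apply Ccv_of_compact with (M + 5).
  - intro n. assert (H := Sh_Cmod_le (a n) (b n) (z n) (Ha n) (Hb n)). specialize (HM n). lra.
  - intros p l Hp Hl. apply Sh_unique; auto. intro n.
    replace (fi b0 n l - fi a0 n z0)%C with ((fi b0 n l - fi a0 n z0) - 0)%C by ring.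
    apply (Ccv_lim_bound (fun k =>
      (fi (b (p k)) n (Sh' (a (p k)) (b (p k)) (z (p k))) - fi (a (p k)) n (z (p k)))%C)).
    + apply Ccv_minus.
      * apply (fi_cv n (fun k => b (p k))); auto. now apply Ccv_subs.
      * apply (fi_cv n (fun k => a (p k)) (fun k => z (p k))); now apply Ccv_subs.
    + intro k. replace (_ - 0)%C with
       (fi (b (p k)) n (Sh' (a (p k)) (b (p k)) (z (p k))) - fi (a (p k)) n (z (p k)))%C by ring.
      now apply Sh_spec.
Qed.

(** Up to time k both orbits stay within 5 of that of z. The resulting rate is uniform in z, as the
    definition of the Böttcher map demands. *)
Lemma psi_seq_Sh (a b z : C) (k : nat) : far a z -> far b z ->
  Cmod (psi_seq' a b k z - Sh' a b z) <= 10 / 10 ^ k.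
Proof.
  intros Ha Hb.
  assert (HS := fun i => Sh_spec a b z Ha Hb i).
  assert (HP : forall i, (i <= k)%nat ->
    Cmod (fi b i (psi_seq' a b k z) - fi a i z) <= 5).
  { intros i Hi. replace k with (i + (k - i))%nat by lia.
    rewrite psi_seq_orbit by auto. apply psi_seq_close; apply far_fi; auto. }
  set (p := psi_seq' a b k z) in *. set (s := Sh' a b z) in *.
  eapply Rle_trans; [apply (orbit_expansion b b p s k)|].
  - intros i Hi. apply (shadow_sum _ _ (fi a i z)); [now apply (far_fi a a z i)| |apply HS].
    apply HP. lia.
  - rewrite Cmod_diag. replace (0 / 9) with 0 by field. rewrite Rplus_0_r.
    apply Rmult_le_compat_r.
    + left. apply Rinv_0_lt_compat, pow_lt. lra.
    + eapply Rle_trans; [apply (Cmod_minus_triangle _ (fi a k z))|].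
      rewrite (Cmod_minus_sym (fi a k z)). specialize (HS k). specialize (HP k (le_n _)). lra.
Qed.

Lemma psi_seq_cv (a b : C) (k : nat) (u : nat -> C) (l : C) :
  (forall n, far a (u n)) -> (forall n, far b (u n)) -> far a l -> far b l -> Ccv u l ->
  Ccv (fun n => psi_seq' a b k (u n)) (psi_seq' a b k l).
Proof.
  revert u l. induction k as [|k IH]; intros u l Hua Hub Hla Hlb Hu; auto.
  assert (Hl0 : l <> 0%C) by (apply Cmod_pos_iff; destruct Hla; lra).
  assert (Hh := h_cv u l Hu).
  simpl. apply hinv_cv, Ccv_mult; auto. apply csqrt_cv.
  - now apply psi_seq_spec.
  - apply Ccv_div.
    + apply Ccv_minus; [|apply Ccv_const].
      apply (IH (fun n => ff a (u n))); try intro; try (apply far_step; auto).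
      apply (f_cv (fun _ => a)); auto using Ccv_const.
    + now apply Ccv_mult.
    + apply Cmult_neq_0; now apply h_neq_0.
Qed.

(** * The Böttcher coordinate near infinity *)

Lemma bottcher_Sh (c : C) (r : R) : 10 <= r -> Cmod c <= 2 * r ->
  bottcher K theta c r (Sh' c 0).
Proof.
  intros Hr Hc. unfold bottcher.
  assert (Hf : forall z, near_infinity r z -> far c z /\ far 0 z).
  { intros z Hz. unfold near_infinity in Hz. split; [now apply far_of_radius with r|].
    apply far_0. lra. }
  split; [lra|split].
  - intros z Hz. assert (H := far_f c z (proj1 (Hf z Hz))). unfold near_infinity in *. lra.
  - exists (psi_seq' c 0). split; [reflexivity|split].
    + intro k. split; [|split].
      * apply continuous_on_of_seq. intros u l Hl Hu Hul.
        apply psi_seq_cv; auto; try intro; now apply Hf.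
      * intros eps. assert (He := cond_pos eps).
        exists (Rmax r ((Cmod c + Cmod 0 + 5) / eps)). intros z Hz.
        destruct (Hf z) as [H1 H2].
        { eapply Rle_lt_trans; [apply Rmax_l|exact Hz]. }
        destruct (psi_seq_spec c 0 (S k) z H1 H2) as [H _].
        eapply Rle_lt_trans; [exact H|].
        assert (H3 : (Cmod c + Cmod 0 + 5) / eps < Cmod z)
          by (eapply Rle_lt_trans; [apply Rmax_r|exact Hz]).
        destruct H1 as [H1 _]. apply Rmult_lt_reg_r with (Cmod z); [lra|].
        unfold Rdiv. rewrite Rmult_assoc, Rinv_l, Rmult_1_r by lra.
        apply (Rmult_lt_compat_r eps) in H3; auto. unfold Rdiv in H3.
        rewrite Rmult_assoc, Rinv_l, Rmult_1_r in H3 by lra. lra.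
      * intros z Hz. destruct (Hf z Hz). now apply psi_seq_spec.
    + intro eps. assert (HL := inv_pow_cv 10 10 ltac:(lra)). apply is_lim_seq_spec in HL.
      destruct (HL eps) as [N HN]. exists N. intros k z Hk Hz. destruct (Hf z Hz).
      eapply Rle_lt_trans; [now apply psi_seq_Sh|].
      specialize (HN k Hk). rewrite Rminus_0_r in HN.
      eapply Rle_lt_trans; [apply Rle_abs|exact HN].
Qed.

(** Uniform convergence puts [psi] within 1 of some psi_(N+1), which is within 1 of the identity
    near infinity. Being a conjugacy, [psi] then maps z to a point whose orbit shadows that of z. *)
Lemma bottcher_unique (c : C) (r : R) (psi : C -> C) : bottcher K theta c r psi ->
  exists M, forall z, M < Cmod z -> psi z = Sh' c 0 z.
Proof.
  intros (Hr & Hinv & ps & H0 & HS & HU).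
  assert (Hcv : forall z, near_infinity r z -> Ccv (fun k => ps k z) (psi z)).
  { intros z Hz. apply Ccv_iff. intros e He. destruct (HU (mkposreal e He)) as [N HN].
    exists N. intros n Hn. now apply (HN n z). }
  assert (Hfe : forall z, near_infinity r z -> psi (ff c z) = ff 0 (psi z)).
  { intros z Hz. apply (Ccv_unique (fun k => ps k (ff c z))); [auto|].
    apply Ccv_ext with (fun k => ff 0 (ps (S k) z)).
    - intro k. now apply HS.
    - apply (f_cv (fun _ => RtoC 0)); [apply Ccv_const|].
      apply (Ccv_subs (fun k => ps k z) (psi z) S); auto. }
  destruct (HU (mkposreal 1 Rlt_0_1)) as [N HN].
  destruct (HS N) as (_ & Has & _). destruct (Has (mkposreal 1 Rlt_0_1)) as [M HM].
  destruct (upper_bound4 r M 10 (Cmod c)) as (B & B1 & B2 & B3 & B4).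
  exists B. intros z Hz.
  assert (Hfc : far c z) by (split; lra).
  apply Sh_unique; auto; [apply far_0; lra|].
  intro n.
  assert (Hn : Cmod z <= Cmod (fi c n z)).
  { assert (H := far_fi_ge c z n Hfc). assert (H1 := pos_INR n). lra. }
  assert (Hpsi : fi 0 n (psi z) = psi (fi c n z)).
  { clear Hn. induction n as [|n IH]; auto. rewrite !fi_S, IH. symmetry. apply Hfe.
    unfold near_infinity. assert (H := far_fi_ge c z n Hfc). assert (H1 := pos_INR n). lra. }
  rewrite Hpsi. set (w := fi c n z) in *.
  eapply Rle_trans; [apply (Cmod_minus_triangle _ (ps (S N) w))|].
  assert (A1 := HN (S N) w (Nat.le_succ_diag_r N)). simpl in A1.
  rewrite (Cmod_minus_sym (psi w)).
  assert (A2 := HM w). simpl in A2. unfold near_infinity in A1.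
  specialize (A1 ltac:(lra)). specialize (A2 ltac:(lra)). lra.
Qed.

(** * Extending the Böttcher coordinate *)

(* Pairs (c, z) such that z lies in the j-th preimage of {|z| > r}, while the
   first n points of the critical orbit do not. *)
Definition pull (r : R) (n j : nat) (x : C * C) : Prop :=
  Cmod (fst x) <= 2 * r /\ (forall i, (i < n)%nat -> Cmod (fi (fst x) i (fst x)) <= r) /\
  r < Cmod (fi (fst x) j (snd x)).

Lemma pull_far (r : R) (n j : nat) (x : C * C) : 10 <= r -> pull r n j x ->
  far (fst x) (fi (fst x) j (snd x)).
Proof. intros Hr (H1 & H2 & H3). now apply far_of_radius with r. Qed.

Lemma pull_add (r : R) (n j k : nat) (x : C * C) : 10 <= r -> pull r n j x ->
  pull r n j (fst x, fi (fst x) k (snd x)).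
Proof.
  intros Hr H. assert (Hf := pull_far r n j x Hr H). destruct H as (H1 & H2 & H3).
  split; [|split]; simpl; auto. rewrite <- fi_add, Nat.add_comm, fi_add.
  assert (H := far_fi_ge _ _ k Hf). assert (H0 := pos_INR k). lra.
Qed.

Lemma pull_S (r : R) (n j : nat) (c z : C) :
  pull r n (S j) (c, z) <-> pull r n j (c, ff c z).
Proof. unfold pull. simpl fst. simpl snd. now rewrite fi_shift. Qed.

Lemma pull_le (r : R) (n j k : nat) (x : C * C) : 10 <= r -> (j <= k)%nat ->
  pull r n j x -> pull r n k x.
Proof.
  intros Hr Hjk H. assert (Hf := pull_far r n j x Hr H). destruct H as (H1 & H2 & H3).
  split; [|split]; auto. replace k with (k - j + j)%nat by lia. rewrite fi_add.
  assert (H := far_fi_ge _ _ (k - j) Hf). assert (H0 := pos_INR (k - j)). lra.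
Qed.

Lemma pull_opp (r : R) (n j : nat) (c z : C) :
  pull r n (S j) (c, z) -> pull r n (S j) (c, (- z)%C).
Proof. rewrite !pull_S. now rewrite f_opp. Qed.

(* Radial escape in {|z| > r}, pulled back by [f_c^j]: since the critical
   values stay out of the way, the inverse branches can be followed. *)
Lemma escape_flow (r M : R) (n j : nat) : 10 <= r -> 0 <= M -> (j <= n)%nat ->
  exists Y : C * C -> R -> C, homotopy (pull r n j) Y /\
    (forall x, pull r n j x -> Y x 0 = snd x) /\
    (forall x t, pull r n j x -> 0 <= t <= 1 ->
       fi (fst x) j (Y x t) = (RtoC (1 + t * M) * fi (fst x) j (snd x))%C).
Proof.
  intros Hr HM. induction j as [|j IH]; intro Hj.
  - exists (fun x t => (RtoC (1 + t * M) * snd x)%C). split; [|split].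
    + intros u x s t Dx Du Hux Hs Ht Hst. apply Ccv_mult; [|apply Hux].
      apply Ccv_RtoC. apply is_lim_seq_plus'; [apply is_lim_seq_const|].
      apply is_lim_seq_mult'; auto using is_lim_seq_const.
    + intros x _. rewrite Rmult_0_l, Rplus_0_r. ring.
    + reflexivity.
  - destruct IH as (Y & HY & HY0 & HYj); [lia|].
    set (fx := fun x : C * C => (fst x, ff (fst x) (snd x))).
    assert (Hfx : forall x, pull r n (S j) x -> pull r n j (fx x)).
    { intros [c z] H. now apply pull_S. }
    assert (Hfc : forall u x, Ccv2 u x -> Ccv2 (fun n => fx (u n)) (fx x)).
    { intros u x []. split; simpl; auto.
      now apply (f_cv (fun n => fst (u n)) (fun n => snd (u n))). }
    destruct (sqrt_lift (pull r n (S j)) (fun x t => Y (fx x) t - fst x)%C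
      (fun x => hh (snd x))) as (Q & HQ & HQ2 & HQ0).
    + intros u x s t Dx Du Hux Hs Ht Hst. apply Ccv_minus; [|apply Hux].
      apply (HY (fun n => fx (u n))); auto.
    (* A zero would put the flow at the critical value c, whose j-th iterate has modulus at most r,
       while the flow keeps the j-th iterate beyond r. *)
    + intros x t Dx Ht E. apply Cminus_eq0 in E.
      assert (H := HYj (fx x) t (Hfx x Dx) Ht). simpl in H. rewrite E in H.
      destruct (Hfx x Dx) as (H1 & H2 & H3). simpl in H2, H3.
      assert (HtM : 0 <= t * M) by (apply Rmult_le_pos; lra).
      specialize (H2 j Hj). rewrite H, Cmod_mult, Cmod_RtoC_pos in H2 by lra.
      set (m := Cmod (fi (fst x) j (ff (fst x) (snd x)))) in *.
      assert (0 <= t * M * m) by (apply Rmult_le_pos; lra). lra.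
    + intros u x Dx Du [_ H]. now apply h_cv.
    + intros x Dx. rewrite HY0 by auto. simpl. rewrite f_eq. ring.
    + exists (fun x t => h' (Q x t)). split; [|split].
      * intros u x s t Dx Du Hux Hs Ht Hst. apply hinv_cv. now apply HQ.
      * intros x Dx. rewrite HQ0 by auto. apply hinv_l.
      * intros x t Dx Ht.
        assert (E : ff (fst x) (h' (Q x t)) = Y (fx x) t).
        { rewrite f_eq, hinv_r, HQ2 by auto. ring. }
        rewrite <- !fi_shift, E. exact (HYj (fx x) t (Hfx x Dx) Ht).
Qed.

(** The speed is a bound A for the j-th iterate on {|z| <= R'}: at time 1 that iterate has been
    multiplied by 1 + A and exceeds A, so the point has left the disk. *)
Lemma escape_flow_far (r R' : R) (n j : nat) : 10 <= r -> (j <= n)%nat ->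
  exists Y : C * C -> R -> C, homotopy (pull r n j) Y /\
    (forall x, pull r n j x -> Y x 0 = snd x) /\
    (forall x t, pull r n j x -> 0 <= t <= 1 -> pull r n j (fst x, Y x t) /\
       Cmod (fi (fst x) j (snd x)) <= Cmod (fi (fst x) j (Y x t))) /\
    (forall x, pull r n j x -> R' < Cmod (Y x 1)).
Proof.
  intros Hr Hj. destruct (fi_bounded j R' (2 * r)) as (A & HA & HA').
  destruct (escape_flow r A n j Hr HA Hj) as (Y & HY & HY0 & HYj).
  exists Y. split; [|split; [|split]]; auto.
  - intros x t Dx Ht. specialize (HYj x t Dx Ht). destruct Dx as (D1 & D2 & D3).
    assert (H : Cmod (fi (fst x) j (snd x)) <= Cmod (fi (fst x) j (Y x t))).
    { assert (HtA : 0 <= t * A) by (apply Rmult_le_pos; lra).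
      rewrite HYj, Cmod_mult, Cmod_RtoC_pos by lra.
      set (m := Cmod (fi (fst x) j (snd x))) in *.
      assert (0 <= t * A * m) by (apply Rmult_le_pos; lra). lra. }
    split; auto. split; [|split]; simpl; auto. lra.
  - intros x Dx. specialize (HYj x 1 Dx ltac:(lra)). destruct Dx as (D1 & D2 & D3).
    apply Rnot_le_lt. intro Hle. specialize (HA' (fst x) (Y x 1) D1 Hle).
    rewrite HYj, Cmod_mult, Cmod_RtoC_pos in HA' by lra.
    set (m := Cmod (fi (fst x) j (snd x))) in *.
    assert (0 <= A * (m - 1)) by (apply Rmult_le_pos; lra). lra.
Qed.

Lemma pull_0_far (r : R) (n : nat) (x : C * C) : 10 <= r -> pull r n 0 x ->
  far (fst x) (snd x) /\ far 0 (snd x).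
Proof.
  intros Hr (H1 & _ & H3). simpl in *. split; [now apply far_of_radius with r|].
  apply far_0. lra.
Qed.

Lemma Sh_cont2 (r : R) (n : nat) : 10 <= r ->
  cont2 (pull r n 0) (fun x => Sh' (fst x) 0 (snd x)).
Proof.
  intros Hr u x Dx Du [Hu1 Hu2].
  apply (Sh_cv (fun n => fst (u n)) (fun _ => RtoC 0) (fun n => snd (u n)));
    auto using Ccv_const.
  - intro k. now apply pull_0_far with r n.
  - intro k. now apply pull_0_far with r n.
  - now apply pull_0_far with r n.
  - now apply pull_0_far with r n.
Qed.

(** From j to j + 1 a square root of [Ps] composed with [f_c] is needed on the larger preimage. Near
    infinity it is [h] composed with [Sh], and the outward flow carries every point there, so
    [sqrt_extend] applies; nonvanishing of [Ps] is part of the induction for that purpose. *)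
Lemma Sh_extension (r : R) (n j : nat) : 10 <= r -> (j <= n)%nat ->
  exists Ps : C * C -> C, cont2 (pull r n j) Ps /\
    (forall x, pull r n j x -> Ps x <> 0%C) /\
    (forall c z, pull r n j (c, z) -> Ps (c, ff c z) = ff 0 (Ps (c, z))) /\
    (forall c z, pull r n 0 (c, z) -> Ps (c, z) = Sh' c 0 z) /\
    (forall c z w, pull r n j (c, z) -> pull r n j (c, w) -> Ps (c, z) = Ps (c, w) -> z = w).
Proof.
  intros Hr. induction j as [|j IH]; intro Hj.
  - assert (Hf : forall c z, pull r n 0 (c, z) -> far c z /\ far 0 z)
      by (intros c z Dx; now apply (pull_0_far r n (c, z))).
    exists (fun x => Sh' (fst x) 0 (snd x)). split; [|split; [|split; [|split]]].
    + now apply Sh_cont2.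
    + intros [c z] Dx. destruct (Hf c z Dx). now apply Sh_neq_0.
    + intros c z Dx. destruct (Hf c z Dx). now apply Sh_f.
    + reflexivity.
    + intros c z w Dz Dw E. destruct (Hf c z Dz), (Hf c w Dw). now apply (Sh_inj c 0).
  - destruct IH as (Ps & HC & HN0 & HE & HS & HI); [lia|].
    (* R1 bounds the (j+1)-st iterate on {|z| <= r}. Along the flow the modulus of that iterate
       never drops below its initial value, so a trajectory starting beyond R' stays in {|z| > r},
       where the new map is [Sh]. *)
    destruct (fi_bounded (S j) r (2 * r)) as (R1 & HR1 & HB).
    set (R' := Rmax r R1).
    assert (HR'r : r <= R') by apply Rmax_l. assert (HR'1 : R1 <= R') by apply Rmax_r.
    destruct (escape_flow_far r R' n (S j) Hr Hj) as (Y & HY & HY0 & HYD & HY1).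
    destruct (escape_flow_far r R' n j Hr ltac:(lia)) as (Z & HZ & HZ0 & HZD & HZ1).
    assert (P0 : forall k c z, pull r n 0 (c, z) -> pull r n k (c, z)).
    { intros k c z H. apply pull_le with 0%nat; auto. lia. }
    assert (Pj : forall c z, pull r n j (c, z) -> pull r n (S j) (c, z)).
    { intros c z H. apply pull_le with j; auto. }
    assert (PF : forall k c z, pull r n k (c, z) -> pull r n k (c, ff c z)).
    { intros k c z H. exact (pull_add r n k 1 (c, z) Hr H). }
    assert (PR : forall k c z, pull r n k (c, z) -> r < Cmod z -> pull r n 0 (c, z)).
    { intros k c z (H1 & H2 & _) H. split; [|split]; auto. }
    destruct (sqrt_extend (pull r n (S j)) (pull r n 0) Y
      (fun x => Ps (fst x, ff (fst x) (snd x))) (fun x => hh (Sh' (fst x) 0 (snd x))))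
      as (Q & HQ & HQ2 & HQS); auto.
    { intros x t Dx Ht. now apply HYD. }
    { intros x Dx. apply (PR (S j)).
      - apply HYD; auto. lra.
      - specialize (HY1 x Dx). lra. }
    { intros u x Dx Du Hu. apply (HC (fun n => (fst (u n), ff (fst (u n)) (snd (u n))))).
      - destruct x. now apply pull_S.
      - intro k. specialize (Du k). destruct (u k). now apply pull_S.
      - split; simpl; [apply Hu|].
        apply (f_cv (fun n => fst (u n)) (fun n => snd (u n))); apply Hu. }
    { intros [c z] Dx. apply HN0. now apply pull_S. }
    { intros [c z] H. now apply P0. }
    { intros u x Dx Du Hu. apply h_cv. now apply (Sh_cont2 r n). }
    { intros [c z] H. simpl. destruct (H) as (H1 & _ & H3). simpl in H1, H3.
      rewrite HS by now apply PF.
      rewrite Sh_f by (try (apply far_0; lra); now apply far_of_radius with r).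
      rewrite f_eq. ring. }
    set (Ps' := fun x => h' (Q x)).
    assert (HE' : forall c z, pull r n (S j) (c, z) -> ff 0 (Ps' (c, z)) = Ps (c, ff c z)).
    { intros c z H. unfold Ps'. rewrite f_eq, hinv_r, HQ2 by auto. simpl. ring. }
    assert (HC' : cont2 (pull r n (S j)) Ps').
    { intros u x Dx Du Hu. apply hinv_cv. now apply HQ. }
    assert (HN' : forall c z, pull r n (S j) (c, z) -> Ps' (c, z) <> 0%C).
    { intros c z H E. assert (H1 := HE' c z H). rewrite E in H1.
      apply (HN0 (c, ff c z)); [now apply pull_S|]. rewrite <- H1, f_eq, h_0. ring. }
    assert (HS' : forall c z, pull r n (S j) (c, z) -> R' < Cmod z ->
      Ps' (c, z) = Sh' c 0 z).
    { intros c z H Hz. unfold Ps'. rewrite HQS; auto; [apply hinv_l|].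
      intros t Ht. destruct (HYD (c, z) t H Ht) as [D1 D2]. apply (PR (S j)); auto.
      simpl in D2 |- *. apply Rnot_le_lt. intro Hle.
      specialize (HB c (Y (c, z) t) (proj1 H) Hle).
      assert (Hf : far c z) by (apply (far_of_radius r); auto; [apply H|lra]).
      assert (H3 := far_fi_ge c z (S j) Hf). assert (H4 := pos_INR (S j)).
      rewrite !fi_S in *. lra. }
    (* Old and new maps have the same image under [f_0], so they agree up to sign; the flow [Z]
       carries the comparison out to where both equal [Sh]. *)
    assert (HA : forall c z, pull r n j (c, z) -> Ps' (c, z) = Ps (c, z)).
    { intros c z H.
      assert (Hpath : path_cont (Z (c, z))) by (now apply (homotopy_path (pull r n j))).
      assert (HD : forall t, 0 <= t <= 1 -> pull r n j (c, Z (c, z) t))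
        by (intros t Ht; now apply (HZD (c, z))).
      assert (E : Ps' (c, Z (c, z) 0) = Ps (c, Z (c, z) 0)).
      { apply (path_same_sign (fun t => Ps' (c, Z (c, z) t)) (fun t => Ps (c, Z (c, z) t)) 1);
          try lra; auto.
        - apply (cont2_path (pull r n (S j))); auto.
        - now apply (cont2_path (pull r n j)).
        - intros t Ht. apply (f_eq_cases 0). rewrite HE', HE by auto. reflexivity.
        - rewrite HS' by (try apply Pj; try apply HD; try lra; now apply (HZ1 (c, z))).
          symmetry. apply HS. apply (PR j); [apply HD; lra|].
          assert (H1 := HZ1 (c, z) H). lra. }
      rewrite !HZ0 in E by auto. exact E. }
    exists Ps'. split; [|split; [|split; [|split]]]; auto.
    + intros [c z]. apply HN'.
    + intros c z H. rewrite HE' by auto. apply HA. now apply pull_S.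
    + intros c z H. rewrite HA by now apply P0. now apply HS.
    + intros c z w Dz Dw E.
      assert (Efe : ff c z = ff c w).
      { apply (HI c); try now apply pull_S. rewrite <- !HE' by auto. now rewrite E. }
      apply f_eq_cases in Efe. destruct Efe as [|Ezw]; auto. exfalso.
      (* The remaining case of injectivity is z = -w. The new map turns out to be odd: this holds at
         time 1 because [Sh] is injective there, and propagates back along the flow. Equal values at
         w and -w would then vanish. *)
      assert (Eo : Ps' (c, (- Y (c, w) 0)%C) = (- Ps' (c, Y (c, w) 0))%C).
      { assert (Hpath : path_cont (Y (c, w))) by (now apply (homotopy_path (pull r n (S j)))).
        assert (HD : forall t, 0 <= t <= 1 -> pull r n (S j) (c, Y (c, w) t))
          by (intros t Ht; now apply (HYD (c, w))).
        assert (Hfe : forall t, 0 <= t <= 1 ->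
          ff 0 (Ps' (c, (- Y (c, w) t)%C)) = ff 0 (Ps' (c, Y (c, w) t))).
        { intros t Ht. rewrite !HE', f_opp by (auto; now apply pull_opp, HD). reflexivity. }
        apply (path_same_sign (fun t => Ps' (c, (- Y (c, w) t)%C))
          (fun t => (- Ps' (c, Y (c, w) t))%C) 1); try lra.
        - apply (cont2_path (pull r n (S j))); auto.
          + intros s t Hs Ht Hst. apply Ccv_opp. now apply Hpath.
          + intros t Ht. now apply pull_opp, HD.
        - intros s t Hs Ht Hst. apply Ccv_opp.
          now apply (cont2_path (pull r n (S j)) Ps' c (Y (c, w))).
        - intros t Ht. destruct (f_eq_cases 0 _ _ (Hfe t Ht)) as [H|H]; rewrite H; [right|left]; ring.
        - intros t Ht H. apply (HN' c (Y (c, w) t)); [now apply HD|].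
          replace (Ps' (c, Y (c, w) t)) with (- - Ps' (c, Y (c, w) t))%C by ring.
          rewrite H. ring.
        - destruct (f_eq_cases 0 _ _ (Hfe 1 ltac:(lra))) as [H|H]; auto. exfalso.
          assert (H1 := HY1 (c, w) Dw). set (y := Y (c, w) 1) in *.
          rewrite !HS' in H; auto;
            try (apply pull_opp); try (apply HD; lra); try now rewrite Cmod_opp.
          apply Sh_inj in H.
          + assert (H2 : y = 0%C).
            { apply NNPP. intro Hy. apply (RtoC_mult_neq_0 2 y); auto; [lra|].
              rewrite <- Cdouble. rewrite <- H at 1. ring. }
            rewrite H2, Cmod_0 in H1. lra.
          + apply (far_of_radius r); [lra|apply Dw|rewrite Cmod_opp; lra].
          + apply far_0. rewrite Cmod_opp. lra.
          + apply (far_of_radius r); [lra|apply Dw|lra].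
          + apply far_0. lra. }
      rewrite HY0 in Eo by auto. simpl in Eo. rewrite <- Ezw, E in Eo.
      apply (RtoC_mult_neq_0 2 (Ps' (c, w))); auto; [lra|].
      rewrite <- Cdouble. rewrite Eo at 1. ring.
Qed.

Lemma fi0_0 (n : nat) : fi 0 n 0 = 0%C.
Proof. induction n as [|n IH]; auto. rewrite fi_S, IH, f_eq, h_0. ring. Qed.

(** One function of (c, z) provides the extensions for all parameters with the same exit time, which
    is what yields continuity of [Psi]. *)
Lemma bottcher_ext_family (r : R) (n : nat) : 10 <= r ->
  exists Ps : C * C -> C, cont2 (pull r n n) Ps /\
    forall c, Cmod c <= 2 * r -> (forall i, (i < n)%nat -> Cmod (fi c i c) <= r) ->
      r < Cmod (fi c n c) ->
      bottcher_ext' c r n (fun z => Ps (c, z)) /\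
      forall z, r < Cmod z -> Ps (c, z) = Sh' c 0 z.
Proof.
  intros Hr. destruct (Sh_extension r n n Hr (le_n _)) as (Ps & HC & HN0 & HE & HS & HI).
  exists Ps. split; auto. intros c Hc Hi Hn.
  assert (Hp : forall z, pullback' c r n z -> pull r n n (c, z)).
  { intros z Hz. split; [|split]; auto. }
  assert (HSc : forall z, r < Cmod z -> Ps (c, z) = Sh' c 0 z).
  { intros z Hz. apply HS. split; [|split]; auto. }
  split; auto. split; [|split; [|split; [|split; [|split]]]]; auto.
  - destruct (bottcher_Sh c r Hr Hc) as (B1 & B2 & ps & B3 & B4 & B5).
    split; [|split]; auto. exists ps. split; [|split]; auto.
    intro eps. destruct (B5 eps) as [N HN]. exists N. intros k z Hk Hz.
    rewrite HSc; auto.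
  - intros m Hm. apply Nat.nlt_ge. intro Hlt. specialize (Hi m Hlt).
    unfold pullback, near_infinity in Hm. lra.
  - apply continuous_on_of_seq. intros u l Hl Hu Hul.
    apply (HC (fun n => (c, u n))); auto. split; simpl; auto using Ccv_const.
  - intros z w Hz Hw. apply HI; auto.
Qed.

Lemma bottcher_ext_exists (c : C) (r : R) (n : nat) : 10 <= r -> Cmod c <= 2 * r ->
  (forall i, (i < n)%nat -> Cmod (fi c i c) <= r) -> r < Cmod (fi c n c) ->
  exists psi, bottcher_ext' c r n psi /\
    forall z, r < Cmod z -> psi z = Sh' c 0 z.
Proof.
  intros Hr Hc Hi Hn. destruct (bottcher_ext_family r n Hr) as (Ps & _ & H).
  exists (fun z => Ps (c, z)). auto.
Qed.

(** Descending induction on the iterate: two conjugacies that agree along the (m+1)-st image of the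
    path agree up to sign along the m-th one, and the sign is settled at time 1, where the whole
    orbit is near infinity. *)
Lemma path_agree (c : C) (V V' : C -> Prop) (p p' : C -> C) (y : R -> C) (R' : R) (k : nat) :
  path_cont y ->
  (forall t i, 0 <= t <= 1 -> V (fi c i (y t)) /\ V' (fi c i (y t))) ->
  seq_cont_on V p -> seq_cont_on V' p' ->
  (forall z, V z -> p (ff c z) = ff 0 (p z)) ->
  (forall z, V' z -> p' (ff c z) = ff 0 (p' z)) ->
  (forall z, R' < Cmod z -> p z = p' z /\ p z <> 0%C) ->
  (forall t, 0 <= t <= 1 -> R' < Cmod (fi c k (y t))) ->
  (forall i, R' < Cmod (fi c i (y 1))) ->
  p (y 0) = p' (y 0).
Proof.
  intros Hy HV Hp Hp' He He' Hfar Hk H1.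
  assert (Hyi : forall i, path_cont (fun t => fi c i (y t))).
  { intros i s t Hs Ht Hst. apply (fi_cv i (fun _ => c)); auto using Ccv_const. }
  assert (Main : forall i, (i <= k)%nat -> forall t, 0 <= t <= 1 ->
    p (fi c (k - i) (y t)) = p' (fi c (k - i) (y t)) /\ p' (fi c (k - i) (y t)) <> 0%C).
  { induction i as [|i IH]; intros Hi t Ht.
    - rewrite Nat.sub_0_r. destruct (Hfar _ (Hk t Ht)) as [E N]. rewrite <- E. auto.
    - assert (Hn : forall t, 0 <= t <= 1 -> p' (fi c (k - S i) (y t)) <> 0%C).
      { intros t' Ht' E. destruct (IH ltac:(lia) t' Ht') as [_ N]. apply N.
        replace (k - i)%nat with (S (k - S i)) by lia.
        rewrite fi_S, He' by now apply HV. rewrite E, f_eq, h_0. ring. }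
      split; [|now apply Hn]. revert t Ht.
      apply (path_same_sign (fun t => p (fi c (k - S i) (y t)))
        (fun t => p' (fi c (k - S i) (y t))) 1); try lra; auto.
      + intros s t Hs Ht Hst.
        apply (Hp (fun n => fi c (k - S i) (y (s n)))).
        * now apply HV.
        * intro n. now apply HV.
        * now apply Hyi.
      + intros s t Hs Ht Hst.
        apply (Hp' (fun n => fi c (k - S i) (y (s n)))).
        * now apply HV.
        * intro n. now apply HV.
        * now apply Hyi.
      + intros t Ht. apply (f_eq_cases 0). rewrite <- He, <- He' by now apply HV.
        rewrite <- !fi_S. replace (S (k - S i)) with (k - i)%nat by lia.
        apply IH; auto. lia.
      + now apply Hfar. }
  destruct (Main k (le_n _) 0 ltac:(lra)) as [E _]. now rewrite Nat.sub_diag in E.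
Qed.

Lemma pullback_f (c z : C) (r : R) (n : nat) : 10 <= r -> Cmod c <= 2 * r ->
  pullback' c r n z -> pullback' c r n (ff c z).
Proof.
  unfold pullback, near_infinity. intros Hr Hc Hz. change (r < Cmod (fi c n z)) in Hz.
  change (r < Cmod (fi c n (ff c z))). rewrite fi_shift, fi_S.
  assert (H := far_f c (fi c n z)).
  specialize (H ltac:(now apply far_of_radius with r)). lra.
Qed.

Lemma pullback_fi (c z : C) (r : R) (n i : nat) : 10 <= r -> Cmod c <= 2 * r ->
  pullback' c r n z -> pullback' c r n (fi c i z).
Proof.
  intros Hr Hc Hz. induction i as [|i IH]; auto. rewrite fi_S. now apply pullback_f.
Qed.

(* Enlarging the radius changes the domain of the extended coordinate but not
   its value at [c]: both extensions live along the radial escape of [c]. *)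
Lemma bottcher_ext_agree_step (c : C) (r r' : R) (n n' : nat) (p p' : C -> C) :
  10 <= r -> Cmod c <= 2 * r -> r <= r' -> r' <= Cmod (fi c n c) ->
  bottcher_ext' c r n p -> bottcher_ext' c r' n' p' -> p c = p' c.
Proof.
  intros Hr Hc Hrr Hr' Hp Hp'.
  destruct Hp as (B & Hn & Hm & HC & _ & HE). destruct Hp' as (B' & Hn' & Hm' & HC' & _ & HE').
  unfold pullback, near_infinity in Hn, Hn', Hm, Hm'.
  change (r < Cmod (fi c n c)) in Hn. change (r' < Cmod (fi c n' c)) in Hn'.
  destruct (bottcher_unique c r p B) as [M1 HM1].
  destruct (bottcher_unique c r' p' B') as [M2 HM2].
  assert (Hmin : forall i, (i < n)%nat -> Cmod (fi c i c) <= r).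
  { intros i Hi. apply Rnot_lt_le. intro H. specialize (Hm i H). lia. }
  destruct (upper_bound4 r M1 M2 0) as (R' & HR0 & HR1 & HR2 & _).
  destruct (escape_flow_far r R' n n Hr (le_n _)) as (Y & HY & HY0 & HYD & HY1).
  assert (Dc : pull r n n (c, c)) by (split; [|split]; auto).
  assert (Hnn : (n <= n')%nat) by (apply Hm; simpl; lra).
  assert (HV' : forall t, 0 <= t <= 1 -> r' < Cmod (fi c n' (Y (c, c) t))).
  { intros t Ht. destruct (HYD (c, c) t Dc Ht) as [D1 D2]. simpl in D2.
    destruct (Nat.eq_dec n n') as [->|Hne]; [lra|].
    replace n' with ((n' - n) + n)%nat by lia. rewrite fi_add.
    assert (Hf := pull_far r n n _ Hr D1). simpl in Hf.
    assert (H := far_fi_ge c _ (n' - n) Hf).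
    assert (H1 : 1 <= INR (n' - n)) by (apply (le_INR 1); lia). lra. }
  destruct (INR_unbounded R') as [m Hm2].
  assert (E : Y (c, c) 0 = c) by (now rewrite HY0).
  replace (p c) with (p (Y (c, c) 0)) by (now rewrite E).
  replace (p' c) with (p' (Y (c, c) 0)) by (now rewrite E).
  apply (path_agree c (pullback' c r n) (pullback' c r' n') p p'
    (Y (c, c)) R' (m + n)).
  - now apply (homotopy_path (pull r n n)).
  - intros t i Ht. split; apply pullback_fi; try lra.
    + destruct (HYD (c, c) t Dc Ht) as [[_ [_ D1]] _]. exact D1.
    + now apply HV'.
  - now apply seq_of_continuous_on.
  - now apply seq_of_continuous_on.
  - exact HE.
  - exact HE'.
  - intros z Hz. rewrite HM1, HM2 by lra. split; auto.
    apply Sh_neq_0; [apply far_of_radius with r; lra|apply far_0; lra].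
  - intros t Ht. destruct (HYD (c, c) t Dc Ht) as [D1 D2].
    assert (Hf := pull_far r n n _ Hr D1). simpl in Hf.
    assert (H := far_fi_ge c _ m Hf). rewrite fi_add.
    assert (H0 := Cmod_ge_0 (fi c n (Y (c, c) t))). lra.
  - intro i. specialize (HY1 (c, c) Dc).
    assert (Hf : far c (Y (c, c) 1)) by (apply far_of_radius with r; auto; lra).
    assert (H := far_fi_ge c _ i Hf). assert (H0 := pos_INR i). lra.
Qed.

Lemma escaping_large (c z : C) (M : R) : esc c z -> exists n, M < Cmod (fi c n z).
Proof.
  intro H. apply is_lim_seq_spec in H. destruct (H M) as [N HN]. exists N. now apply (HN N).
Qed.

Lemma escaping_of_far (c z : C) (n : nat) : far c (fi c n z) -> esc c z.
Proof.
  intro H. apply is_lim_seq_spec. intro M.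
  destruct (INR_unbounded M) as [m Hm]. exists (m + n)%nat. intros k Hk.
  replace k with ((k - n) + n)%nat by lia.
  change (M < Cmod (fi c (k - n + n) z)). rewrite fi_add.
  assert (H1 := far_fi_ge c _ (k - n) H).
  assert (H2 : INR m <= INR (k - n)) by (apply le_INR; lia).
  assert (H3 := Cmod_ge_0 (fi c n z)). lra.
Qed.

Lemma first_exit (c : C) (r : R) : (exists n, r < Cmod (fi c n c)) ->
  exists n, r < Cmod (fi c n c) /\ forall i, (i < n)%nat -> Cmod (fi c i c) <= r.
Proof.
  intros [n Hn]. revert Hn. induction n as [n IH] using lt_wf_ind.
  intro Hn. destruct (classic (exists i, (i < n)%nat /\ r < Cmod (fi c i c))) as [(i & Hi & Hr)|H].
  - now apply (IH i).
  - exists n. split; auto. intros i Hi. apply Rnot_lt_le. intro Hlt. apply H. now exists i.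
Qed.

(** The one-step comparison requires the larger radius not to exceed the modulus of the exit point.
    Larger radii are reached by taking that modulus as an intermediate radius; its exit time is
    strictly later, so n' - n decreases. *)
Lemma bottcher_ext_agree (c : C) (r r' : R) (n n' : nat) (p p' : C -> C) :
  10 <= r -> Cmod c <= 2 * r -> r <= r' -> esc c c ->
  bottcher_ext' c r n p -> bottcher_ext' c r' n' p' -> p c = p' c.
Proof.
  intros Hr Hc Hrr He Hp Hp'.
  remember (n' - n)%nat as m eqn:Em. revert r n p Hr Hc Hrr Hp Em.
  induction m as [m IH] using lt_wf_ind. intros r n p Hr Hc Hrr Hp Em.
  destruct (Rle_lt_dec r' (Cmod (fi c n c))) as [Hle|Hlt].
  - now apply (bottcher_ext_agree_step c r r' n n').
  - set (r2 := Cmod (fi c n c)) in *.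
    assert (Hp0 := Hp). destruct Hp0 as (_ & Hn & Hm & _).
    destruct Hp' as (B' & Hn' & Hm' & HX').
    unfold pullback, near_infinity in Hn, Hn', Hm.
    change (r < r2) in Hn. change (r' < Cmod (fi c n' c)) in Hn'.
    destruct (first_exit c r2 (escaping_large c c r2 He)) as (n2 & Hn2 & Hi2).
    destruct (bottcher_ext_exists c r2 n2) as [p2 [Hp2 _]]; auto; try lra.
    assert (Hnn2 : (n < n2)%nat).
    { apply Nat.nle_gt. intro H. apply Nat.lt_eq_cases in H. destruct H as [H|H].
      - assert (n <= n2)%nat by (apply Hm; change (r < Cmod (fi c n2 c)); lra). lia.
      - subst n2. unfold r2 in Hn2. lra. }
    assert (Hn2' : (n2 <= n')%nat).
    { apply Nat.nlt_ge. intro H. specialize (Hi2 n' H). lra. }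
    transitivity (p2 c).
    + apply (bottcher_ext_agree_step c r r2 n n2); auto; try lra. apply Rle_refl.
    + apply (IH (n' - n2)%nat) with r2 n2; auto; try lra; try lia.
Qed.

Lemma bottcher_ext_value (c : C) (r r' : R) (n n' : nat) (p p' : C -> C) :
  10 <= r -> Cmod c <= 2 * r -> 10 <= r' -> Cmod c <= 2 * r' -> esc c c ->
  bottcher_ext' c r n p -> bottcher_ext' c r' n' p' -> p c = p' c.
Proof.
  intros. destruct (Rle_lt_dec r r').
  - now apply (bottcher_ext_agree c r r' n n').
  - symmetry. apply (bottcher_ext_agree c r' r n' n); auto. lra.
Qed.

Lemma Psi_spec (c : C) : esc c c -> Psi_value K theta c (Psi' c).
Proof.
  intro He. unfold Psi. apply epsilon_spec.
  set (r0 := Rmax 10 (Cmod c / 2)).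
  assert (H10 : 10 <= r0) by apply Rmax_l. assert (Hc2 : Cmod c / 2 <= r0) by apply Rmax_r.
  assert (Hex : forall r, r0 < r -> exists n psi, bottcher_ext' c r n psi).
  { intros r Hr. destruct (first_exit c r (escaping_large c c r He)) as (n & Hn & Hi).
    destruct (bottcher_ext_exists c r n) as [p [Hp _]]; auto; try lra. now exists n, p. }
  destruct (Hex (r0 + 1)) as (n1 & p1 & H1); [lra|].
  exists (p1 c), r0. intros r Hr. destruct (Hex r Hr) as (n & p & H).
  exists n, p. split; auto. apply (bottcher_ext_value c r (r0 + 1) n n1); auto; lra.
Qed.

Lemma Psi_eq (c : C) (r : R) (n : nat) (p : C -> C) : 10 <= r -> Cmod c <= 2 * r -> esc c c ->
  bottcher_ext' c r n p -> Psi' c = p c.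
Proof.
  intros Hr Hc He Hp. destruct (Psi_spec c He) as [r0 H].
  assert (Hr' : r <= Rmax r r0) by apply Rmax_l. assert (Hr0 : r0 <= Rmax r r0) by apply Rmax_r.
  destruct (H (Rmax r r0 + 1)) as (n' & p' & Hp' & <-); [lra|].
  apply (bottcher_ext_value c (Rmax r r0 + 1) r n' n); auto; lra.
Qed.

(** The usable description of [Psi]: after N iterations it is given by [Sh], with no reference to
    extensions. It fixes [Psi c] only up to the branches of f_0^(-N). *)
Lemma Psi_conj (c : C) (r : R) (N : nat) : 10 <= r -> Cmod c <= 2 * r ->
  r < Cmod (fi c N c) -> fi 0 N (Psi' c) = Sh' c 0 (fi c N c).
Proof.
  intros Hr Hc HN.
  assert (He : esc c c) by (apply escaping_of_far with N; now apply far_of_radius with r).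
  destruct (first_exit c r) as (n & Hn & Hi); [now exists N|].
  destruct (bottcher_ext_exists c r n) as [p [Hp HS]]; auto.
  rewrite (Psi_eq c r n p) by auto. destruct (Hp) as (_ & Hc' & _ & _ & _ & HE).
  rewrite <- HS by auto. clear HN. induction N as [|N IH]; auto.
  rewrite !fi_S, IH. symmetry. apply HE. now apply pullback_fi.
Qed.

Lemma Psi_cv (u : nat -> C) (c : C) : esc c c -> Ccv u c ->
  Ccv (fun k => Psi' (u k)) (Psi' c).
Proof.
  intros He Hu. set (r0 := Rmax 10 (Cmod c / 2) + 1).
  assert (H10 : 11 <= r0) by (assert (H := Rmax_l 10 (Cmod c / 2)); unfold r0; lra).
  assert (Hc2 : Cmod c / 2 + 1 <= r0)
    by (assert (H := Rmax_r 10 (Cmod c / 2)); unfold r0; lra).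
  destruct (first_exit c r0 (escaping_large c c r0 He)) as (n & Hn & Hi).
  (* Strictly between the earlier orbit points and the exit point, so that nearby parameters have
     the same exit time for this radius. *)
  set (r := (r0 + Cmod (fi c n c)) / 2).
  assert (Hr : r0 < r < Cmod (fi c n c)) by (unfold r; lra).
  destruct (bottcher_ext_family r n) as (Ps & HC & HP); [lra|].
  assert (Hor : forall i, Ccv (fun k => fi (u k) i (u k)) (fi c i c))
    by (intro i; now apply fi_cv).
  assert (H2 : exists N, forall k, (N <= k)%nat -> Cmod (u k) <= 2 * r).
  { destruct (Ccv_Cmod_lt u c (2 * r) Hu) as [N HN]; [lra|].
    exists N. intros k Hk. left. now apply HN. }
  assert (H3 : exists N, forall k, (N <= k)%nat -> r < Cmod (fi (u k) n (u k))).
  { apply (Ccv_Cmod_gt _ _ r (Hor n)). lra. }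
  assert (H4 : exists N, forall k, (N <= k)%nat ->
    forall i, (i < n)%nat -> Cmod (fi (u k) i (u k)) <= r).
  { assert (H : forall m, (m <= n)%nat -> exists N, forall k, (N <= k)%nat ->
      forall i, (i < m)%nat -> Cmod (fi (u k) i (u k)) <= r).
    { induction m as [|m IH]; intro Hm; [exists 0%nat; intros; lia|].
      destruct IH as [N HN]; [lia|].
      destruct (Ccv_Cmod_lt _ _ r (Hor m)) as [N' HN'].
      { specialize (Hi m Hm). lra. }
      exists (Nat.max N N'). intros k Hk i Hlt.
      destruct (Nat.eq_dec i m) as [->|Hne].
      - left. apply HN'. lia.
      - apply HN; lia. }
    now apply H. }
  destruct H2 as [N2 H2], H3 as [N3 H3], H4 as [N4 H4].
  set (N := Nat.max N2 (Nat.max N3 N4)).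
  assert (Hpull : forall k, (N <= k)%nat -> pull r n n (u k, u k)).
  { intros k Hk. split; [|split]; simpl; [apply H2|apply H4|apply H3]; lia. }
  assert (Hc : pull r n n (c, c)).
  { split; [|split]; simpl; try lra. intros i Hlt. specialize (Hi i Hlt). lra. }
  assert (HPsi : forall c, pull r n n (c, c) -> Psi' c = Ps (c, c)).
  { intros d (D1 & D2 & D3). simpl in *. apply (Psi_eq d r n (fun z => Ps (d, z))); auto; try lra.
    - apply escaping_of_far with n. apply far_of_radius with r; auto; lra.
    - now apply HP. }
  rewrite (HPsi c Hc).
  apply Ccv_shift with N.
  apply Ccv_ext with (fun k => Ps (u (N + k)%nat, u (N + k)%nat)).
  - intro k. symmetry. apply HPsi, Hpull. lia.
  - apply (HC (fun k => (u (N + k)%nat, u (N + k)%nat))); auto.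
    + intro k. apply Hpull. lia.
    + split; simpl; apply (Ccv_subs u c (fun k => (N + k)%nat)); auto; intro; lia.
Qed.

(** * Green's functions *)

Lemma far_far0 (a z : C) : far a z -> far 0 z.
Proof. intros [H _]. now apply far_0. Qed.

Lemma escaping_far (c z : C) : esc c z -> exists N, far c (fi c N z).
Proof.
  intro H. destruct (escaping_large c z (Rmax 10 (Cmod c)) H) as [N HN]. exists N.
  assert (H1 := Rmax_l 10 (Cmod c)). assert (H2 := Rmax_r 10 (Cmod c)). split; lra.
Qed.

Lemma escaping_fi (c z : C) (n : nat) : esc c z -> esc c (fi c n z).
Proof.
  intro H. destruct (escaping_far c z H) as [N HN]. apply escaping_of_far with N.
  rewrite <- fi_add, Nat.add_comm, fi_add. now apply far_fi.
Qed.

Lemma escaping_fi_inv (c z : C) (n : nat) : esc c (fi c n z) -> esc c z.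
Proof.
  intro H. destruct (escaping_far c _ H) as [N HN]. rewrite <- fi_add in HN.
  now apply escaping_of_far with (N + n)%nat.
Qed.

Lemma green_value_unique (c z : C) (x y : R) :
  green_value K theta c z x -> green_value K theta c z y -> x = y.
Proof.
  assert (H : forall N k, far c (fi c N z) ->
    Lgg (Sh' c 0 (fi c (k + N) z)) / 2 ^ (k + N) =
    Lgg (Sh' c 0 (fi c N z)) / 2 ^ N).
  { intros N k Hf. assert (Hf0 := far_far0 _ _ Hf).
    rewrite fi_add, Sh_fi, Lg_fi0, pow_add by (auto using Sh_neq_0).
    assert (H1 := pow2_pos N). assert (H2 := pow2_pos k). field. lra. }
  intros (N & HN & ->) (M & HM & ->).
  destruct (Nat.le_ge_cases N M) as [L|L].
  - replace M with ((M - N) + N)%nat by lia. now rewrite H.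
  - replace N with ((N - M) + M)%nat by lia. now rewrite H.
Qed.

Lemma Lg_Sh_pos (c z : C) : far c z -> 0 < Lgg (Sh' c 0 z).
Proof.
  intro Hf. assert (H0 := far_far0 _ _ Hf).
  assert (H := Lg_bounds _ (Sh_neq_0 c 0 z Hf H0)).
  assert (H1 := Sh_Cmod_ge c 0 z Hf H0). destruct Hf as [Hz _].
  assert (H2 : ln 1 < ln (Cmod (Sh' c 0 z))) by (apply ln_increasing; lra).
  rewrite ln_1 in H2. lra.
Qed.

Lemma G0_Sh (c z : C) : far c z -> G0' (Sh' c 0 z) = Lgg (Sh' c 0 z).
Proof.
  intro Hf. apply G0_escaping, escaping0_iff. split.
  - apply Sh_neq_0; auto. now apply far_far0 with c.
  - now apply Lg_Sh_pos.
Qed.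

Lemma is_green_value (c : C) (g : C -> R) (z : C) : is_green K theta c g -> esc c z ->
  green_value K theta c z (g z).
Proof.
  intros ((r & psi & B & M & HM) & H2 & _) He.
  destruct (bottcher_unique c r psi B) as [M' HM'].
  destruct (upper_bound4 10 (Cmod c) M M') as (M2 & A1 & A2 & A3 & A4).
  destruct (escaping_large c z M2 He) as [N HN].
  assert (Hf : far c (fi c N z)) by (split; lra).
  exists N. split; auto.
  assert (E : g (fi c N z) = 2 ^ N * g z).
  { clear HN Hf. induction N as [|N IH]; [simpl; ring|].
    rewrite fi_S, H2, IH by (now apply escaping_fi). simpl. ring. }
  rewrite HM, HM', G0_Sh in E by (auto; lra). rewrite E.
  assert (H := pow2_pos N). field. lra.
Qed.

Lemma G_green (c : C) : is_green K theta c (G K theta c).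
Proof.
  unfold G. apply epsilon_spec.
  set (g := fun z => if excluded_middle_informative (esc c z)
                     then epsilon (inhabits 0) (green_value K theta c z) else 0).
  assert (Hg : forall z, esc c z -> green_value K theta c z (g z)).
  { intros z He. unfold g. destruct excluded_middle_informative; [|easy].
    apply epsilon_spec. destruct (escaping_far c z He) as [N HN].
    exists (Lgg (Sh' c 0 (fi c N z)) / 2 ^ N), N. auto. }
  exists g. split; [|split].
  - set (r := Rmax 10 (Cmod c)).
    assert (H1 : 10 <= r) by apply Rmax_l. assert (H2 : Cmod c <= r) by apply Rmax_r.
    exists r, (Sh' c 0). split; [apply bottcher_Sh; lra|].
    exists r. intros z Hz. assert (Hf : far c z) by (split; lra).
    assert (He : esc c z) by (now apply escaping_of_far with 0%nat).
    rewrite G0_Sh by auto. apply (green_value_unique c z); auto.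
    exists 0%nat. split; auto. simpl. field.
  - intros z He. assert (Hf : esc c (ff c z)) by (apply (escaping_fi c z 1); auto).
    destruct (Hg _ Hf) as (N & HN & E). rewrite fi_shift in HN, E.
    assert (Ez : g z = Lgg (Sh' c 0 (fi c (S N) z)) / 2 ^ S N).
    { apply (green_value_unique c z); auto. now exists (S N). }
    rewrite E, Ez. simpl (2 ^ S N). assert (H := pow2_pos N). field. lra.
  - intros z Hz. unfold g. now destruct excluded_middle_informative.
Qed.

Lemma G_value (c z : C) (N : nat) : far c (fi c N z) ->
  G K theta c z = Lgg (Sh' c 0 (fi c N z)) / 2 ^ N.
Proof.
  intro Hf. apply (green_value_unique c z).
  - apply is_green_value; [apply G_green|]. now apply escaping_of_far with N.
  - now exists N.
Qed.

Lemma G_BO (c z : C) : ~ esc c z -> G K theta c z = 0.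
Proof. intro H. now apply (G_green c). Qed.

Lemma G_fi (c z : C) (n : nat) : esc c z -> G K theta c (fi c n z) = 2 ^ n * G K theta c z.
Proof.
  intro He. induction n as [|n IH]; [simpl; ring|].
  rewrite fi_S. destruct (G_green c) as (_ & H & _).
  rewrite H, IH by (now apply escaping_fi). simpl. ring.
Qed.

Lemma green_bound_pos (rho : R) : 0 <= rho -> 0 < green_bound K rho.
Proof.
  intro Hr. unfold green_bound. assert (H1 := lnK_pos).
  assert (H2 : ln 1 <= ln (K * K + rho)) by (apply ln_le; nra).
  assert (H3 : ln 1 <= ln (Rmax 1 rho)) by (apply ln_le; [lra|apply Rmax_l]).
  assert (H4 : ln 1 < ln 2) by (apply ln_increasing; lra).
  rewrite ln_1 in *. lra.
Qed.

(** With A = K^2 + rho and m = max(1, |w|) one has max(1, |f_c(w)|) <= A m^2, so ln m + ln A at most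
    doubles at each step. *)
Lemma fi_ln_bound (rho : R) (c z : C) (n : nat) : Cmod c <= rho -> Cmod z <= rho ->
  ln (Rmax 1 (Cmod (fi c n z))) <=
  2 ^ n * (ln (K * K + rho) + ln (Rmax 1 rho)) - ln (K * K + rho).
Proof.
  intros Hc Hz. assert (Hr : 0 <= rho) by (assert (H := Cmod_ge_0 c); lra).
  set (A := K * K + rho). assert (HA : 1 <= A) by (unfold A; nra).
  assert (Hm1 : forall x, 1 <= Rmax 1 x) by (intro; apply Rmax_l).
  induction n as [|n IH].
  - simpl. assert (ln (Rmax 1 (Cmod z)) <= ln (Rmax 1 rho)).
    { apply ln_le; [specialize (Hm1 (Cmod z)); lra|]. apply Rle_max_compat_l. lra. }
    lra.
  - rewrite fi_S. set (w := fi c n z) in *. set (m := Rmax 1 (Cmod w)) in *.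
    assert (Hm : 1 <= m) by apply Hm1.
    assert (Hw : Cmod w <= m) by apply Rmax_r.
    assert (H1 : Rmax 1 (Cmod (ff c w)) <= A * (m * m)).
    { assert (H2 : 1 <= m * m) by nra. apply Rmax_lub; [nra|].
      eapply Rle_trans; [apply f_upper|].
      assert (H0 := Cmod_ge_0 w).
      assert (H3 : Cmod w * Cmod w <= m * m) by nra.
      assert (H4 : 0 <= K * K) by nra. unfold A.
      assert (H5 : K * K * (Cmod w * Cmod w) <= K * K * (m * m)) by nra. nra. }
    apply ln_le in H1; [|specialize (Hm1 (Cmod (ff c w))); lra].
    rewrite !ln_mult in H1 by nra. simpl (2 ^ S n). lra.
Qed.

Lemma G_upper (rho : R) (c z : C) : Cmod c <= rho -> Cmod z <= rho ->
  G K theta c z <= green_bound K rho.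
Proof.
  intros Hc Hz. assert (Hr : 0 <= rho) by (assert (H := Cmod_ge_0 c); lra).
  destruct (classic (esc c z)) as [He|He].
  - destruct (escaping_far c z He) as [N HN]. rewrite (G_value c z N) by auto.
    assert (H0 := far_far0 _ _ HN).
    assert (Hb := Lg_bounds _ (Sh_neq_0 c 0 _ HN H0)).
    assert (Hu := Sh_Cmod_le c 0 _ HN H0). assert (Hl := Sh_Cmod_ge c 0 _ HN H0).
    assert (Hln := fi_ln_bound rho c z N Hc Hz).
    set (w := fi c N z) in *. destruct HN as [Hw _].
    rewrite Rmax_right in Hln by lra.
    assert (H1 : ln (Cmod (Sh' c 0 w)) <= ln 2 + ln (Cmod w)).
    { rewrite <- ln_mult by lra. apply ln_le; lra. }
    assert (HA : ln 1 <= ln (K * K + rho)) by (apply ln_le; nra).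
    assert (H4 : ln 1 < ln 2) by (apply ln_increasing; lra). rewrite ln_1 in *.
    assert (Hp : 1 <= 2 ^ N) by (apply pow_R1_Rle; lra).
    apply Rmult_le_reg_r with (2 ^ N); [lra|].
    unfold Rdiv. rewrite Rmult_assoc, Rinv_l, Rmult_1_r by lra.
    unfold green_bound.
    assert (H5 : (ln 2 + 2 * ln K) * 1 <= (ln 2 + 2 * ln K) * 2 ^ N)
      by (apply Rmult_le_compat_l; lra).
    lra.
  - rewrite G_BO by auto. left. now apply green_bound_pos.
Qed.

(** * The potential on the parameter plane *)

Lemma escaping_critical (c : C) : mandelbrot K theta c <-> ~ esc c c.
Proof.
  unfold mandelbrot, BO.
  assert (E : ff c 0 = c) by (rewrite f_eq, h_0; ring).
  assert (H : esc c 0 <-> esc c c); [|tauto].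
  split; intro H.
  - apply (escaping_fi c 0 1) in H. rewrite fi_S in H. change (fi c 0 0) with (RtoC 0) in H.
    now rewrite E in H.
  - apply (escaping_fi_inv c 0 1). rewrite fi_S. change (fi c 0 0) with (RtoC 0).
    now rewrite E.
Qed.

Lemma escaping_radius (c : C) : esc c c ->
  exists N r, 10 <= r /\ Cmod c < 2 * r /\ r + 10 < Cmod (fi c N c).
Proof.
  intro He. set (r := Rmax 10 (Cmod c)).
  assert (H1 : 10 <= r) by apply Rmax_l. assert (H2 : Cmod c <= r) by apply Rmax_r.
  destruct (escaping_large c c (r + 10) He) as [N HN]. exists N, r. repeat split; lra.
Qed.

Lemma GM_escaping (c : C) : esc c c ->
  Psi' c <> 0%C /\ GM' c = Lgg (Psi' c) /\ 0 < GM' c.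
Proof.
  intro He. destruct (escaping_radius c He) as (N & r & H1 & H2 & H3).
  assert (HP := Psi_conj c r N H1 ltac:(lra) ltac:(lra)).
  assert (Hf : far c (fi c N c)) by (apply far_of_radius with r; lra).
  assert (Hn : Psi' c <> 0%C).
  { intro E. rewrite E, fi0_0 in HP. symmetry in HP. revert HP.
    apply Sh_neq_0; auto. now apply far_far0 with c. }
  assert (E : GM' c = Lgg (Psi' c)).
  { unfold GM. rewrite (G_value c c N), <- HP, Lg_fi0 by auto.
    assert (H := pow2_pos N). field. lra. }
  repeat split; auto. unfold GM. rewrite (G_value c c N) by auto.
  apply Rdiv_lt_0_compat; [now apply Lg_Sh_pos|apply pow2_pos].
Qed.

Lemma GM_BO (c : C) : ~ esc c c -> GM' c = 0.
Proof. apply G_BO. Qed.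

Lemma GM_pos_escaping (c : C) : 0 < GM' c -> esc c c.
Proof. intro H. apply NNPP. intro N. rewrite GM_BO in H by auto. lra. Qed.

Lemma GM_upper (rho : R) (c : C) : Cmod c <= rho -> GM' c <= green_bound K rho.
Proof. intro H. now apply G_upper. Qed.

Lemma Psi_near_infinity (c : C) : 10 < Cmod c ->
  esc c c /\ Psi' c = Sh' c 0 c.
Proof.
  intro H. set (r := (10 + Cmod c) / 2). 
  split.
  - apply escaping_of_far with 0%nat. split; simpl; lra.
  - apply (Psi_conj c r 0); simpl; unfold r; lra.
Qed.

Lemma GM_lower (c : C) : 10 < Cmod c -> ln (Cmod c - 5) <= GM' c.
Proof.
  intro H. destruct (Psi_near_infinity c H) as [He E].
  destruct (GM_escaping c He) as (Hn & EG & _). rewrite EG.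
  eapply Rle_trans; [|apply Lg_bounds; auto]. apply ln_le; [lra|]. rewrite E.
  apply Sh_Cmod_ge; split; try rewrite Cmod_0; lra.
Qed.

Lemma escaping_open (u : nat -> C) (c : C) : Ccv u c -> esc c c ->
  exists N, forall k, (N <= k)%nat -> esc (u k) (u k).
Proof.
  intros Hu He. destruct (escaping_radius c He) as (n & r & H1 & H2 & H3).
  destruct (Ccv_Cmod_lt u c (2 * r) Hu H2) as [N1 HN1].
  destruct (Ccv_Cmod_gt (fun k => fi (u k) n (u k)) (fi c n c) r) as [N2 HN2].
  - now apply fi_cv.
  - lra.
  - exists (Nat.max N1 N2). intros k Hk. apply escaping_of_far with n.
    apply far_of_radius with r; auto; [left; apply HN1|apply HN2]; lia.
Qed.

Lemma GM_cv (u : nat -> C) (c : C) : Ccv u c -> esc c c ->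
  is_lim_seq (fun k => GM' (u k)) (GM' c).
Proof.
  intros Hu He. destruct (escaping_open u c Hu He) as [N HN].
  apply (is_lim_seq_incr_n _ N).
  destruct (GM_escaping c He) as (H1 & H2 & _). rewrite H2.
  apply is_lim_seq_ext with (fun k => Lgg (Psi' (u (k + N)%nat))).
  - intro k. symmetry. apply GM_escaping, HN. lia.
  - apply Lg_cv; auto.
    + intro k. apply GM_escaping, HN. lia.
    + apply (Ccv_subs (fun k => Psi' (u k)) _ (fun k => (k + N)%nat)).
      * intro; lia.
      * now apply Psi_cv.
Qed.

(* Near a parameter of the Mandelbrot set the first n points of the critical
   orbit stay bounded, so that the potential is at most a constant over 2^n. *)
Lemma GM_closed (u : nat -> C) (c : C) (tau : R) : Ccv u c -> 0 < tau ->
  (forall k, tau <= GM' (u k)) -> esc c c /\ tau <= GM' c.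
Proof.
  intros Hu Ht HG.
  assert (He : esc c c).
  { apply NNPP. intro He. set (rho := Rmax 10 (Cmod c) + 1).
    assert (R1 : 11 <= rho) by (assert (H := Rmax_l 10 (Cmod c)); unfold rho; lra).
    assert (R2 : Cmod c + 1 <= rho) by (assert (H := Rmax_r 10 (Cmod c)); unfold rho; lra).
    assert (Hb : forall n, Cmod (fi c n c) < rho).
    { intro n. apply Rnot_le_lt. intro H. apply He.
      apply escaping_of_far with n. split; lra. }
    assert (HL := inv_pow_cv (green_bound K rho) 2 ltac:(lra)). apply is_lim_seq_spec in HL.
    destruct (HL (mkposreal tau Ht)) as [n Hn]. specialize (Hn n (le_n _)). simpl in Hn.
    rewrite Rminus_0_r in Hn. apply Rabs_lt_between in Hn.
    destruct (Ccv_Cmod_lt (fun k => fi (u k) n (u k)) (fi c n c) rho) as [N1 HN1];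
      [now apply fi_cv|auto|].
    destruct (Ccv_Cmod_lt u c rho Hu) as [N2 HN2]; [lra|].
    set (k := Nat.max N1 N2). specialize (HN1 k ltac:(lia)). specialize (HN2 k ltac:(lia)).
    specialize (HG k).
    assert (Hek : esc (u k) (u k)) by (apply GM_pos_escaping; lra).
    assert (HU := G_upper rho (u k) (fi (u k) n (u k)) ltac:(lra) ltac:(lra)).
    rewrite G_fi in HU by auto. fold (GM' (u k)) in HU.
    assert (Hp := pow2_pos n).
    assert (H2 : GM' (u k) <= green_bound K rho / 2 ^ n).
    { apply Rmult_le_reg_r with (2 ^ n); auto.
      unfold Rdiv. rewrite Rmult_assoc, Rinv_l, Rmult_1_r by lra. lra. }
    lra. }
  split; auto.
  apply (is_lim_seq_le (fun _ => tau) (fun k => GM' (u k)) tau (GM' c));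
    auto using is_lim_seq_const, GM_cv.
Qed.

(** * The coordinate [Psi] is a local homeomorphism where sigma < 1 *)

(* The factor by which one iteration of [f_c] contracts backwards between the
   critical orbits of [c] and [d]; for c = d it is the factor defining sigma. *)
Local Notation contr c d x y := (fun i => / Cmod (hh (fi c i x + fi d i y))).

(** The truncations converge to a limit l < 1 and their increments, the partial products, tend to 0.
    Adding a ninth of the last product therefore leaves the limit below 1. *)
Lemma sigma_kap (c : C) : Rbar_lt (Defs.sigma K theta c) 1 ->
  (forall i, fi c i c <> 0%C) /\
  exists N0, forall N, (N0 <= N)%nat -> kap (contr c c c c) N (/ 9) < 1.
Proof.
  unfold Defs.sigma. destruct excluded_middle_informative as [|Hz]; [easy|]. intro Hs.
  assert (Hz' : forall i, fi c i c <> 0%C).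
  { intros i E. apply Hz. now exists i. }
  split; auto. clear Hz.
  set (e := fun i => 1 / (2 * Cmod (hh (P K theta i c)))).
  assert (He : forall i, 0 < e i).
  { intro i. apply Rdiv_lt_0_compat; [lra|].
    assert (0 < Cmod (hh (P K theta i c))); [|lra].
    apply Cmod_gt_0, h_neq_0, Hz'. }
  assert (Ee : forall i, / Cmod (hh (fi c i c + fi c i c)) = e i).
  { intro i. unfold e, P. rewrite h_plus.
    rewrite Cdouble.
    rewrite Cmod_mult, Cmod_RtoC_pos by lra. unfold Rdiv. now rewrite Rmult_1_l. }
  assert (Hpp : forall N, 0 < partial_prod e N).
  { induction N as [|N IH]; [simpl; lra|]. rewrite partial_prod_S.
    now apply Rmult_lt_0_compat. }
  set (s := sigma_n K theta c) in *.
  assert (HsS : forall n, s (S n) = s n + partial_prod e (S n)).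
  { intro n. unfold s, sigma_n. rewrite sum_n_Sm by lia. reflexivity. }
  assert (Hinc : forall n, s n <= s (S n))
    by (intro n; rewrite HsS; specialize (Hpp (S n)); lra).
  assert (Hlim := Lim_seq_correct s (ex_lim_seq_incr s Hinc)).
  assert (Hl : exists l, l < 1 /\ is_lim_seq s (Finite l)).
  { destruct (Lim_seq s) as [l| |] eqn:E; simpl in Hs; try easy.
    - now exists l.
    - exfalso. apply is_lim_seq_spec in Hlim. destruct (Hlim (s 0%nat)) as [N HN].
      specialize (HN N (le_n _)).
      assert (H : s 0%nat <= s N).
      { clear HN. induction N as [|N IH]; [lra|]. specialize (Hinc N). lra. }
      lra. }
  destruct Hl as (l & Hl1 & Hl).
  assert (Hk : is_lim_seq (fun n => s (S n) + (s (S n) - s n) * / 9) (l + (l - l) * / 9)).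
  { assert (H1 : is_lim_seq (fun n => s (S n)) l)
      by (apply (is_lim_seq_subs s l S); auto).
    apply is_lim_seq_plus'; auto. apply is_lim_seq_mult'; auto using is_lim_seq_const.
    now apply is_lim_seq_minus'. }
  replace (l + (l - l) * / 9) with l in Hk by ring.
  apply is_lim_seq_spec in Hk. assert (H1l : 0 < 1 - l) by lra.
  destruct (Hk (mkposreal _ H1l)) as [N0 HN0]. exists (S N0). intros N HN.
  destruct N as [|N]; [lia|]. specialize (HN0 N ltac:(lia)). simpl in HN0.
  apply Rabs_lt_between in HN0.
  assert (E : forall N T, kap (contr c c c c) N T = kap e N T).
  { clear - Ee. induction N as [|N IH]; intro T; [reflexivity|].
    cbn [kap]. now rewrite IH, Ee. }
  rewrite E, kap_sum.
  change (sum_n_m _ 1 (S N)) with (s (S N)). specialize (HsS N). lra.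
Qed.

Lemma orbit_kap (c d x y : C) (N : nat) (T : R) :
  (forall i, (i < N)%nat -> 0 < Cmod (hh (fi c i x + fi d i y))) ->
  Cmod (fi c N x - fi d N y) <= T * Cmod (c - d) ->
  Cmod (x - y) <= kap (contr c d x y) N T * Cmod (c - d).
Proof.
  intros Hp HN.
  apply (kap_bound (contr c d x y) (fun i => Cmod (fi c i x - fi d i y)) N T); auto.
  - intros i Hi. left. now apply Rinv_0_lt_compat, Hp.
  - intros i Hi. specialize (Hp i Hi). cbv beta. rewrite !fi_S, f_diff.
    set (a := fi c i x) in *. set (b := fi d i y) in *.
    assert (H := Cmod_plus_ge (hh (a - b) * hh (a + b)) (c - d)).
    rewrite Cmod_mult in H. assert (H1 := h_lower (a - b)).
    apply Rmult_le_reg_l with (Cmod (hh (a + b))); auto.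
    rewrite <- Rmult_assoc, Rinv_r, Rmult_1_l by lra.
    assert (H2 := Rmult_le_compat_l (Cmod (hh (a + b))) _ _ (Rlt_le _ _ Hp) H1). lra.
Qed.

Lemma contr_cv (u v x y : nat -> C) (c0 : C) (i : nat) :
  Ccv u c0 -> Ccv v c0 -> Ccv x c0 -> Ccv y c0 -> fi c0 i c0 <> 0%C ->
  is_lim_seq (fun k => contr (u k) (v k) (x k) (y k) i) (contr c0 c0 c0 c0 i) /\
  exists M, forall k, (M <= k)%nat -> 0 < Cmod (hh (fi (u k) i (x k) + fi (v k) i (y k))).
Proof.
  intros Hu Hv Hx Hy Hn.
  assert (Hc : Ccv (fun k => hh (fi (u k) i (x k) + fi (v k) i (y k)))
                 (hh (fi c0 i c0 + fi c0 i c0))).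
  { apply h_cv, Ccv_plus; now apply fi_cv. }
  assert (H0 : 0 < Cmod (hh (fi c0 i c0 + fi c0 i c0))).
  { eapply Rlt_le_trans; [|apply h_lower].
    rewrite Cdouble.
    rewrite Cmod_mult, Cmod_RtoC_pos by lra. apply Cmod_gt_0 in Hn. lra. }
  split.
  - apply (is_lim_seq_inv _ (Finite (Cmod (hh (fi c0 i c0 + fi c0 i c0))))).
    + now apply Ccv_Cmod.
    + injection. lra.
  - now apply (Ccv_Cmod_gt _ _ 0 Hc).
Qed.

Lemma contr_eventually (u v x y : nat -> C) (c0 : C) (N : nat) (q : R) :
  Ccv u c0 -> Ccv v c0 -> Ccv x c0 -> Ccv y c0 -> (forall i, fi c0 i c0 <> 0%C) ->
  kap (contr c0 c0 c0 c0) N (/ 9) < q ->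
  exists M, forall k, (M <= k)%nat ->
    kap (contr (u k) (v k) (x k) (y k)) N (/ 9) < q /\
    forall i, (i < N)%nat -> 0 < Cmod (hh (fi (u k) i (x k) + fi (v k) i (y k))).
Proof.
  intros Hu Hv Hx Hy Hn Hk.
  assert (Hc : is_lim_seq (fun k => kap (contr (u k) (v k) (x k) (y k)) N (/ 9))
                 (kap (contr c0 c0 c0 c0) N (/ 9))).
  { apply (kap_cv (fun k => contr (u k) (v k) (x k) (y k)) _ N (fun _ => / 9)).
    - intros i _. now apply contr_cv.
    - apply is_lim_seq_const. }
  apply is_lim_seq_spec in Hc.
  assert (Hq : 0 < q - kap (contr c0 c0 c0 c0) N (/ 9)) by lra.
  destruct (Hc (mkposreal _ Hq)) as [M1 HM1]. simpl in HM1.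
  destruct (eventually_finite N
    (fun i k => 0 < Cmod (hh (fi (u k) i (x k) + fi (v k) i (y k))))) as [M2 HM2].
  { intros i _. now apply (contr_cv u v x y c0). }
  exists (Nat.max M1 M2). intros k Hkk. split.
  - specialize (HM1 k ltac:(lia)). apply Rabs_lt_between in HM1. lra.
  - apply HM2. lia.
Qed.

(** The N-th orbit points shadow one orbit of [f_0], hence differ by at most |u - v|/9. Pulled back
    along the critical orbits this gives |u - v| <= k |u - v| with k < 1. *)
Lemma Psi_locally_injective (c0 : C) (N : nat) (r : R) (u v : nat -> C) :
  expanding K theta c0 N r ->
  Ccv u c0 -> Ccv v c0 -> (forall k, Psi' (u k) = Psi' (v k)) ->
  exists M, forall k, (M <= k)%nat -> u k = v k.
Proof.
  intros (Hr & Hc & HN & Hz & Hk) Hu Hv E.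
  destruct (Ccv_Cmod_lt u c0 _ Hu Hc) as [M1 HM1].
  destruct (Ccv_Cmod_lt v c0 _ Hv Hc) as [M2 HM2].
  destruct (Ccv_Cmod_gt (fun k => fi (u k) N (u k)) (fi c0 N c0) (r + 10)) as [M3 HM3];
    [now apply fi_cv|auto|].
  destruct (Ccv_Cmod_gt (fun k => fi (v k) N (v k)) (fi c0 N c0) (r + 10)) as [M4 HM4];
    [now apply fi_cv|auto|].
  destruct (contr_eventually u v u v c0 N 1) as [M5 HM5]; auto.
  exists (Nat.max (Nat.max M1 M2) (Nat.max M3 (Nat.max M4 M5))). intros k Hkk.
  specialize (HM1 k ltac:(lia)). specialize (HM2 k ltac:(lia)).
  specialize (HM3 k ltac:(lia)). specialize (HM4 k ltac:(lia)).
  destruct (HM5 k ltac:(lia)) as [HM6 HM7]. cbv beta in HM3, HM4.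
  assert (Eu := Psi_conj (u k) r N Hr ltac:(lra) ltac:(lra)).
  assert (Ev := Psi_conj (v k) r N Hr ltac:(lra) ltac:(lra)).
  rewrite E, Ev in Eu.
  set (x := fi (u k) N (u k)) in *. set (y := fi (v k) N (v k)) in *.
  assert (Fx : far (u k) x) by (apply far_of_radius with r; lra).
  assert (Fy : far (v k) y) by (apply far_of_radius with r; lra).
  assert (Fx0 := far_far0 _ _ Fx). assert (Fy0 := far_far0 _ _ Fy).
  (* The margin 10 in [expanding] is used here: the image under [Sh] loses at most 5 and still lies
     beyond r. *)
  assert (Hw := Sh_Cmod_ge (u k) 0 x Fx Fx0).
  set (w := Sh' (u k) 0 x) in *.
  assert (Hxy : Cmod (x - y) <= / 9 * Cmod (u k - v k)).
  { rewrite <- (Sh_inv (u k) 0 x) by auto. fold w.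
    replace (/ 9 * Cmod (u k - v k)) with (Cmod (u k - v k) / 9) by field.
    apply Sh_lip.
    - apply far_0. lra.
    - apply far_of_radius with r; lra.
    - intro n. rewrite Cmod_minus_sym. rewrite <- Eu. now apply (Sh_spec (v k) 0 y). }
  assert (H := orbit_kap (u k) (v k) (u k) (v k) N (/ 9) HM7 Hxy).
  apply Cmod_minus_le0. 
  apply Rnot_lt_le. intro Hlt. nra.
Qed.

Lemma chain_step (c z : nat -> C) (p0 p1 c0 : C) :
  Ccv c c0 -> Ccv z p1 -> p0 <> 0%C -> ff c0 p0 = p1 ->
  Ccv (fun k => h' (hh p0 * csqrt ((z k - c k) / (hh p0 * hh p0)))%C) p0 /\
  exists M, forall k, (M <= k)%nat ->
    ff (c k) (h' (hh p0 * csqrt ((z k - c k) / (hh p0 * hh p0)))%C) = z k.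
Proof.
  intros Hc Hz H0 E. assert (Hh := h_neq_0 p0 H0).
  assert (Hu : Ccv (fun k => (z k - c k) / (hh p0 * hh p0))%C 1%C).
  { replace (RtoC 1) with ((p1 - c0) / (hh p0 * hh p0))%C
      by (rewrite <- E, f_eq; field; auto).
    apply Ccv_div; auto using Ccv_const, Ccv_minus. now apply Cmult_neq_0. }
  split.
  - assert (E1 : h' (hh p0 * csqrt 1)%C = p0) by (rewrite csqrt_1, Cmult_1_r; apply hinv_l).
    assert (Hl : Ccv (fun k => h' (hh p0 * csqrt ((z k - c k) / (hh p0 * hh p0)))%C)
                   (h' (hh p0 * csqrt 1)%C)).
    { apply hinv_cv, Ccv_mult; [apply Ccv_const|]. apply csqrt_cv; [simpl; lra|auto]. }
    now rewrite E1 in Hl.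
  - apply Ccv_iff with (eps := / 2) in Hu; [|lra]. destruct Hu as [M HM].
    exists M. intros k Hk. specialize (HM k Hk). rewrite f_eq, hinv_r.
    set (w := ((z k - c k) / (hh p0 * hh p0))%C) in *.
    replace (hh p0 * csqrt w * (hh p0 * csqrt w))%C with (hh p0 * hh p0 * (csqrt w * csqrt w))%C
      by ring.
    rewrite csqrt_sqr.
    + unfold w. field. auto.
    + apply fst_pos_near_1 with (/ 2); lra.
Qed.

Lemma chain_cv (c0 : C) (N : nat) (c z : nat -> C) (p := fun i => fi c0 i c0) :
  Ccv c c0 -> Ccv z (p N) -> (forall i, p i <> 0%C) ->
  Ccv (fun k => chain K theta p (c k) (z k) N) c0 /\
  exists M, forall k, (M <= k)%nat -> fi (c k) N (chain K theta p (c k) (z k) N) = z k.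
Proof.
  intros Hc Hz Hp. revert z Hz. induction N as [|N IH]; intros z Hz; cbn [chain].
  - split; auto. exists 0%nat. reflexivity.
  - destruct (chain_step c z (p N) (p (S N)) c0 Hc Hz (Hp N) eq_refl) as [H1 [M1 H2]].
    destruct (IH _ H1) as [H3 [M2 H4]]. split; auto.
    exists (Nat.max M1 M2). intros k Hk. rewrite fi_S, H4 by lia. apply H2. lia.
Qed.

(** Equal images under [f_0] mean equality up to sign, and the minus sign is excluded since the sum
    of the two points tends to twice a nonzero point. *)
Lemma f0_locally_injective (N : nat) (w0 : C) (u v : nat -> C) : w0 <> 0%C ->
  Ccv u w0 -> Ccv v w0 -> (forall k, fi 0 N (u k) = fi 0 N (v k)) ->
  exists M, forall k, (M <= k)%nat -> u k = v k.
Proof.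
  intros H0 Hu Hv E.
  assert (Main : forall i, (i <= N)%nat ->
    exists M, forall k, (M <= k)%nat -> fi 0 (N - i) (u k) = fi 0 (N - i) (v k)).
  { induction i as [|i IH]; intro Hi.
    - exists 0%nat. intros k _. now rewrite Nat.sub_0_r.
    - destruct IH as [M HM]; [lia|].
      set (j := (N - S i)%nat). replace (N - i)%nat with (S j) in HM by lia.
      assert (Hj : 0 < Cmod (fi 0 j w0)) by (now apply Cmod_gt_0, fi0_neq_0).
      assert (Cu : Ccv (fun k => fi 0 j (u k)) (fi 0 j w0))
        by (apply (fi_cv j (fun _ => RtoC 0)); auto using Ccv_const).
      assert (Cv : Ccv (fun k => fi 0 j (v k)) (fi 0 j w0))
        by (apply (fi_cv j (fun _ => RtoC 0)); auto using Ccv_const).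
      destruct (Ccv_Cmod_gt _ _ 0 (Ccv_plus _ _ _ _ Cu Cv)) as [M' HM'].
      { rewrite Cdouble.
        rewrite Cmod_mult, Cmod_RtoC_pos by lra. lra. }
      exists (Nat.max M M'). intros k Hk.
      specialize (HM k ltac:(lia)). specialize (HM' k ltac:(lia)).
      rewrite !fi_S in HM. apply f_eq_cases in HM. destruct HM as [|HM]; auto.
      exfalso. cbv beta in HM'. rewrite HM in HM'.
      replace (- fi 0 j (v k) + fi 0 j (v k))%C with (RtoC 0) in HM' by ring.
      rewrite Cmod_0 in HM'. lra. }
  destruct (Main N (le_n _)) as [M HM]. exists M. intros k Hk. specialize (HM k Hk).
  now rewrite Nat.sub_diag in HM.
Qed.

(* The c with [Psi c = w] are the fixed points of c -> T c w, where T c w is the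
   point of the dynamical plane of [f_c] with Böttcher coordinate [w]; its
   Lipschitz constant in [c] is close to sigma. *)
Lemma Psi_locally_surjective (c0 : C) (N : nat) (r : R) (w : nat -> C) :
  expanding K theta c0 N r ->
  Ccv w (Psi' c0) ->
  exists c : nat -> C, Ccv c c0 /\
    exists M, forall k, (M <= k)%nat -> esc (c k) (c k) /\ Psi' (c k) = w k.
Proof.
  intros (Hr & Hc & HN & Hz & Hk) Hw.
  set (w0 := Psi' c0) in *. set (p := fun i => fi c0 i c0).
  assert (Fp : far c0 (p N)) by (apply far_of_radius with r; unfold p; lra).
  assert (Fp0 := far_far0 _ _ Fp).
  assert (Ew0 : fi 0 N w0 = Sh' c0 0 (p N)) by (apply Psi_conj with r; unfold p; lra).
  assert (HW0 := Sh_Cmod_ge c0 0 (p N) Fp Fp0). rewrite <- Ew0 in HW0.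
  assert (Hw0 : w0 <> 0%C).
  { intro E. rewrite E, fi0_0, Cmod_0 in HW0. unfold p in HW0. lra. }
  (* [Sh 0 c] moves the N-th iterate of w into the plane of [f_c], and [chain] pulls it back along
     the critical orbit of c0, where branches are unambiguous. *)
  set (T := fun c w => chain K theta p c (Sh' 0 c (fi 0 N w)) N).
  set (good := fun c w => Cmod c < 2 * r /\ r < Cmod (fi 0 N w) /\
    fi c N (T c w) = Sh' 0 c (fi 0 N w)).
  assert (Hcv : forall c v, Ccv c c0 -> Ccv v w0 -> exists L,
    Ccv (fun k => T (c (L + k)%nat) (v (L + k)%nat)) c0 /\
    forall k, good (c (L + k)%nat) (v (L + k)%nat)).
  { intros c v Cc Cvv.
    destruct (Ccv_Cmod_lt c c0 _ Cc Hc) as [M1 HM1].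
    assert (CF : Ccv (fun k => fi 0 N (v k)) (fi 0 N w0))
      by (apply (fi_cv N (fun _ => RtoC 0)); auto using Ccv_const).
    destruct (Ccv_Cmod_gt _ _ r CF) as [M2 HM2]; [unfold p in HW0; lra|].
    set (L0 := Nat.max M1 M2).
    assert (Cc' : Ccv (fun k => c (L0 + k)%nat) c0)
      by (now apply Ccv_tail).
    assert (CF' : Ccv (fun k => fi 0 N (v (L0 + k)%nat)) (fi 0 N w0))
      by (now apply (Ccv_tail (fun k => fi 0 N (v k)))).
    assert (HZ : Ccv (fun k => Sh' 0 (c (L0 + k)%nat) (fi 0 N (v (L0 + k)%nat))) (p N)).
    { replace (p N) with (Sh' 0 c0 (fi 0 N w0)) by (rewrite Ew0; now apply Sh_inv).
      apply (Sh_cv (fun _ => RtoC 0)); auto using Ccv_const.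
      - intro k. apply far_0. specialize (HM2 (L0 + k)%nat ltac:(lia)). lra.
      - intro k. specialize (HM1 (L0 + k)%nat ltac:(lia)).
        specialize (HM2 (L0 + k)%nat ltac:(lia)). apply far_of_radius with r; lra.
      - apply far_0. unfold p in HW0. lra.
      - apply far_of_radius with r; unfold p in HW0; lra. }
    destruct (chain_cv c0 N _ _ Cc' HZ Hz) as [H1 [M3 H2]]. fold p in H1, H2.
    exists (L0 + M3)%nat. split.
    - apply Ccv_ext with (fun k => T (c (L0 + (M3 + k))%nat) (v (L0 + (M3 + k))%nat)).
      + intro k. now rewrite Nat.add_assoc.
      + apply (Ccv_subs _ c0 (fun k => (M3 + k)%nat)) in H1; [exact H1|]. intro; lia.
    - intro k. split; [apply HM1; lia|split; [apply HM2; lia|]].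
      specialize (H2 (M3 + k)%nat ltac:(lia)). rewrite !Nat.add_assoc in H2. exact H2. }
  (* Halfway to 1: the contraction constant at c0 may grow a little at nearby parameters. *)
  set (q := (1 + kap (contr c0 c0 c0 c0) N (/ 9)) / 2).
  destruct (near_of_seq (C * (C * C))
    (fun x => Rmax (Cmod (fst x - c0))
       (Rmax (Cmod (fst (snd x) - c0)) (Cmod (snd (snd x) - w0))))
    (fun x => good (fst x) (snd (snd x)) /\
       Cmod (T (fst x) (snd (snd x)) - T (fst (snd x)) (snd (snd x))) <=
       Rmax 0 q * Cmod (fst x - fst (snd x)))) as (rho & Hrho & HQ').
  { intros x Hx.
    set (c := fun n => fst (x n)). set (d := fun n => fst (snd (x n))).
    set (v := fun n => snd (snd (x n))).
    assert (Cc : Ccv c c0).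
    { apply Ccv_of_radii. intro n. eapply Rle_trans; [apply Rmax_l|apply Hx]. }
    assert (Cd : Ccv d c0).
    { apply Ccv_of_radii. intro n. eapply Rle_trans; [|apply Hx].
      eapply Rle_trans; [apply Rmax_l|apply Rmax_r]. }
    assert (Cvv : Ccv v w0).
    { apply Ccv_of_radii. intro n. eapply Rle_trans; [|apply Hx].
      eapply Rle_trans; [apply Rmax_r|apply Rmax_r]. }
    destruct (Hcv c v Cc Cvv) as (L1 & CT1 & G1). destruct (Hcv d v Cd Cvv) as (L2 & CT2 & G2).
    set (L := (L1 + L2)%nat).
    assert (CT1' : Ccv (fun k => T (c (L + k)%nat) (v (L + k)%nat)) c0).
    { apply (Ccv_subs _ c0 (fun k => (L2 + k)%nat)) in CT1; [|intro; lia].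
      eapply Ccv_ext; [|exact CT1]. intro k. cbv beta. unfold L. now rewrite Nat.add_assoc. }
    assert (CT2' : Ccv (fun k => T (d (L + k)%nat) (v (L + k)%nat)) c0).
    { apply (Ccv_subs _ c0 (fun k => (L1 + k)%nat)) in CT2; [|intro; lia].
      eapply Ccv_ext; [|exact CT2]. intro k. cbv beta. unfold L.
      now rewrite Nat.add_assoc, (Nat.add_comm L1 L2). }
    destruct (contr_eventually (fun k => c (L + k)%nat) (fun k => d (L + k)%nat) _ _ c0 N q
      (Ccv_tail c c0 L Cc)
      (Ccv_tail d c0 L Cd) CT1' CT2' Hz) as [M HM].
    { unfold q. lra. }
    exists (L + M)%nat. destruct (HM M (le_n _)) as [HM1 HM2].
    assert (Gc : good (c (L + M)%nat) (v (L + M)%nat)).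
    { specialize (G1 (L2 + M)%nat). unfold L. now rewrite Nat.add_assoc in G1. }
    assert (Gd : good (d (L + M)%nat) (v (L + M)%nat)).
    { specialize (G2 (L1 + M)%nat). unfold L.
      now rewrite Nat.add_assoc, (Nat.add_comm L2 L1) in G2. }
    fold (c (L + M)%nat) (d (L + M)%nat) (v (L + M)%nat). split; auto.
    set (c1 := c (L + M)%nat) in *. set (d1 := d (L + M)%nat) in *.
    set (v1 := v (L + M)%nat) in *.
    destruct Gc as (A1 & A2 & A3). destruct Gd as (B1 & B2 & B3).
    eapply Rle_trans; [apply (orbit_kap c1 d1 _ _ N (/ 9) HM2)|].
    - rewrite A3, B3. replace (/ 9 * Cmod (c1 - d1)) with (Cmod (c1 - d1) / 9) by field.
      apply Sh_lip.
      + apply far_0. lra.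
      + apply far_of_radius with r; lra.
      + apply Sh_spec; [apply far_0; lra|apply far_of_radius with r; lra].
    - apply Rmult_le_compat_r; [apply Cmod_ge_0|].
      eapply Rle_trans; [|apply Rmax_r]. lra. }
  assert (HQ : forall c d v, Cmod (c - c0) <= rho -> Cmod (d - c0) <= rho ->
    Cmod (v - w0) <= rho -> good c v /\ Cmod (T c v - T d v) <= Rmax 0 q * Cmod (c - d)).
  { intros c d v H1 H2 H3. apply (HQ' (c, (d, v))). simpl. now repeat apply Rmax_lub. }
  (* The maximum with 0 supplies the nonnegativity that [banach] asks for. *)
  assert (Hq : 0 <= Rmax 0 q < 1).
  { split; [apply Rmax_l|]. apply Rmax_lub_lt; unfold q; lra. }
  set (q' := Rmax 0 q) in *.
  assert (CT0 : Ccv (fun k => T c0 (w k)) c0).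
  { destruct (Hcv (fun _ => c0) w (Ccv_const c0) Hw) as (L & CT & _).
    now apply Ccv_shift with L. }
  assert (Hfix : exists M, forall k, (M <= k)%nat ->
    exists c, Cmod (c - c0) <= rho /\ T c (w k) = c /\ Cmod (w k - w0) <= rho).
  (* The centre moves by less than (1 - q') rho, so the contraction maps the disk of radius rho into
     itself. *)
  { destruct (proj1 (Ccv_iff _ _) CT0 ((1 - q') * rho)) as [M1 HM1];
      [apply Rmult_lt_0_compat; lra|].
    destruct (proj1 (Ccv_iff _ _) Hw rho Hrho) as [M2 HM2].
    exists (Nat.max M1 M2). intros k Hkk.
    specialize (HM1 k ltac:(lia)). specialize (HM2 k ltac:(lia)). cbv beta in HM1.
    assert (H0 : Cmod (c0 - c0) <= rho).
    { rewrite Cmod_diag. lra. }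
    destruct (banach (fun c => T c (w k)) c0 rho q') as (c & Hc1 & Hc2); try lra.
    - intros z Hzz. eapply Rle_trans; [apply (Cmod_minus_triangle _ (T c0 (w k)))|].
      destruct (HQ z c0 (w k) Hzz H0 ltac:(lra)) as [_ H1].
      assert (H2 : q' * Cmod (z - c0) <= q' * rho) by (apply Rmult_le_compat_l; lra).
      lra.
    - intros z y Hzz Hy. apply HQ; auto; lra.
    - exists c. repeat split; auto. lra. }
  destruct Hfix as [M HM].
  set (c := fun k => epsilon (inhabits c0) (fun c =>
    Cmod (c - c0) <= rho /\ T c (w k) = c /\ Cmod (w k - w0) <= rho)).
  assert (Hcs : forall k, (M <= k)%nat ->
    Cmod (c k - c0) <= rho /\ T (c k) (w k) = c k /\ Cmod (w k - w0) <= rho).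
  { intros k Hkk. unfold c. apply epsilon_spec. auto. }
  assert (H0 : Cmod (c0 - c0) <= rho).
  { rewrite Cmod_diag. lra. }
  assert (Cc : Ccv c c0).
  { apply Ccv_shift with M.
    apply Ccv_le with (fun k => / (1 - q') * Cmod (T c0 (w (M + k)%nat) - c0)).
    - intro k. destruct (Hcs (M + k)%nat ltac:(lia)) as (A1 & A2 & A3).
      destruct (HQ (c (M + k)%nat) c0 (w (M + k)%nat) A1 H0 A3) as [_ A4].
      rewrite A2 in A4.
      assert (A5 := Cmod_minus_triangle (c (M + k)%nat) (T c0 (w (M + k)%nat)) c0).
      apply Rmult_le_reg_l with (1 - q'); [lra|].
      rewrite <- Rmult_assoc, Rinv_r, Rmult_1_l by lra. lra.
    - replace 0 with (/ (1 - q') * 0) by ring.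
      apply is_lim_seq_mult'; [apply is_lim_seq_const|].
      exact (Ccv_tail _ _ M CT0). }
  assert (Hfar : forall k, (M <= k)%nat -> esc (c k) (c k) /\
    fi 0 N (Psi' (c k)) = fi 0 N (w k) \/ Cmod (fi (c k) N (c k)) <= r).
  { intros k Hkk. destruct (Hcs k Hkk) as (A1 & A2 & A3).
    destruct (HQ (c k) c0 (w k) A1 H0 A3) as [(B1 & B2 & B3) _]. rewrite A2 in B3.
    destruct (Rlt_le_dec r (Cmod (fi (c k) N (c k)))) as [Hlt|]; [left|now right].
    split.
    - apply escaping_of_far with N. apply far_of_radius with r; lra.
    - rewrite (Psi_conj (c k) r N) by lra. rewrite B3. apply Sh_inv.
      + apply far_0. lra.
      + apply far_of_radius with r; lra. }
  assert (He0 : esc c0 c0) by (now apply escaping_of_far with N).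
  destruct (Ccv_Cmod_gt (fun k => fi (c k) N (c k)) (fi c0 N c0) r) as [M' HM'];
    [now apply fi_cv|lra|].
  set (L := Nat.max M M').
  (* The fixed-point equation only gives equality after N iterations of [f_0]; both sides tend to
     w0, so local injectivity removes the iterates. *)
  destruct (f0_locally_injective N w0 (fun k => Psi' (c (L + k)%nat))
    (fun k => w (L + k)%nat)) as [M2 HM2]; auto.
  - apply (Ccv_tail (fun k => Psi' (c k))). now apply Psi_cv.
  - now apply Ccv_tail.
  - intro k. destruct (Hfar (L + k)%nat ltac:(lia)) as [[_ H]|H]; auto.
    specialize (HM' (L + k)%nat ltac:(lia)). cbv beta in HM'. lra.
  - exists c. split; auto. exists (L + M2)%nat. intros k Hkk.
    specialize (HM2 (k - L)%nat ltac:(lia)). cbv beta in HM2.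
    replace (L + (k - L))%nat with k in HM2 by lia. split; auto.
    destruct (Hfar k ltac:(lia)) as [[H _]|H]; auto.
    specialize (HM' k ltac:(lia)). cbv beta in HM'. lra.
Qed.

(** * The coordinate [Psi] as a homeomorphism *)

Lemma slow_far (m : C -> C) (c w : C) : slow m -> 20 < Cmod w -> Cmod (c - w) <= 5 ->
  far (m c) w.
Proof.
  intros [Hm _] Hw Hc. split; [lra|]. specialize (Hm c).
  assert (H := Cmod_rev_triangle c w). lra.
Qed.

Lemma slow_lip (m : C -> C) (c d w : C) : slow m -> 20 < Cmod w ->
  Cmod (c - w) <= 5 -> Cmod (d - w) <= 5 ->
  Cmod (Sh' 0 (m c) w - Sh' 0 (m d) w) <= / 3 * Cmod (c - d).
Proof.
  intros Hm Hw Hc Hd. assert (F0 : far 0 w) by (apply far_0; lra).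
  eapply Rle_trans; [apply Sh_lip; auto|].
  - now apply slow_far.
  - apply Sh_spec; auto. now apply slow_far.
  - destruct Hm as [_ Hm]. specialize (Hm c d). lra.
Qed.

Lemma slow_fix (m : C -> C) (w : C) : slow m -> 20 < Cmod w ->
  exists c, Cmod (c - w) <= 5 /\ Sh' 0 (m c) w = c.
Proof.
  intros Hm Hw. apply (banach (fun c => Sh' 0 (m c) w) w 5 (/ 3)); try lra.
  - intros c Hc. apply Sh_close; [apply far_0; lra|now apply slow_far].
  - intros c d Hc Hd. now apply slow_lip.
Qed.

Lemma slow_fix_unique (m : C -> C) (w c d : C) : slow m -> 20 < Cmod w ->
  Cmod (c - w) <= 5 -> Sh' 0 (m c) w = c ->
  Cmod (d - w) <= 5 -> Sh' 0 (m d) w = d -> c = d.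
Proof.
  intros Hm Hw Hc Ec Hd Ed. assert (H := slow_lip m c d w Hm Hw Hc Hd).
  rewrite Ec, Ed in H. apply Cmod_minus_le0. lra.
Qed.

Lemma slow_id : slow (fun c => c).
Proof.
  split; intros; [lra|]. assert (H := Cmod_ge_0 (c - d)%C). lra.
Qed.

Lemma Psi_surj_infinity (w : C) : 20 < Cmod w -> exists c, esc c c /\ Psi' c = w.
Proof.
  intro Hw. destruct (slow_fix (fun c => c) w slow_id Hw) as (c & Hc & E).
  assert (Hcw := Cmod_rev_triangle w c). rewrite Cmod_minus_sym in Hcw.
  destruct (Psi_near_infinity c) as [He EP]; [lra|].
  exists c. split; auto. rewrite EP.
  assert (F0 : far 0 w) by (apply far_0; lra).
  assert (F : far c w) by (apply (slow_far (fun c => c)); auto using slow_id).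
  assert (H := Sh_inv 0 c w F0 F). now rewrite E in H.
Qed.

(** Both parameters solve the same contracting fixed-point equation; 25 = 20 + 5 keeps the common
    coordinate beyond 20. *)
Lemma Psi_inj_infinity (c d : C) : 25 < Cmod c -> 25 < Cmod d ->
  Psi' c = Psi' d -> c = d.
Proof.
  intros Hc Hd E.
  destruct (Psi_near_infinity c) as [_ Ec]; [lra|].
  destruct (Psi_near_infinity d) as [_ Ed]; [lra|].
  rewrite Ec, Ed in E.
  assert (Fc : far c c) by (split; lra). assert (Fd : far d d) by (split; lra).
  assert (Fc0 := far_far0 _ _ Fc). assert (Fd0 := far_far0 _ _ Fd).
  assert (Bc := Sh_close c 0 c Fc Fc0). assert (Bd := Sh_close d 0 d Fd Fd0).
  assert (Lc := Sh_Cmod_ge c 0 c Fc Fc0).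
  rewrite Cmod_minus_sym in Bc, Bd.
  apply (slow_fix_unique (fun c => c) (Sh' c 0 c)); auto using slow_id.
  - lra.
  - now apply Sh_inv.
  - now rewrite E.
  - rewrite E. now apply Sh_inv.
Qed.

Lemma Omega_star_local (c : C) : Omega_star' c ->
  exists N r, expanding K theta c N r.
Proof.
  intros [HM Hs]. assert (He : esc c c).
  { apply NNPP. intro H. now apply HM, escaping_critical. }
  destruct (sigma_kap c Hs) as [Hz [N0 HN0]].
  destruct (escaping_radius c He) as (N & r & H1 & H2 & H3).
  exists (N0 + N)%nat, r. repeat split; auto.
  - assert (Hf : far c (fi c N c)) by (apply far_of_radius with r; lra).
    rewrite fi_add. assert (H := far_fi_ge c _ N0 Hf). assert (H0 := pos_INR N0). lra.
  - apply HN0. lia.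
Qed.

Lemma Omega_star_escaping (c : C) : Omega_star' c -> esc c c.
Proof.
  intros [HM _]. apply NNPP. intro H. now apply HM, escaping_critical.
Qed.

Lemma GM_bounded (T : R) (c : C) : GM' c <= T -> Cmod c <= 15 + exp T.
Proof.
  intro H. apply Rnot_lt_le. intro Hlt. assert (He := exp_pos T).
  assert (HL := GM_lower c ltac:(lra)).
  assert (H2 : ln (exp T) < ln (Cmod c - 5)) by (apply ln_increasing; lra).
  rewrite ln_exp in H2. lra.
Qed.

(** Continuity method along the ray s w. Only s >= 1 occurs, so every preimage has potential at
    least [Lg w] > t and stays where sigma < 1; that strict gap makes limits of preimages preimages
    again. *)
Lemma Psi_unique_preimage (t : R) (w : C) : 0 < t ->
  (forall c, t < GM' c -> Omega_star' c) -> w <> 0%C -> t < Lgg w ->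
  exists! c, t < GM' c /\ Psi' c = w.
Proof.
  intros Ht HO Hw HL.
  set (X := fun c => t < GM' c).
  set (Q := fun s => exists! c, X c /\ Psi' c = (RtoC s * w)%C).
  assert (Hsw : forall s, 1 <= s -> (RtoC s * w)%C <> 0%C).
  { intros s Hs. apply RtoC_mult_neq_0; auto; lra. }
  assert (HLs : forall s, 1 <= s -> Lgg (RtoC s * w) = ln s + Lgg w)
    by (intros s Hs; apply Lg_scal; auto; lra).
  assert (Hln : forall s, 1 <= s -> 0 <= ln s).
  { intros s Hs. rewrite <- ln_1. apply ln_le; lra. }
  assert (HX : forall c s, 1 <= s -> esc c c -> Psi' c = (RtoC s * w)%C -> 
    GM' c = ln s + Lgg w /\ X c).
  { intros c s Hs He E. destruct (GM_escaping c He) as (_ & EG & _).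
    rewrite E, HLs in EG by auto. unfold X. specialize (Hln s Hs). split; lra. }
  assert (Xe : forall c, X c -> esc c c) by (intros c Hc; now apply Omega_star_escaping, HO).
  assert (Hcomp : forall B (s : nat -> R) l (c : nat -> C),
    (forall n, 1 <= s n <= B) -> 1 <= l -> is_lim_seq s (Finite l) ->
    (forall n, X (c n) /\ Psi' (c n) = (RtoC (s n) * w)%C) ->
    exists p d, (forall n, (n <= p n)%nat) /\ Ccv (fun n => c (p n)) d /\
      X d /\ Psi' d = (RtoC l * w)%C).
  { intros B s l c Hs Hl Hsl Hc.
    destruct (complex_bolzano c (15 + exp (ln B + Lgg w))) as (p & d & Hp & Hd).
    { intro n. apply GM_bounded. destruct (Hc n) as [H1 H2]. specialize (Hs n).
      destruct (HX (c n) (s n)) as [H3 _]; auto; try lra. rewrite H3.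
      apply Rplus_le_compat_r, ln_le; lra. }
    destruct (GM_closed (fun n => c (p n)) d (Lgg w)) as [He Hge]; auto; try lra.
    { intro n. destruct (Hc (p n)) as [H1 H2]. specialize (Hs (p n)).
      destruct (HX (c (p n)) (s (p n))) as [H3 _]; auto; try lra. rewrite H3.
      specialize (Hln (s (p n)) ltac:(lra)). lra. }
    exists p, d. repeat split; auto; [unfold X; lra|].
    apply (Ccv_unique (fun n => Psi' (c (p n)))); [now apply Psi_cv|].
    apply Ccv_ext with (fun n => (RtoC (s (p n)) * w)%C).
    - intro n. symmetry. apply Hc.
    - apply Ccv_mult; [|apply Ccv_const]. apply Ccv_RtoC.
      now apply (is_lim_seq_subs s (Finite l) p). }
  assert (Hsurj : forall (s : nat -> R) l c, (forall n, 1 <= s n) -> is_lim_seq s (Finite l) ->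
    X c -> Psi' c = (RtoC l * w)%C ->
    exists d, Ccv d c /\ exists M, forall k, (M <= k)%nat ->
      X (d k) /\ Psi' (d k) = (RtoC (s k) * w)%C).
  { intros s l c Hs Hsl Hc E.
    destruct (Omega_star_local c (HO c Hc)) as (N & r & Hx).
    destruct (Psi_locally_surjective c N r (fun k => RtoC (s k) * w)%C) as (d & Hd & M & HM);
      auto.
    - rewrite E. apply Ccv_mult; [|apply Ccv_const]. now apply Ccv_RtoC.
    - exists d. split; auto. exists M. intros k Hk. destruct (HM k Hk) as [He EP].
      split; auto. now apply (HX (d k) (s k)). }
  assert (Hinj : forall c u v, X c -> Ccv u c -> Ccv v c ->
    (forall k : nat, Psi' (u k) = Psi' (v k)) -> exists k, u k = v k).
  { intros c u v Hc Hu Hv E.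
    destruct (Omega_star_local c (HO c Hc)) as (N & r & Hx).
    destruct (Psi_locally_injective c N r u v) as [M HM]; auto. exists M. now apply HM. }
  (* The second bound places B w beyond 20, for surjectivity; the third makes the potential exceed
     its maximum on {|c| <= 25}, so all preimages lie where injectivity is known. *)
  destruct (upper_bound4 1 (21 / Cmod w) (exp (green_bound K 25)) 0)
    as (B & HB1 & HB2 & HB3 & _).
  assert (QB : Q B).
  { assert (Hm : 0 < Cmod w) by (now apply Cmod_gt_0).
    destruct (Psi_surj_infinity (RtoC B * w)%C) as (c & He & E).
    { rewrite Cmod_mult, Cmod_RtoC_pos by lra.
      apply (Rmult_le_compat_r (Cmod w)) in HB2; [|lra].
      unfold Rdiv in HB2. rewrite Rmult_assoc, Rinv_l in HB2 by lra. lra. }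
    assert (Hbig : forall d, X d -> Psi' d = (RtoC B * w)%C -> 25 < Cmod d).
    { intros d Hd Ed. apply Rnot_le_lt. intro Hle. apply GM_upper in Hle.
      destruct (HX d B HB1 (Xe d Hd) Ed) as [EG _].
      assert (H : ln (exp (green_bound K 25)) <= ln B) by (apply ln_le; auto using exp_pos).
      rewrite ln_exp in H. lra. }
    assert (Hc : X c) by (now apply (HX c B)).
    exists c. split; auto. intros d [Hd Ed].
    apply Psi_inj_infinity; auto. now rewrite E. }
  assert (Q1 : Q 1).
  { apply (interval_clopen 1 B Q) with B; try lra; auto.
    (* Uniqueness survives in the limit: two distinct preimages over l would both continue to
       distinct preimages over s_k. *)
    - intros s l Hs Hl Hsl HQ.
      set (c := fun n => epsilon (inhabits w)
        (fun c => X c /\ Psi' c = (RtoC (s n) * w)%C)).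
      assert (Hc : forall n, X (c n) /\ Psi' (c n) = (RtoC (s n) * w)%C).
      { intro n. unfold c. apply epsilon_spec. destruct (HQ n) as (d & Hd & _). now exists d. }
      destruct (Hcomp B s l c) as (p & d & Hp & Hd & Xd & Ed); auto; try lra.
      exists d. split; auto. intros d' [Xd' Ed']. apply NNPP. intro Hne.
      destruct (Hsurj s l d) as (u & Hu & M & HM); auto; [apply Hs|].
      destruct (Hsurj s l d') as (v & Hv & M' & HM'); auto; [apply Hs|].
      assert (Hdd : 0 < Cmod (d - d')).
      { apply Cmod_gt_0. intro E. now apply Hne, Cminus_eq0. }
      destruct (Ccv_Cmod_gt _ _ 0 (Ccv_minus _ _ _ _ Hu Hv) Hdd) as [M2 HM2].
      set (k := Nat.max M (Nat.max M' M2)).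
      specialize (HM k ltac:(lia)). specialize (HM' k ltac:(lia)). specialize (HM2 k ltac:(lia)).
      destruct (HQ k) as (e & _ & He). cbv beta in HM2.
      rewrite <- (He (u k)), <- (He (v k)) in HM2 by auto.
      rewrite Cmod_diag in HM2. lra.
    (* Failure survives too: continue the unique preimage over l to u; second preimages v different
       from u accumulate at the same c, against local injectivity. *)
    - intros s l Hs Hl Hsl HQ (c & [Xc Ec] & Huc).
      destruct (Hsurj s l c) as (u & Hu & M & HM); auto; [apply Hs|].
      set (v := fun n => epsilon (inhabits w)
        (fun c => (X c /\ Psi' c = (RtoC (s (M + n)%nat) * w)%C) /\ c <> u (M + n)%nat)).
      assert (Hv : forall n, (X (v n) /\ Psi' (v n) = (RtoC (s (M + n)%nat) * w)%C) /\
                             v n <> u (M + n)%nat).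
      { intro n. unfold v. apply epsilon_spec. apply NNPP. intro Hno.
        apply (HQ (M + n)%nat). exists (u (M + n)%nat). split; [apply HM; lia|].
        intros d Hd. apply NNPP. intro Hne. apply Hno. exists d. split; auto. }
      destruct (Hcomp B (fun n => s (M + n)%nat) l v) as (p & d & Hp & Hd & Xd & Ed);
        auto; try lra.
      + apply (is_lim_seq_subs s _ (fun n => (M + n)%nat)); auto. intro; lia.
      + intro n. apply Hv.
      + rewrite <- (Huc d) in Hd by auto.
        destruct (Hinj c (fun n => v (p n)) (fun n => u (M + p n)%nat)) as [k Hk]; auto.
        * apply (Ccv_subs (fun n => u (M + n)%nat)); auto. now apply Ccv_tail.
        * intro k. rewrite (proj2 (proj1 (Hv (p k)))). symmetry. apply HM. lia.
        * now apply (Hv (p k)). }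
  unfold Q in Q1. now rewrite Cmult_1_l in Q1.
Qed.

Lemma Psi_homeomorphism (t : R) : 0 < t ->
  (forall c, t < GM' c -> Omega_star' c) ->
  exists g : C -> C,
    (forall c, t < GM' c -> t < G0' (Psi' c)) /\
    (forall w, t < G0' w -> t < GM' (g w)) /\
    (forall c, t < GM' c -> g (Psi' c) = c) /\
    (forall w, t < G0' w -> Psi' (g w) = w) /\
    seq_cont_on (fun c => t < GM' c) (Psi') /\
    seq_cont_on (fun w => t < G0' w) g.
Proof.
  intros Ht HO.
  set (X := fun c => t < GM' c).
  assert (Xe : forall c, X c -> esc c c) by (intros c Hc; now apply Omega_star_escaping, HO).
  assert (XY : forall c, X c -> t < G0' (Psi' c)).
  { intros c Hc. destruct (GM_escaping c (Xe c Hc)) as (H1 & H2 & _).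
    apply G0_gt_iff; [lra|]. rewrite <- H2. auto. }
  set (g := fun w => epsilon (inhabits w) (fun c => X c /\ Psi' c = w)).
  assert (Hg : forall w, t < G0' w -> X (g w) /\ Psi' (g w) = w).
  { intros w Hw. unfold g. apply epsilon_spec. apply G0_gt_iff in Hw; [|lra].
    destruct Hw as [H1 H2].
    destruct (Psi_unique_preimage t w Ht HO H1 H2) as (c & Hc & _). now exists c. }
  assert (Hun : forall c d, X c -> X d -> Psi' c = Psi' d -> c = d).
  { intros c d Hc Hd E. assert (Hw := XY c Hc). apply G0_gt_iff in Hw; [|lra].
    destruct Hw as [H1 H2].
    destruct (Psi_unique_preimage t _ Ht HO H1 H2) as (e & _ & He).
    rewrite <- (He c), <- (He d); auto. }
  exists g. split; [|split; [|split; [|split; [|split]]]].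
  - exact XY.
  - intros w Hw. now apply Hg.
  - intros c Hc. destruct (Hg (Psi' c)); auto.
  - intros w Hw. now apply Hg.
  - intros u l Hl _ Hu. apply Psi_cv; auto.
  - intros u l Hl Hu Hul.
    assert (Hn : forall w, t < G0' w -> w <> 0%C /\ t < Lgg w)
      by (intros w Hw; apply G0_gt_iff; [lra|auto]).
    assert (HLc : is_lim_seq (fun n => Lgg (u n)) (Lgg l)).
    { apply Lg_cv; auto; [now apply Hn|]. intro n. now apply Hn. }
    assert (HGL : forall w, t < G0' w -> GM' (g w) = Lgg w).
    { intros w Hw. destruct (Hg w Hw) as [H1 H2].
      destruct (GM_escaping (g w) (Xe _ H1)) as (_ & H & _). now rewrite H, H2. }
    destruct (filterlim_bounded (fun n => Lgg (u n))) as [T HT];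
      [exists (Lgg l); exact HLc|].
    apply Ccv_of_compact with (15 + exp T).
    + intro n. apply GM_bounded. rewrite HGL by auto.
      eapply Rle_trans; [apply Rle_abs|apply HT].
    + intros p d Hp Hd.
      destruct (GM_closed (fun n => g (u (p n))) d t) as [He _]; auto.
      { intro n. rewrite HGL by auto. left. now apply Hn. }
      assert (HP : Psi' d = l).
      { apply (Ccv_unique (fun n => Psi' (g (u (p n))))); [now apply Psi_cv|].
        apply Ccv_ext with (fun n => u (p n)); [|now apply Ccv_subs].
        intro n. symmetry. now apply Hg. }
      apply Hun.
      * unfold X. destruct (GM_escaping d He) as (_ & H & _). rewrite H, HP. now apply Hn.
      * now apply Hg.
      * rewrite HP. symmetry. now apply Hg.
Qed.

(** * Sublevel sets are disks *)

(** For 20 < |w| <= 25 the cut-off vanishes near w, so the identity solves the same fixed-point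
    equation; this overlap makes the two cases fit together continuously. *)
Lemma blend_spec (w : C) : 20 < Cmod w ->
  Cmod (blend' w - w) <= 5 /\
  Sh' 0 (cutoff (blend' w)) w = blend' w.
Proof.
  intro Hw. unfold blend. destruct (Rle_dec (Cmod w) 25) as [H|H].
  - split.
    + rewrite Cmod_diag. lra.
    + rewrite cutoff_small by lra. apply Sh_same, far_0. lra.
  - apply epsilon_spec. apply slow_fix; auto using cutoff_slow.
Qed.

Lemma blend_unique (w c : C) : 20 < Cmod w -> Cmod (c - w) <= 5 ->
  Sh' 0 (cutoff c) w = c -> blend' w = c.
Proof.
  intros Hw Hc E. destruct (blend_spec w Hw) as [H1 H2].
  apply (slow_fix_unique cutoff w); auto using cutoff_slow.
Qed.

Lemma blend_inv_close (c : C) : Cmod (blend_inv' c - c) <= 5.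
Proof.
  unfold blend_inv. destruct (Rle_dec (Cmod c) 30) as [H|H].
  - rewrite Cmod_diag. lra.
  - apply Sh_close; [|apply far_0; lra]. split; [lra|].
    assert (H1 := proj1 cutoff_slow c). lra.
Qed.

Lemma blend_blend_inv (c : C) : blend' (blend_inv' c) = c.
Proof.
  assert (Hc := blend_inv_close c). rewrite Cmod_minus_sym in Hc.
  revert Hc. unfold blend_inv. destruct (Rle_dec (Cmod c) 30) as [H|H]; intro Hc.
  - destruct (Rle_dec (Cmod c) 25) as [H2|H2].
    + unfold blend. now destruct (Rle_dec (Cmod c) 25).
    + apply blend_unique; auto; [lra|]. rewrite cutoff_small by auto. apply Sh_same, far_0. lra.
  - assert (Hm := proj1 cutoff_slow c).
    assert (F : far (cutoff c) c) by (split; lra). assert (F0 := far_far0 _ _ F).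
    apply blend_unique; auto.
    + assert (H1 := Sh_Cmod_ge (cutoff c) 0 c F F0). lra.
    + now apply Sh_inv.
Qed.

Lemma blend_inv_blend (w : C) : blend_inv' (blend' w) = w.
Proof.
  destruct (Rle_dec (Cmod w) 25) as [H|H].
  - unfold blend. destruct (Rle_dec (Cmod w) 25); [|easy].
    unfold blend_inv. destruct (Rle_dec (Cmod w) 30); auto; lra.
  - destruct (blend_spec w) as [H1 H2]; [lra|]. set (c := blend' w) in *.
    unfold blend_inv. destruct (Rle_dec (Cmod c) 30) as [Hc|Hc].
    + rewrite cutoff_small, Sh_same in H2; auto. apply far_0. lra.
    + assert (F : far (cutoff c) w) by (apply slow_far; auto using cutoff_slow; lra).
      assert (F0 := far_far0 _ _ F). rewrite <- H2 at 2. now apply Sh_inv.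
Qed.

Lemma blend_cv (u : nat -> C) (l : C) : Ccv u l ->
  Ccv (fun n => blend' (u n)) (blend' l).
Proof.
  intro Hu. destruct (Rle_lt_dec (Cmod l) 20) as [Hl|Hl].
  - destruct (Ccv_Cmod_lt u l 25 Hu) as [N HN]; [lra|].
    apply Ccv_ext_loc with u N.
    + intros n Hn. specialize (HN n Hn). unfold blend.
      destruct (Rle_dec (Cmod (u n)) 25); auto; lra.
    + unfold blend. destruct (Rle_dec (Cmod l) 25); auto; lra.
  - destruct (Ccv_Cmod_gt u l 20 Hu Hl) as [N HN].
    apply Ccv_shift with N.
    destruct (blend_spec l Hl) as [Hl1 Hl2]. set (c := blend' l) in *.
    assert (Fl : far (cutoff c) l) by (apply slow_far; auto using cutoff_slow).
    assert (Hfar : exists N3, forall n, (N3 <= n)%nat -> far (cutoff c) (u n)).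
    { destruct (Ccv_Cmod_gt u l (Cmod l - 5) Hu) as [N3 HN3]; [lra|].
      exists (Nat.max N N3). intros n Hn. specialize (HN3 n ltac:(lia)).
      specialize (HN n ltac:(lia)). split; [lra|].
      assert (Hm := proj1 cutoff_slow c). assert (Ht := Cmod_rev_triangle c l). lra. }
    destruct Hfar as [N3 HN3].
    apply Ccv_shift with N3.
    set (v := fun n => u (N + (N3 + n))%nat).
    assert (Hv : Ccv v l) by (apply (Ccv_subs u l (fun n => (N + (N3 + n))%nat)); auto; intro; lia).
    assert (HS : Ccv (fun n => Sh' 0 (cutoff c) (v n)) (Sh' 0 (cutoff c) l)).
    { apply (Sh_cv (fun _ => RtoC 0) (fun _ => cutoff c));
        auto using Ccv_const.
      - intro n. apply far_0. unfold v. specialize (HN (N + (N3 + n))%nat ltac:(lia)). lra.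
      - intro n. apply HN3. lia.
      - apply far_0. lra. }
    rewrite Hl2 in HS.
    (* Freezing the parameter at the limit costs a third of |d - c|, which is absorbed on the left;
       3/2 is 1/(1 - 1/3). *)
    apply Ccv_le with (fun n => 3 / 2 * Cmod (Sh' 0 (cutoff c) (v n) - c)).
    + intro n. change (u (N + (N3 + n))%nat) with (v n).
      assert (Hvn : 20 < Cmod (v n)) by (apply HN; lia).
      destruct (blend_spec (v n) Hvn) as [B1 B2]. set (d := blend' (v n)) in *.
      assert (Fn : far (cutoff c) (v n)) by (apply HN3; lia).
      assert (HL : Cmod (Sh' 0 (cutoff d) (v n) - Sh' 0 (cutoff c) (v n))
                   <= / 3 * Cmod (d - c)).
      { assert (F0 : far 0 (v n)) by (apply far_0; lra).
        eapply Rle_trans; [apply Sh_lip; auto|].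
        - apply slow_far; auto using cutoff_slow.
        - now apply Sh_spec.
        - assert (H := proj2 cutoff_slow d c). lra. }
      rewrite B2 in HL.
      assert (Ht := Cmod_minus_triangle d (Sh' 0 (cutoff c) (v n)) c). lra.
    + replace (Finite 0) with (Finite (3 / 2 * 0)) by (f_equal; ring).
      apply is_lim_seq_mult'; auto using is_lim_seq_const.
Qed.

Lemma angular_bounds (z : C) : z <> 0%C -> 0 <= angular' z <= 2 * ln K.
Proof. intro Hz. assert (H := Lg_bounds z Hz). unfold angular. lra. Qed.

Lemma angular_scal (r : R) (z : C) : 0 < r -> z <> 0%C ->
  angular' (RtoC r * z)%C = angular' z.
Proof.
  intros Hr Hz. unfold angular. rewrite Lg_scal, Cmod_mult, Cmod_RtoC_pos by (auto; lra).
  rewrite ln_mult; auto; [ring|now apply Cmod_gt_0].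
Qed.

Lemma radial_eq (T : R) (z : C) : z <> 0%C ->
  radial' T z = (RtoC (exp (T - angular' z)) * z)%C /\
  radial' T z <> 0%C /\ Lgg (radial' T z) = T + ln (Cmod z).
Proof.
  intro Hz. unfold radial. destruct excluded_middle_informative as [|_]; [easy|].
  assert (He := exp_pos (T - angular' z)). split; auto. split.
  - now apply RtoC_mult_neq_0.
  - rewrite Lg_scal, ln_exp by auto. unfold angular. ring.
Qed.

Lemma radial_inv_eq (T : R) (w : C) : w <> 0%C ->
  radial_inv' T w = (RtoC (exp (angular' w - T)) * w)%C /\
  radial_inv' T w <> 0%C /\ Cmod (radial_inv' T w) = exp (Lgg w - T).
Proof.
  intro Hw. unfold radial_inv. destruct excluded_middle_informative as [|_]; [easy|].
  assert (He := exp_pos (angular' w - T)). split; auto. split.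
  - now apply RtoC_mult_neq_0.
  - assert (Hm : 0 < Cmod w) by (now apply Cmod_gt_0).
    rewrite Cmod_mult, Cmod_RtoC_pos by lra. unfold angular.
    replace (Lgg w - ln (Cmod w) - T) with (Lgg w - T + - ln (Cmod w)) by ring.
    rewrite exp_plus, exp_Ropp, exp_ln by auto. field. lra.
Qed.

Lemma radial_radial_inv (T : R) (w : C) : radial' T (radial_inv' T w) = w.
Proof.
  destruct (excluded_middle_informative (w = 0%C)) as [->|Hw].
  - unfold radial_inv. destruct excluded_middle_informative as [_|N]; [|easy].
    unfold radial. destruct excluded_middle_informative as [_|N]; easy.
  - destruct (radial_inv_eq T w Hw) as (E & Hn & _).
    destruct (radial_eq T _ Hn) as (E2 & _ & _). rewrite E2, E.
    rewrite angular_scal by (auto; apply exp_pos).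
    rewrite Cmult_assoc, <- RtoC_mult, <- exp_plus.
    replace (T - angular' w + (angular' w - T)) with 0 by ring.
    rewrite exp_0. ring.
Qed.

Lemma radial_inv_radial (T : R) (z : C) : radial_inv' T (radial' T z) = z.
Proof.
  destruct (excluded_middle_informative (z = 0%C)) as [->|Hz].
  - unfold radial. destruct excluded_middle_informative as [_|N]; [|easy].
    unfold radial_inv. destruct excluded_middle_informative as [_|N]; easy.
  - destruct (radial_eq T z Hz) as (E & Hn & _).
    destruct (radial_inv_eq T _ Hn) as (E2 & _ & _). rewrite E2, E.
    rewrite angular_scal by (auto; apply exp_pos).
    rewrite Cmult_assoc, <- RtoC_mult, <- exp_plus.
    replace (angular' z - T + (T - angular' z)) with 0 by ring.
    rewrite exp_0. ring.
Qed.

Lemma radial_cv (T : R) (u : nat -> C) (l : C) : Ccv u l ->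
  Ccv (fun n => radial' T (u n)) (radial' T l).
Proof.
  intro Hu. destruct (excluded_middle_informative (l = 0%C)) as [->|Hl].
  - assert (E0 : radial' T 0 = 0%C).
    { unfold radial. now destruct excluded_middle_informative. }
    rewrite E0. apply Ccv_le with (fun n => exp T * Cmod (u n)).
    + intro n. replace (radial' T (u n) - 0)%C with (radial' T (u n)) by ring.
      destruct (excluded_middle_informative (u n = 0%C)) as [->|Hn].
      * rewrite E0, Cmod_0. lra.
      * destruct (radial_eq T (u n) Hn) as (-> & _).
        assert (He := exp_pos (T - angular' (u n))).
        rewrite Cmod_mult, Cmod_RtoC_pos by lra.
        apply Rmult_le_compat_r; [apply Cmod_ge_0|].
        assert (Hb := angular_bounds (u n) Hn).
        destruct (Req_dec (angular' (u n)) 0) as [->|Hne].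
        -- rewrite Rminus_0_r. lra.
        -- left. apply exp_increasing. lra.
    + replace 0 with (exp T * Cmod 0) by (rewrite Cmod_0; ring).
      apply is_lim_seq_mult'; [apply is_lim_seq_const|]. now apply Ccv_Cmod.
  - assert (Hm : 0 < Cmod l) by (now apply Cmod_gt_0).
    destruct (Ccv_Cmod_gt u l 0 Hu Hm) as [N HN].
    apply Ccv_shift with N.
    assert (Hn : forall n, u (N + n)%nat <> 0%C)
      by (intro n; apply Cmod_pos_iff, HN; lia).
    assert (Hv := Ccv_tail u l N Hu).
    destruct (radial_eq T l Hl) as (-> & _).
    apply Ccv_ext with (fun n => RtoC (exp (T - angular' (u (N + n)%nat))) * u (N + n)%nat)%C.
    + intro n. symmetry. now apply radial_eq.
    + apply Ccv_mult; auto. apply Ccv_RtoC, exp_cv.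
      apply is_lim_seq_minus'; [apply is_lim_seq_const|].
      apply is_lim_seq_minus'; [now apply Lg_cv|].
      apply ln_cv; auto. now apply Ccv_Cmod.
Qed.

Lemma G0_le_iff (w : C) (T : R) : 0 <= T ->
  (G0' w <= T <-> (w <> 0%C -> Lgg w <= T)).
Proof.
  intro HT. assert (H := G0_gt_iff w T HT). split.
  - intros HG Hw. apply Rnot_lt_le. intro Hlt. apply Rle_not_lt in HG. apply HG, H. auto.
  - intro HL. apply Rnot_lt_le. intro Hlt. apply H in Hlt. destruct Hlt as [H1 H2].
    specialize (HL H1). lra.
Qed.

Lemma G0_eq_iff (w : C) (t : R) : 0 < t -> (G0' w = t <-> w <> 0%C /\ Lgg w = t).
Proof.
  intro Ht. destruct (classic (esc 0 w)) as [He|He].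
  - rewrite G0_escaping by auto. apply escaping0_iff in He. tauto.
  - rewrite G0_not_escaping by auto. rewrite escaping0_iff in He. split; [lra|].
    intros [H1 H2]. exfalso. apply He. split; auto; lra.
Qed.

Lemma radial_disk (T : R) (z : C) : 0 <= T ->
  (Cmod z <= 1 <-> G0' (radial' T z) <= T).
Proof.
  intro HT. rewrite G0_le_iff by auto.
  destruct (excluded_middle_informative (z = 0%C)) as [->|Hz].
  - rewrite Cmod_0. split; [|lra]. intros _ H. exfalso. apply H.
    unfold radial. now destruct excluded_middle_informative.
  - destruct (radial_eq T z Hz) as (_ & Hn & E). rewrite E.
    assert (Hm : 0 < Cmod z) by (now apply Cmod_gt_0). split.
    + intros H _. assert (H1 : ln (Cmod z) <= ln 1) by (apply ln_le; auto).
      rewrite ln_1 in H1. lra.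
    + intro H. specialize (H Hn). apply Rnot_lt_le. intro Hlt.
      assert (H1 : ln 1 < ln (Cmod z)) by (apply ln_increasing; lra).
      rewrite ln_1 in H1. lra.
Qed.

(** Beyond |c| = 60 the cut-off is the identity, so w is exactly [Psi c] and potentials match.
    Inside, |w| <= 65 and both potentials are below the threshold. *)
Lemma blend_level (T : R) (w : C) : green_bound K 65 <= T ->
  (G0' w <= T <-> GM' (blend' w) <= T).
Proof.
  intro HT. assert (Hb := green_bound_pos 65 ltac:(lra)).
  assert (Ew := blend_inv_blend w). set (c := blend' w) in *.
  destruct (Rle_lt_dec (Cmod c) 60) as [Hc|Hc].
  - assert (HG := GM_upper 65 c ltac:(lra)).
    assert (Hw := blend_inv_close c). rewrite Ew in Hw.
    assert (Hw2 := Cmod_rev_triangle w c).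
    assert (H0 : G0' w <= T).
    { apply G0_le_iff; [lra|]. intro Hn. assert (HL := Lg_bounds w Hn).
      assert (Hm : 0 < Cmod w) by (now apply Cmod_gt_0).
      assert (H1 : ln (Cmod w) <= ln (Rmax 1 65)).
      { apply ln_le; auto. eapply Rle_trans; [|apply Rmax_r]. lra. }
      assert (H2 : ln 1 <= ln (K * K + 65)) by (apply ln_le; nra).
      assert (H3 : ln 1 <= ln 2) by (apply ln_le; lra). rewrite ln_1 in *.
      unfold green_bound in HT. lra. }
    split; intros _; lra.
  - destruct (Psi_near_infinity c) as [He EP]; [lra|].
    unfold blend_inv in Ew. destruct (Rle_dec (Cmod c) 30); [lra|].
    rewrite cutoff_large in Ew by lra. rewrite <- EP in Ew.
    destruct (GM_escaping c He) as (H1 & H2 & H3).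
    rewrite H2, Ew. rewrite Ew in H1. rewrite G0_le_iff by lra. tauto.
Qed.

(** Slides c along its parameter ray until its potential has been stretched; [g] stands for the
    inverse of [Psi]. *)
Definition level_move (g : C -> C) (a k : R) (c : C) : C :=
  if Rle_dec (GM' c) a then c
  else g (RtoC (exp (stretch a k (GM' c) - GM' c)) * Psi' c)%C.

Lemma level_move_spec (g : C -> C) (t a k : R) (c : C) : 0 < t -> t < a -> 0 < k ->
  (forall w, t < G0' w -> t < GM' (g w)) ->
  (forall c, t < GM' c -> g (Psi' c) = c) ->
  (forall w, t < G0' w -> Psi' (g w) = w) ->
  GM' (level_move g a k c) = stretch a k (GM' c) /\
  level_move g a (/ k) (level_move g a k c) = c.
Proof.
  intros Ht Hta Hk Hg1 Hg2 Hg3. unfold level_move at 1 3.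
  destruct (Rle_dec (GM' c) a) as [H|H].
  - rewrite stretch_low by auto. split; auto. unfold level_move.
    destruct (Rle_dec (GM' c) a); [reflexivity|contradiction].
  - assert (He : esc c c) by (apply GM_pos_escaping; lra).
    destruct (GM_escaping c He) as (H1 & H2 & H3).
    set (x := GM' c) in *. set (w := (RtoC (exp (stretch a k x - x)) * Psi' c)%C).
    assert (Hs : a < stretch a k x) by (rewrite stretch_high by lra; nra).
    assert (Ex := exp_pos (stretch a k x - x)).
    assert (Hw0 : w <> 0%C).
    { now apply RtoC_mult_neq_0. }
    assert (HL : Lgg w = stretch a k x).
    { unfold w. rewrite Lg_scal, ln_exp, <- H2 by auto. ring. }
    assert (Hw : t < G0' w) by (apply G0_gt_iff; [lra|split; auto; lra]).
    assert (Hgw := Hg1 w Hw).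
    destruct (GM_escaping (g w)) as (G1 & G2 & G3); [apply GM_pos_escaping; lra|].
    rewrite Hg3, HL in G2 by auto. split; auto.
    unfold level_move. rewrite G2. destruct (Rle_dec (stretch a k x) a); [lra|].
    rewrite stretch_inv, Hg3 by auto. unfold w.
    rewrite Cmult_assoc, <- RtoC_mult, <- exp_plus.
    replace (x - stretch a k x + (stretch a k x - x)) with 0 by ring.
    rewrite exp_0, Cmult_1_l. apply Hg2. fold x. lra.
Qed.

(** Where GM > t one formula serves both cases, because the stretch is trivial up to [a]. Where GM
    <= t, [GM_closed] keeps nearby potentials below [a], and the map is locally the identity. *)
Lemma level_move_cv (g : C -> C) (t a k : R) (u : nat -> C) (c : C) :
  0 < t -> t < a -> 0 < k ->
  (forall c, t < GM' c -> g (Psi' c) = c) ->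
  seq_cont_on (fun w => t < G0' w) g ->
  Ccv u c -> Ccv (fun n => level_move g a k (u n)) (level_move g a k c).
Proof.
  intros Ht Hta Hk Hg2 Hgc Hu.
  destruct (Rle_lt_dec (GM' c) t) as [Hc|Hc].
  - assert (HN : exists N, forall n, (N <= n)%nat -> GM' (u n) < a).
    { apply NNPP. intro Hn.
      destruct (not_eventually _ Hn) as [p Hp].
      destruct (GM_closed (fun n => u (p n)) c a); try lra.
      - apply Ccv_subs; auto. intro; apply Hp.
      - intro n. apply Rnot_lt_le, Hp. }
    destruct HN as [N HN].
    apply Ccv_ext_loc with u N.
    + intros n Hn. specialize (HN n Hn). unfold level_move.
      destruct (Rle_dec (GM' (u n)) a); auto; lra.
    + unfold level_move. destruct (Rle_dec (GM' c) a); auto; lra.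
  - set (W := fun c => (RtoC (exp (stretch a k (GM' c) - GM' c)) * Psi' c)%C).
    assert (HW : forall c, t < GM' c -> level_move g a k c = g (W c) /\ t < G0' (W c)).
    { intros d Hd. destruct (GM_escaping d) as (H1 & H2 & H3); [apply GM_pos_escaping; lra|].
      assert (Ex := exp_pos (stretch a k (GM' d) - GM' d)).
      assert (Hs : t < stretch a k (GM' d)).
      { destruct (Rle_lt_dec (GM' d) a).
        - now rewrite stretch_low.
        - rewrite stretch_high by lra. nra. }
      split.
      - unfold level_move, W. destruct (Rle_dec (GM' d) a) as [H|H]; auto.
        rewrite stretch_low, Rminus_diag, exp_0, Cmult_1_l by auto. symmetry. auto.
      - apply G0_gt_iff; [lra|]. unfold W. split.
        + now apply RtoC_mult_neq_0.
        + rewrite Lg_scal, ln_exp, <- H2 by auto. lra. }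
    assert (He : esc c c) by (apply GM_pos_escaping; lra).
    assert (HG := GM_cv u c Hu He). assert (HG' := HG). apply is_lim_seq_spec in HG'.
    assert (Hd : 0 < GM' c - t) by lra.
    destruct (HG' (mkposreal _ Hd)) as [N HN]. simpl in HN.
    assert (HN' : forall n, t < GM' (u (N + n)%nat)).
    { intro n. specialize (HN (N + n)%nat ltac:(lia)). apply Rabs_lt_between in HN. lra. }
    apply Ccv_shift with N.
    rewrite (proj1 (HW c Hc)).
    apply Ccv_ext with (fun n => g (W (u (N + n)%nat))).
    + intro n. symmetry. now apply HW.
    + apply (Hgc (fun n => W (u (N + n)%nat))).
      * now apply HW.
      * intro n. now apply HW.
      * apply (Ccv_tail (fun n => W (u n))). apply Ccv_mult; [|now apply Psi_cv].
        apply Ccv_RtoC, exp_cv, is_lim_seq_minus'; auto using stretch_cv.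
Qed.

Lemma sublevel_disk (t' t : R) : 0 < t' -> t' < t ->
  (forall c, t' < GM' c -> Omega_star' c) ->
  closed_topological_disk (fun c => GM' c <= t).
Proof.
  intros Ht' Htt HO.
  destruct (Psi_homeomorphism t' Ht' HO) as (g & _ & Hg1 & Hg2 & Hg3 & _ & Hgc).
  (* Between t' and a nothing moves, a collar that glues the slide to the identity inside. T is a
     level at which [blend] respects potentials, and [k] is the slope sending it to t. *)
  set (a := (t' + t) / 2). set (T := Rmax t (green_bound K 65)).
  assert (HTt : t <= T) by apply Rmax_l. assert (HTb : green_bound K 65 <= T) by apply Rmax_r.
  set (k := (t - a) / (T - a)).
  assert (Ha : t' < a < t) by (unfold a; lra).
  assert (Hk : 0 < k) by (apply Rdiv_lt_0_compat; lra).
  assert (HkT : k * (T - a) = t - a) by (unfold k; field; lra).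
  assert (Hik : 0 < / k) by now apply Rinv_0_lt_compat.
  assert (Hlev : forall c, GM' (level_move g a k c) = stretch a k (GM' c) /\
      level_move g a (/ k) (level_move g a k c) = c)
    by (intro c; apply (level_move_spec g t'); auto; lra).
  assert (Hlev' : forall c, level_move g a k (level_move g a (/ k) c) = c).
  { intro c. destruct (level_move_spec g t' a (/ k) c) as [_ H]; auto; try lra.
    now rewrite Rinv_inv in H. }
  assert (Hst : forall x, x <= T <-> stretch a k x <= t).
  { intro x. destruct (Rle_lt_dec x a).
    - rewrite stretch_low by auto. split; intro; lra.
    - rewrite stretch_high by lra. split; intro; nra. }
  exists (fun z => level_move g a k (blend' (radial' T z))).
  apply compact_homeomorphism with
    (fun c => radial_inv' T (blend_inv' (level_move g a (/ k) c))) 1.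
  - auto.
  - intros u l Hu Hl. replace l with (l - 0)%C by ring.
    apply (Ccv_lim_bound u); auto. intro n.
    replace (u n - 0)%C with (u n) by ring. auto.
  - intros z Hz. rewrite (proj1 (Hlev _)). apply (Hst _), (blend_level T); auto.
    apply radial_disk; auto; lra.
  - intros c Hc. apply (radial_disk T); [lra|]. rewrite radial_radial_inv.
    apply blend_level; auto. rewrite blend_blend_inv.
    apply Hst. rewrite <- (proj1 (Hlev _)), Hlev'. auto.
  - intros z Hz. rewrite (proj2 (Hlev _)), blend_inv_blend. apply radial_inv_radial.
  - intros c Hc. rewrite radial_radial_inv, blend_blend_inv. apply Hlev'.
  - intros u l _ _ Hu. apply (level_move_cv g t'); auto; try lra.
    now apply blend_cv, radial_cv.
Qed.

(** * Rays and equipotentials *)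

Lemma homeomorphism_restrict (X Y B : C -> Prop) (p g : C -> C) :
  (forall c, X c -> Y (p c)) -> (forall w, Y w -> X (g w)) ->
  (forall c, X c -> g (p c) = c) -> (forall w, Y w -> p (g w) = w) ->
  seq_cont_on X p -> seq_cont_on Y g -> (forall w, B w -> Y w) ->
  homeomorphism_on (fun c => X c /\ B (p c)) B p.
Proof.
  intros H1 H2 H3 H4 H5 H6 HB. apply homeomorphism_of_seq with g.
  - now intros z [].
  - intros w Hw. rewrite H4; auto.
  - intros z []. auto.
  - auto.
  - intros u l [] Hu Hl. apply H5; auto. intro n. now destruct (Hu n).
  - intros u l Hl Hu Hul. apply H6; auto.
Qed.

Lemma radial_arc_above (t phi : R) (w : C) : 0 <= t ->
  radial_arc K theta t phi w -> t < G0' w.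
Proof.
  intros Ht (r & Hr & ->). rewrite b_Cmod, <- exp_plus in Hr.
  assert (He := exp_pos (t + - Lgg (cis phi))).
  apply G0_gt_iff; auto. split.
  - apply RtoC_mult_neq_0; [lra|apply cis_neq_0].
  - rewrite Lg_scal by (auto using cis_neq_0; lra).
    apply ln_increasing in Hr; auto. rewrite ln_exp in Hr. lra.
Qed.

Lemma equipotential_jordan (t : R) : 0 < t -> jordan_curve (fun w => G0' w = t).
Proof.
  intro Ht. exists (radial' t).
  assert (Hn : forall z : C, Cmod z = 1 -> z <> 0%C) by (intros z Hz; apply Cmod_pos_iff; lra).
  apply compact_homeomorphism with (radial_inv' t) 1.
  - intros; lra.
  - intros u l Hu Hl. assert (H := Ccv_Cmod u l Hl).
    apply is_lim_seq_ext with (v := fun _ => 1) in H; [|auto].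
    apply is_lim_seq_unique in H. rewrite Lim_seq_const in H. now injection H.
  - intros z Hz. apply G0_eq_iff; auto. destruct (radial_eq t z (Hn z Hz)) as (_ & H1 & H2).
    split; auto. rewrite H2, Hz, ln_1. ring.
  - intros w Hw. apply G0_eq_iff in Hw; auto. destruct Hw as [Hw HL].
    destruct (radial_inv_eq t w Hw) as (_ & _ & ->). rewrite HL, Rminus_diag. apply exp_0.
  - intros z _. apply radial_inv_radial.
  - intros w _. apply radial_radial_inv.
  - intros u l _ _ Hu. now apply radial_cv.
Qed.

Lemma equipotential_scaled_boundary (t : R) (w : C) : 0 < t ->
  (G0' w = t <->
   exists z, boundary (esc 0) z /\ w = (RtoC (exp t) * z)%C).
Proof.
  intro Ht. rewrite G0_eq_iff by auto. split.
  - intros [Hw HL]. exists (RtoC (exp (- t)) * w)%C.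
    assert (He := exp_pos (- t)). split.
    + apply boundary0_iff. split.
      * now apply RtoC_mult_neq_0.
      * rewrite Lg_scal, ln_exp by auto. lra.
    + rewrite Cmult_assoc, <- RtoC_mult, <- exp_plus, Rplus_opp_r, exp_0. ring.
  - intros (z & Hz & ->). apply boundary0_iff in Hz. destruct Hz as [Hz HL].
    assert (He := exp_pos t). split.
    + now apply RtoC_mult_neq_0.
    + rewrite Lg_scal, ln_exp by auto. lra.
Qed.

Lemma carries_above (t' : R) : 0 < t' ->
  (forall c, t' < GM' c -> Omega_star' c) ->
  homeomorphism_on (fun c => t' < GM' c) (fun w => t' < G0' w) (Psi') /\
  (forall c, t' < GM' c -> G0' (Psi' c) = GM' c) /\
  (forall phi, homeomorphism_on (parameter_ray K theta t' phi)
     (radial_arc K theta t' phi) (Psi')) /\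
  (forall t, t' < t -> homeomorphism_on (parameter_equipotential K theta t' t)
     (fun w => G0' w = t) (Psi')).
Proof.
  intros Ht' HO.
  destruct (Psi_homeomorphism t' Ht' HO) as (g & H1 & H2 & H3 & H4 & H5 & H6).
  split; [|split; [|split]].
  - now apply homeomorphism_of_seq with g.
  - intros c Hc. destruct (GM_escaping c) as (E1 & E2 & E3); [apply GM_pos_escaping; lra|].
    apply G0_eq_iff; auto.
  - intro phi. apply (homeomorphism_restrict _ (fun w => t' < G0' w) _ _ g); auto.
    intros w. apply radial_arc_above. lra.
  - intros t Ht. apply (homeomorphism_restrict _ (fun w => t' < G0' w)
      (fun w => G0' w = t) _ g); auto.
    intros w ->. lra.
Qed.

(** Without an admissible level below t, t would be a lower bound of the set whose infimum is
    [t0]. *)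
Lemma above_t0 (t : R) : Rbar_lt (t0 K theta) t ->
  exists t', 0 < t' /\ t' < t /\ forall c, t' < GM' c -> Omega_star' c.
Proof.
  intro H. apply NNPP. intro Hn.
  assert (Hlb : is_lb_Rbar (fun t => 0 < t /\ forall s, t <= s ->
      forall c, s < GM' c -> Omega_star' c) t).
  { intros x [Hx HO]. simpl. apply Rnot_lt_le. intro Hlt. apply Hn. exists x.
    split; [|split]; auto. apply HO. lra. }
  assert (HG := proj2 (Glb_Rbar_correct _) t Hlb).
  unfold t0 in H. exact (Rbar_lt_not_le _ _ H HG).
Qed.

End Stretch.

Theorem corollary1p8 (K theta : R) (hK : 1 < K)
    (htheta : - PI / 2 < theta <= PI / 2) :
  (forall t : R, Rbar_lt (t0 K theta) t ->
     closed_topological_disk (fun c => GM K theta c <= t) /\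
     (forall c, mandelbrot K theta c -> GM K theta c <= t)) /\
  carries_rays_and_equipotentials_above K theta (t0 K theta).
Proof.
  split.
  - intros t Ht. destruct (above_t0 K theta t Ht) as (t' & H0 & H1 & HO). split.
    + now apply (sublevel_disk K theta hK t').
    + intros c Hc. rewrite (GM_BO K theta hK); [lra|].
      now apply (escaping_critical K theta hK).
  - intros t Ht. destruct (above_t0 K theta t Ht) as (t' & H0 & H1 & HO).
    destruct (carries_above K theta hK t) as (A1 & A2 & A3 & A4); [lra| |].
    { intros c Hc. apply HO. lra. }
    split; [|split; [|split]]; auto.
    intros s Hs. split; [auto|split].
    + apply (equipotential_jordan K theta hK). lra.
    + intro w. apply (equipotential_scaled_boundary K theta hK). lra.
Qed.
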